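(* Let $k\ge0$, $l\ge1$, $m\ge1$ be integers and let $0<\tau\le\min(m,l)$. Let $L$ be the configuration of the generalized link $C_{k,l}^m(\tau)$ defined in the context, with components $\alpha_1,\dots,\alpha_k$ (closed), $\beta_1,\dots,\beta_l$ and $\gamma_1,\dots,\gamma_m$ (arcs). Then $L$ is strongly critical for minimizing length (all weights equal to $1$) when constrained by Gehring thickness.
   Context: GENERALIZED LINKS AND CRITICALITY. A generalized link $L$ is a curve in $\mathbb{R}^3$ with finitely many, mutually disjoint components $L_i$ (arcs or closed curves), where each endpoint $x\in\partial L$ is constrained to stay on a given affine subspace $M_x\subset\mathbb{R}^3$, together with finitely many obstacles $\{p\in\mathbb{R}^3: g_j(p)<0\}$, with $g_j$ of class $C^1$ having $0$ as a regular value; $L$ must lie in $\{\min_j g_j\ge 0\}$. The Gehring thickness $\mathrm{GThi}(L)$ is the minimal distance between points on different components of $L$. The Gehring ropelength problem is to minimize length subject to $\mathrm{GThi}\ge1$. A Gehring strut is an unordered pair $\{x,y\}$ of points on different components with $|x-y|=\mathrm{GThi}(L)$; a wall strut is a pair $(j,x)$ with $x\in L$, $g_j(x)=0$. A compatible vectorfield is a continuous $\xi:L\to\mathbb{R}^3$ (continuous along the parametrized curve) with $\xi_x$ tangent to $M_x$ at each endpoint $x$. The first variation of length of a component with unit tangent $T$ (of bounded variation) is $\delta_\xi\mathrm{Len}=[T\cdot\xi]_{\mathrm{start}}^{\mathrm{end}}-\int\xi\cdot dT$ (no boundary term for closed components), and $\delta_\xi\mathrm{Len}(L)=\sum_i \delta_\xi\mathrm{Len}(L_i)$.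 Put $\delta^+_\xi\mathrm{GThi}(L)=\min (\xi_x-\xi_y)\cdot\frac{x-y}{|x-y|}$ over all Gehring struts $\{x,y\}$, and $\delta^+_\xi O(L)=\min \xi_x\cdot\nabla g_j(x)$ over all wall struts $(j,x)$; these are the one-sided first variations of $\mathrm{GThi}$ and of $O(L)=\min_j\min_{x\in L}g_j(x)$. $L$ is strongly critical for minimizing length when constrained by $\mathrm{GThi}$ if there is $\varepsilon>0$ such that for all compatible $\xi$ with $\delta_\xi\mathrm{Len}(L)=-1$ we have $\min(\delta^+_\xi\mathrm{GThi}(L),\delta^+_\xi O(L))\le-\varepsilon$. WEIGHTED CLASP ARCS. Use coordinates $(x_1,x_2,z)$ on $\mathbb{R}^3$ with $z$ vertical, and let $P_i$ be the $x_iz$-coordinate plane. Given $\tau_1,\tau_2\in(0,1]$, for $\{i,j\}=\{1,2\}$ and $u\in[0,\tau_i]$ set $v=\tau_j(1-u/\tau_i)$ and $$X_i(u)=\sqrt{\frac{u^2(1-v^2)}{1-u^2v^2}},\qquad Z_i(u)=\int_0^u\frac{s}{\sqrt{1-s^2}}\,X_i'(s)\,ds,$$ extended to $[-\tau_i,\tau_i]$ by $X_i(-u)=-X_i(u)$, $Z_i(-u)=Z_i(u)$. Let $h=Z_2(\tau_2)+\sqrt{1-\tau_2^2}=Z_1(\tau_1)+\sqrt{1-\tau_1^2}$. Here $|u|$ is the absolute value of the $z$-component of the unit tangent of the arcs used below. THE GENERALIZED LINK. $C_{1,1}^1(\tau)$ is the connect sum of a clasp of two arcs $\beta$ (ends attached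 to lower planes) and $\gamma$ (ends attached to upper planes) with a Hopf link: a closed component $\alpha$ is added which is linked to $\gamma$ but not to $\beta$. $C_{k,l}^m(\tau)$ is obtained by replacing $\alpha,\beta,\gamma$ by $k,l,m$ parallel copies respectively, the planes containing the ends of the $\beta$ copies being at angle $\arcsin(\tau/l)$ from the vertical, those for the $\gamma$ copies at angle $\arcsin(\tau/m)$. CONFIGURATION. Let $n=k+l$ and use the arcs above with $\tau_1=\tau/n$, $\tau_2=\tau/m$. ''Outer parallel at distance $d$'' of a convex planar $C^1$ curve means the curve obtained by moving each point a distance $d$ along the outward normal in its plane. (i) $\gamma_1\subset P_2$ is the arc $\{(0,X_2(u),Z_2(u)):|u|\le\tau/m\}$ (with tip at the origin), and for $1\le j\le m$, $\gamma_j$ is the outer (downward at the tip) parallel of this arc at distance $j-1$, extended at its two ends $u=\pm\tau/m$ by straight segments in directions $m_\pm=(0,\pm\sqrt{1-(\tau/m)^2},\tau/m)$ until they meet the planes $m_\pm\cdot p=c_2$. The tip of $\gamma_j$ is $q_j=(0,0,-(j-1))$. (ii) Let $A\subset P_1$ be the convex closed curve consisting of: the arc $\{(X_1(u),0,h-Z_1(u)):|u|\le\tau/n\}$; the arcs of the unit circle in $P_1$ about $q_1=(0,0,0)$ from its endpoints $(\pm\tau/n,0,\sqrt{1-(\tau/n)^2})$ to $(\pm1,0,0)$; the vertical segments from $(\pm1,0,0)$ to $(\pm1,0,-(m-1))$; and the lower unit semicircle in $P_1$ about $q_m$. For $1\le j\le k$, $\alpha_j$ is the outer parallel of $A$ at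 distance $j-1$. (iii) For $1\le j\le l$, $\beta_j$ is the outer parallel at distance $k+j-1$ of the part of the upper portion $A\cap\{z\ge0\}$ of $A$ on which the unit tangent has $z$-component of absolute value at most $\tau/l$, extended at its two ends by straight tangent segments in directions $n_\pm=(\pm\sqrt{1-(\tau/l)^2},0,-\tau/l)$ until they meet the planes $n_\pm\cdot p=c_1$. Each endpoint $x$ has as constraint $M_x$ the plane just named on which it lies. The obstacles are given by $g=c_1-n_\pm\cdot p$ and $g=c_2-m_\pm\cdot p$, i.e. $L$ must stay in $\{n_\pm\cdot p\le c_1,\ m_\pm\cdot p\le c_2\}$; the constants $c_1,c_2$ are fixed and large enough that all components lie in this region. If $k=0$ there are no $\alpha$ components. *)

(* Defs.v *)
From HB Require Import structures.
From mathcomp Require Import all_boot all_order all_algebra.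
From mathcomp Require Import all_classical all_reals all_analysis.

Set Implicit Arguments.
Unset Strict Implicit.
Unset Printing Implicit Defensive.

Import Order.TTheory GRing.Theory Num.Theory.
Import numFieldNormedType.Exports.

Local Open Scope classical_set_scope.
Local Open Scope ring_scope.

Section GeneralizedLinks.
Variable R : realType.

Notation V := 'rV[R]_3.

(* The library norm on row vectors is the sup norm, hence the Euclidean
   structure below; topologically the two agree. *)
Definition dot (p q : V) : R := \sum_(i < 3) p ord0 i * q ord0 i.
Definition enorm (p : V) : R := Num.sqrt (dot p p).
Definition direction (p : V) : V := (enorm p)^-1 *: p.

Definition gradient (g : V -> R) (p : V) : V :=
  \row_(i < 3) 'D_(delta_mx ord0 i) g p.

Record curve := Curve {
  lo : R;
  hi : R;
  param :> R -> V;
  closed_curve : bool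
}.

Definition points (K : curve) : set V := [set K t | t in `[lo K, hi K]].

(* Unit tangent as a limit of secant directions: it does not depend on the
   speed of the parametrization, and makes sense where the derivative of the
   parametrization vanishes or blows up. On a closed curve hi and lo represent
   the same point, so the tangent at hi is the tangent at lo. *)
Definition forward_tangent (K : curve) (t : R) : V :=
  lim (direction (K s - K t) @[s --> t^'+]).
Definition backward_tangent (K : curve) (t : R) : V :=
  lim (direction (K t - K s) @[s --> t^'-]).
Definition tangent (K : curve) (t : R) : V :=
  if t < hi K then forward_tangent K t
  else if closed_curve K then forward_tangent K (lo K)
  else backward_tangent K t.

(* Riemann-Stieltjes integral of f . dg over [a, b], as the limit over tagged
   partitions a = x_0 < ... < x_n = b of vanishing mesh; it exists for f
   continuous and g of bounded variation. *)
Definition is_RS_integral (f g : R -> V) (a b I : R) : Prop :=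
  forall e : R, 0 < e -> exists2 d : R, 0 < d &
    forall (s : seq R) (xi : nat -> R), itv_partition a b s ->
      let x := nth b (a :: s) in
      (forall i, (i < size s)%N ->
         x i.+1 - x i < d /\ x i <= xi i <= x i.+1) ->
      `| I - \sum_(i < size s) dot (f (xi i)) (g (x i.+1) - g (x i)) | < e.

Definition RS_integral (f g : R -> V) (a b : R) : R :=
  get [set I | is_RS_integral f g a b I].

Record genlink := GenLink {
  comp : finType;
  component : comp -> curve;
  (* constraint subspaces at the two ends; irrelevant for closed components *)
  fix_lo : comp -> set V;
  fix_hi : comp -> set V;
  wall : finType;
  obstacle : wall -> V -> R
}.

Definition in_region (L : genlink) : Prop :=
  forall (i : comp L) (j : wall L) (p : V),
    points (component i) p -> 0 <= obstacle j p.

Definition GThi (L : genlink) : \bar R :=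
  ereal_inf [set e | exists i j : comp L, exists x y : V,
    [/\ i != j, points (component i) x, points (component j) y
      & e = (enorm (x - y))%:E]].

Definition gehring_strut (L : genlink) (x y : V) : Prop :=
  exists i j : comp L,
    [/\ i != j, points (component i) x, points (component j) y
      & (enorm (x - y))%:E = GThi L].

Definition wall_strut (L : genlink) (j : wall L) (x : V) : Prop :=
  (exists i : comp L, points (component i) x) /\ obstacle j x = 0.

(* Only the values of xi on L matter. A vector v is tangent to the affine
   subspace M at x \in M when x + v \in M. *)
Definition compatible (L : genlink) (xi : V -> V) : Prop :=
  forall i : comp L, let K := component i in
    {within `[lo K, hi K], continuous (xi \o K)} /\
    (~~ closed_curve K ->
       fix_lo i (K (lo K) + xi (K (lo K))) /\
       fix_hi i (K (hi K) + xi (K (hi K)))).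

Definition dLen_curve (xi : V -> V) (K : curve) : R :=
  (if closed_curve K then 0
   else dot (tangent K (hi K)) (xi (K (hi K)))
        - dot (tangent K (lo K)) (xi (K (lo K))))
  - RS_integral (xi \o K) (tangent K) (lo K) (hi K).

Definition dLen (L : genlink) (xi : V -> V) : R :=
  \sum_(i : comp L) dLen_curve xi (component i).

Definition dGThi (L : genlink) (xi : V -> V) : \bar R :=
  ereal_inf [set e | exists x y : V, gehring_strut L x y /\
    e = (dot (xi x - xi y) (direction (x - y)))%:E].

Definition dO (L : genlink) (xi : V -> V) : \bar R :=
  ereal_inf [set e | exists (j : wall L) (x : V), wall_strut j x /\
    e = (dot (xi x) (gradient (obstacle j) x))%:E].

Definition strongly_critical (L : genlink) : Prop :=
  exists2 eps : R, 0 < eps &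
    forall xi : V -> V, compatible L xi -> dLen L xi = -1 ->
      (Order.min (dGThi L xi) (dO L xi) <= (- eps)%:E)%E.

End GeneralizedLinks.

Section ClaspArcs.
Variable R : realType.

(* clasp_X t t' and clasp_Z t t' are X_i and Z_i for t = tau_i, t' = tau_j. *)
Definition clasp_X (t t' u : R) : R :=
  let X u := let v := t' * (1 - u / t) in
    Num.sqrt (u ^+ 2 * (1 - v ^+ 2) / (1 - u ^+ 2 * v ^+ 2)) in
  if 0 <= u then X u else - X (- u).

(* For t = 1 the integrand is unbounded near s = 1, but still (Lebesgue)
   integrable. *)
Definition clasp_Z (t t' u : R) : R :=
  \int[lebesgue_measure]_(s in `[0, `|u|])
     (s / Num.sqrt (1 - s ^+ 2) * derive1 (clasp_X t t') s).

End ClaspArcs.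

Section Configuration.
Variable R : realType.

Notation V := 'rV[R]_3.

Definition vec3 (x y z : R) : V := \row_(i < 3) [:: x; y; z]`_i.
Definition x1 (p : V) : R := p ord0 0.
Definition x2 (p : V) : R := p ord0 1.
Definition zc (p : V) : R := p ord0 2.

Definition plane (n : V) (c : R) : set V := [set p | dot n p = c].

(* Parallel at distance d, N sending the unit tangent to the outward normal. *)
Definition parallel (N : V -> V) (d : R) (K : curve R) : curve R :=
  Curve (lo K) (hi K) (fun t => K t + d *: N (tangent K t)) (closed_curve K).

(* Distance travelled from p in the unit direction e before meeting the plane
   e . p = c. It is 0 when that plane lies behind p; then p itself violates
   e . p <= c. *)
Definition travel (e : V) (c : R) (p : V) : R :=
  inf [set t | 0 <= t /\ plane e c (p + t *: e)].

Definition extend (elo ehi : V) (c : R) (K : curve R) : curve R :=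
  let plo := K (lo K) in
  let phi := K (hi K) in
  Curve (lo K - travel elo c plo) (hi K + travel ehi c phi)
    (fun t => if t < lo K then plo + (lo K - t) *: elo
              else if t <= hi K then K t
              else phi + (t - hi K) *: ehi)
    false.

Variables (k l m : nat) (tau : R).

Let n := (k + l)%N.
Let t1 : R := tau / n%:R.
Let t2 : R := tau / m%:R.

(* The equality with clasp_Z t2 t1 t2 + Num.sqrt (1 - t2 ^+ 2) is a property of
   the clasp arcs. *)
Definition height : R := clasp_Z t1 t2 t1 + Num.sqrt (1 - t1 ^+ 2).

(* m_+ = m_dir false, m_- = m_dir true, and likewise for n_dir. *)
Definition m_dir (s : bool) : V :=
  vec3 0 ((-1) ^+ s * Num.sqrt (1 - (tau / m%:R) ^+ 2)) (tau / m%:R).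
Definition n_dir (s : bool) : V :=
  vec3 ((-1) ^+ s * Num.sqrt (1 - (tau / l%:R) ^+ 2)) 0 (- (tau / l%:R)).

Definition gamma_tip_arc : curve R :=
  Curve (- t2) t2 (fun u => vec3 0 (clasp_X t2 t1 u) (clasp_Z t2 t1 u)) false.

(* gamma is convex upwards and traversed with x2 increasing: outward is on the
   right of the tangent. *)
Definition gamma_normal (T : V) : V := vec3 0 (zc T) (- x2 T).

Definition gamma_curve (c2 : R) (j : nat) : curve R :=
  extend (m_dir true) (m_dir false) c2
    (parallel gamma_normal j%:R gamma_tip_arc).

(* Right half of A from its top (s = 0) to its bottom (s = m + pi / 2). On the
   clasp arc and on the circle around q_1 the parameter is the u of the clasp
   arcs, that is, the sine of the angle between tangent and horizontal. *)
Definition A_right (s : R) : R * R :=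
  if s <= t1 then (clasp_X t1 t2 s, height - clasp_Z t1 t2 s)
  else if s <= 1 then (s, Num.sqrt (1 - s ^+ 2))
  else if s <= m%:R then (1, 1 - s)
  else (cos (s - m%:R), 1 - m%:R - sin (s - m%:R)).

Definition A_curve : curve R :=
  Curve (- (m%:R + pi / 2)) (m%:R + pi / 2)
    (fun t => vec3 ((if 0 <= t then 1 else -1) * (A_right `|t|).1) 0
                   (A_right `|t|).2)
    true.

(* A is convex and traversed clockwise, from the bottom over the negative x1
   side: outward is on the left of the tangent. *)
Definition A_normal (T : V) : V := vec3 (- zc T) 0 (x1 T).

Definition alpha_curve (j : nat) : curve R := parallel A_normal j%:R A_curve.

Definition beta_range : set R :=
  [set t | [/\ lo A_curve <= t <= hi A_curve, 0 <= zc (A_curve t)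
             & `|zc (tangent A_curve t)| <= tau / l%:R]].

Definition beta_tip_arc : curve R :=
  Curve (inf beta_range) (sup beta_range) A_curve false.

Definition beta_curve (c1 : R) (j : nat) : curve R :=
  extend (n_dir true) (n_dir false) c1
    (parallel A_normal (k + j)%:R beta_tip_arc).

Variables c1 c2 : R.

Definition clasp_hopf_component (i : 'I_k + 'I_l + 'I_m) : curve R :=
  match i with
  | inl (inl j) => alpha_curve j
  | inl (inr j) => beta_curve c1 j
  | inr j => gamma_curve c2 j
  end.

(* s = true is the start of the arc, s = false its end. *)
Definition clasp_hopf_fix (s : bool) (i : 'I_k + 'I_l + 'I_m) : set V :=
  match i with
  | inl (inl _) => setT
  | inl (inr _) => plane (n_dir s) c1
  | inr _ => plane (m_dir s) c2
  end.

Definition clasp_hopf_obstacle (w : bool + bool) (p : V) : R :=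
  match w with
  | inl s => c1 - dot (n_dir s) p
  | inr s => c2 - dot (m_dir s) p
  end.

Definition clasp_hopf : genlink R :=
  GenLink clasp_hopf_component (clasp_hopf_fix true) (clasp_hopf_fix false)
    clasp_hopf_obstacle.

End Configuration.

(* Main.v *)
From HB Require Import structures.
Require Import Defs.
From mathcomp Require Import all_boot all_order all_algebra.
From mathcomp Require Import all_classical all_reals all_analysis.
From mathcomp Require Import measurable_realfun ring lra.

Set Implicit Arguments.
Unset Strict Implicit.
Unset Printing Implicit Defensive.

Import Order.TTheory GRing.Theory Num.Theory.
Import numFieldNormedType.Exports.

Local Open Scope classical_set_scope.
Local Open Scope ring_scope.

(** The link is balanced: the struts carry forces which cancel its curvature
force. This is used in the following quantitative form. If a compatible field
shortens no strut at a rate above [eps], then the first variation of length is at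
least [- C * eps], where [C] depends on the configuration only ([dLen_ge]). Hence
every field with first variation [-1] shortens some strut at a rate bounded below.
The boundary terms vanish, because the arcs end orthogonally on the planes, so
the first variation of each component is the integral of its curvature against
the outward normal component of the field.

The forces are transmitted as follows. Struts between consecutive parallels pass
the curvature forces to the innermost strand and hoop ([push_ge],
[hoop_push_ge]). The innermost closed curve consists of a clasp arc, two arcs of
the unit circle about the tip of the first hoop, two vertical segments and a unit
semicircle about the tip of the last hoop. Each point of the circular arcs has a
strut to the corresponding center ([push_circle], [push_bottom]); the forces at
both centers add up to vertical ones of the same size, one for each end of each
closed strand, which cancel through the struts between the tips of the hoops
([tips_bound]). On the clasp arcs the point at [u] is joined to the point at
[v = b - b / a * u] of the other arc by a strut normal to both arcs, and the four
struts arising from the symmetries are in balance ([clasp_push]). The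
substitution [u -> v] matches the curvature measures of [k + l] upper arcs and
[m] lower ones.

These pairs are struts because the thickness is 1 ([GThi_link]). Parallels are
at distance at least 1 by convexity ([parallel_dist]). The distance between the
two clasp arcs has its minimum, for one fixed point, at the conjugate point
([clasp_arc_dist]), which rests on the identity [clasp_height_split] for the
vertical distance of conjugate points; passing to parallels and to the straight
ends increases distances ([strand_hoop_dist]).

The curvatures may be unbounded, and the parametrizations singular, at the ends
of the arcs. Therefore curves are described by a tangent angle which has an
integrable density, in the sense of [density], and which governs the directions of
all chords, in the sense of [sweeps]. The latter gives the unit tangents as limits
of chords ([swept_tangent]) as well as convexity ([sweeps_support]), and the
former turns Riemann-Stieltjes integrals into integrals of the curvature
([RS_integral_turning]). *)

(** * Integrals over segments *)

Section SegmentIntegrals.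
Variable R : realType.
Implicit Types (f g F w phi : R -> R) (a b c x y : R).

Notation mu := (@lebesgue_measure R).

Definition sint f a b : R := \int[mu]_(x in `[a, b]) f x.
Definition sintegrable f a b : Prop := mu.-integrable `[a, b] (EFin \o f).

Lemma sintegrable_sub f a b x y :
  a <= x -> y <= b -> sintegrable f a b -> sintegrable f x y.
Proof.
move=> ax yb; apply: integrableS => //.
by apply: subset_itv; rewrite bnd_simp.
Qed.

Lemma itvcc_setU a b c : a <= b -> b <= c ->
  `[a, c]%classic = `[a, b] `|` `]b, c] :> set R.
Proof. by move=> ab bc; apply: itv_bndbnd_setU; rewrite bnd_simp. Qed.

Lemma itvcc_disj a b c : [disjoint (`[a, b]%classic : set R) & `]b, c]%classic].
Proof.
apply/disj_setPS => x [] /=; rewrite !in_itv/= => /andP[_ xb] /andP[bx _].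
by rewrite leNgt bx in xb.
Qed.

Lemma sintegrable_cat f a b c : a <= b -> b <= c ->
  sintegrable f a b -> sintegrable f b c -> sintegrable f a c.
Proof.
move=> ab bc fab fbc; rewrite /sintegrable (itvcc_setU ab bc).
have fbc' : mu.-integrable `]b, c] (EFin \o f).
  by apply: integrableS fbc => //; apply: subset_itvr; rewrite bnd_simp.
move: fab fbc' => /integrableP[mf1 f1] /integrableP[mf2 f2].
apply/integrableP; split; first exact/measurable_funU.
rewrite ge0_integral_setU//; [exact: lte_add_pinfty| |exact: itvcc_disj].
apply/measurable_funU => //; split; exact: measurableT_comp.
Qed.

Lemma sint_cat f a b c : a <= b -> b <= c -> sintegrable f a c ->
  sint f a c = sint f a b + sint f b c.
Proof.
move=> ab bc fac; rewrite /sint (itvcc_setU ab bc) Rintegral_setU//.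
- rewrite Rintegral_itv_obnd_cbnd//; apply: integrableS fac => //.
  by apply: subset_itv; rewrite bnd_simp.
- by rewrite -itvcc_setU.
- exact: itvcc_disj.
Qed.

Lemma sintegrable_oo f a b :
  mu.-integrable `]a, b[ (EFin \o f) -> sintegrable f a b.
Proof.
move=> /integrableP[mf fi]; apply/integrableP; split.
  apply/measurable_EFinP; apply: (@measurable_fun_itv_cc _ a b false true).
  exact/measurable_EFinP.
rewrite integral_itv_bndoo//; exact: measurableT_comp.
Qed.

Lemma sint_oo f a b : sintegrable f a b -> sint f a b = \int[mu]_(x in `]a, b[) f x.
Proof.
move=> fi; rewrite /sint /Rintegral integral_itv_bndoo//.
have : mu.-integrable `]a, b[ (EFin \o f).
  by apply: integrableS fi => //; exact: subset_itv_oo_cc.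
exact: measurable_int.
Qed.

Lemma eq_sintegrable f g a b : (forall x, a < x < b -> f x = g x) ->
  sintegrable f a b -> sintegrable g a b.
Proof.
move=> fg fi; apply: sintegrable_oo.
have : mu.-integrable `]a, b[ (EFin \o f).
  by apply: integrableS fi => //; exact: subset_itv_oo_cc.
by apply: eq_integrable => // x; rewrite inE/= in_itv/= => /fg ->.
Qed.

Lemma eq_sint f g a b : (forall x, a < x < b -> f x = g x) ->
  sintegrable f a b -> sint f a b = sint g a b.
Proof.
move=> fg fi; rewrite !sint_oo//; last exact: eq_sintegrable fg fi.
by apply: eq_Rintegral => x; rewrite inE/= in_itv/= => /fg.
Qed.

Lemma sint_pt f a : sint f a a = 0.
Proof. by rewrite /sint set_itv1 Rintegral_set1. Qed.

Lemma sintegrable_pt f a : sintegrable f a a.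
Proof.
rewrite /sintegrable set_itv1; apply: null_set_integrable => //.
  apply/measurable_EFinP; exact: measurable_fun_set1.
exact: lebesgue_measure_set1.
Qed.

Lemma sintegrable_continuous f a b : {within `[a, b], continuous f} -> sintegrable f a b.
Proof. by move=> cf; apply: continuous_compact_integrable => //; exact: segment_compact. Qed.

Lemma sintegrableD f g a b : sintegrable f a b -> sintegrable g a b ->
  sintegrable (fun x => f x + g x) a b.
Proof. by move=> fi gi; apply: integrableD fi gi. Qed.

Lemma sintegrableZ k f a b : sintegrable f a b -> sintegrable (fun x => k * f x) a b.
Proof. by move=> fi; apply: integrableZl fi. Qed.

Lemma sintD f g a b : sintegrable f a b -> sintegrable g a b ->
  sint (fun x => f x + g x) a b = sint f a b + sint g a b.
Proof. by move=> fi gi; rewrite /sint RintegralD. Qed.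

Lemma sintZ k f a b : sintegrable f a b -> sint (fun x => k * f x) a b = k * sint f a b.
Proof. by move=> fi; rewrite /sint RintegralZl. Qed.

Lemma le_sint f g a b : sintegrable f a b -> sintegrable g a b ->
  (forall x, a < x < b -> f x <= g x) -> sint f a b <= sint g a b.
Proof.
move=> fi gi fg; rewrite !sint_oo//; apply: le_Rintegral => //.
- by apply: integrableS fi => //; exact: subset_itv_oo_cc.
- by apply: integrableS gi => //; exact: subset_itv_oo_cc.
Qed.

Lemma within_sub f a b x y : a <= x -> y <= b ->
  {within `[a, b], continuous f} -> {within `[x, y], continuous f}.
Proof.
move=> ax yb; apply: continuous_subspaceW.
by apply: subset_itv; rewrite bnd_simp.
Qed.

Lemma segment_bounded f a b : {within `[a, b], continuous f} ->
  exists2 M : R, 0 < M & forall x, a <= x <= b -> `|f x| <= M.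
Proof.
move=> cf; have [ab|ba] := leP a b; last first.
  by exists 1 => // x /andP[/le_trans h /h]; rewrite leNgt ba.
have cn : {within `[a, b], continuous (fun x => `|f x|)}.
  by move=> x; apply: continuous_comp; [exact: cf|exact: norm_continuous].
have [c cab hc] := EVT_max ab cn.
exists (`|f c| + 1); first by rewrite ltr_wpDl.
move=> x xI; apply: (@le_trans _ _ `|f c|); last by rewrite lerDl.
by apply: hc; rewrite in_itv.
Qed.

Lemma sintegrable_mul phi w a b : {within `[a, b], continuous phi} ->
  sintegrable w a b -> sintegrable (fun x => phi x * w x) a b.
Proof.
move=> cphi wi; apply: (@integrableMr _ _ R mu `[a, b]%classic _ phi (EFin \o w)) => //.
  by apply: subspace_continuous_measurable_fun.
have [M _ hM] := segment_bounded cphi.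
exists M; split; [exact: num_real|move=> N /ltW MN x xab].
by apply: le_trans MN; apply: hM; rewrite /= in_itv in xab.
Qed.

(** The integrand may blow up at both ends, as curvatures and slopes of the clasp
arcs do; positivity turns exhaustion by inner segments into monotone
convergence. *)
Lemma ge0_FTC2 f F a b : a <= b -> {within `[a, b], continuous F} ->
  (forall x, a < x < b -> is_derive x 1 F (f x)) ->
  (forall x, a < x < b -> {for x, continuous f}) ->
  (forall x, a < x < b -> 0 <= f x) ->
  sintegrable f a b /\ sint f a b = F b - F a.
Proof.
rewrite le_eqVlt => /predU1P[<-|ab] cF dF cf f0.
  by split; [exact: sintegrable_pt|rewrite sint_pt subrr].
pose d n : R := (b - a) / n.+3%:R.
have d0 n : 0 < d n by rewrite divr_gt0 ?subr_gt0.
have dab n : a + d n < b - d n.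
  have : d n * n.+3%:R = b - a by rewrite /d divfK.
  have : 3 <= n.+3%:R :> R by rewrite ler_nat.
  have := d0 n; nra.
pose E n : set R := `[a + d n, b - d n]%classic.
have in_oo n x : E n x -> a < x < b.
  rewrite /E/= in_itv/= => /andP[h1 h2]; have := d0 n; lra.
have dS m n : (m <= n)%N -> d n <= d m.
  by move=> mn; rewrite ler_pM2l ?subr_gt0// lef_pV2 ?posrE ?ltr0n// ler_nat.
have Endecr : nondecreasing_seq E.
  move=> m n mn; rewrite subsetEset; apply: subset_itv; rewrite bnd_simp.
    by rewrite lerD2l dS.
  by rewrite lerB// dS.
have d_cvg : d n @[n --> \oo] --> (0 : R).
  rewrite -(mulr0 (b - a)); apply: cvgZr.
  apply: (@cvg_comp _ _ _ (fun n => n.+2) (fun n : nat => n.+1%:R^-1) _ \oo).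
    by have := cvg_addnr 2; apply: cvg_trans; apply: near_eq_cvg; near=> n; rewrite addn2.
  exact: cvg_harmonic.
have Ucup : \bigcup_n E n = `]a, b[%classic.
  apply/seteqP; split => x /=.
    by move=> [n _ /in_oo]; rewrite in_itv.
  rewrite in_itv/= => /andP[ax xb].
  have e0 : 0 < Num.min (x - a) (b - x) by rewrite lt_min !subr_gt0 ax.
  have /cvgrPdist_lt /(_ _ e0) [n _ /(_ n (leqnn n))] := d_cvg.
  rewrite /= sub0r normrN gtr0_norm// lt_min => /andP[h1 h2].
  by exists n => //; rewrite /E/= in_itv/=; apply/andP; split; lra.
have mf : measurable_fun `]a, b[ f.
  by apply: open_continuous_measurable_fun => // x; rewrite inE/= in_itv/=; exact: cf.
have intE n : (\int[mu]_(x in E n) (f x)%:E = (F (b - d n) - F (a + d n))%:E)%E.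
  have sub x : x \in `]a + d n, b - d n[ -> a < x < b.
    by rewrite in_itv/= => /andP[h1 h2]; apply: (in_oo n); rewrite /E/= in_itv/= !ltW.
  rewrite (@continuous_FTC2 _ f F) ?EFinB//.
  - apply: continuous_in_subspaceT => x; rewrite inE => /in_oo; exact: cf.
  - have cF' x : a < x < b -> {for x, continuous F}.
      by move=> /dF df; apply/differentiable_continuous/derivable1_diffP.
    have h : {within `[a + d n, b - d n], continuous F}.
      by apply: within_sub cF; have := d0 n; lra.
    move/(continuous_within_itvP _ (dab n)): h => [_ h1 h2]; split => //.
    by move=> x /sub/dF df.
  - by move=> x /sub/dF df; rewrite derive1E derive_val.
have mE i : measurable (E i) by exact: measurable_itv.
have mfE i : measurable_fun (E i) (EFin \o f).
  apply/measurable_EFinP; apply: measurable_funS mf => // x /in_oo; by rewrite /= in_itv.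
have fE0 i x : E i x -> (0 <= (EFin \o f) x)%E by move=> /in_oo/f0; rewrite lee_fin.
have := ge0_nondecreasing_set_cvg_integral Endecr mE mfE fE0 (mu := mu).
rewrite Ucup => h1.
have h2 : (\int[mu]_(x in E i) ((EFin \o f) x))%E @[i --> \oo] --> (F b - F a)%:E.
  under eq_fun do rewrite /= intE.
  apply: cvg_EFin; first by near=> n.
  move/(continuous_within_itvP _ ab): cF => [_ Fa Fb].
  apply: cvgB.
    apply: (cvg_comp _ _ _ Fb) => P [e e0 Pe].
    have /cvgrPdist_lt /(_ _ e0) := d_cvg.
    apply: filterS => n; rewrite sub0r normrN => dn; apply: Pe => /=.
      by rewrite opprB addrC subrK.
    by rewrite ltrBlDr ltrDl.
  apply: (cvg_comp _ _ _ Fa) => P [e e0 Pe].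
  have /cvgrPdist_lt /(_ _ e0) := d_cvg.
  apply: filterS => n; rewrite sub0r normrN => dn; apply: Pe => /=.
    by rewrite opprD addNKr normrN.
  by rewrite ltrDl.
have intF := cvg_unique (@ereal_hausdorff R) h1 h2.
have fi : sintegrable f a b.
  apply: sintegrable_oo; apply/integrableP; split; first exact/measurable_EFinP.
  rewrite (_ : \int[mu]_(x in _) _ = (F b - F a)%:E)%E ?ltry// -intF.
  apply: eq_integral => x; rewrite inE/= in_itv/= => /f0 fx0.
  by rewrite ger0_norm.
by split => //; rewrite sint_oo// /Rintegral intF.
Unshelve. all: by end_near. Qed.

Lemma preimage_affine_oc (p q a b : R) : p < 0 ->
  (fun x => p * x + q) @^-1` `]a, b]%classic = `[(b - q) / p, (a - q) / p[%classic.
Proof.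
move=> p0; apply/seteqP; split => x /=; rewrite !in_itv/=;
  by rewrite ler_ndivrMr// ltr_ndivlMr// ltrBlDr lerBrDr mulrC andbC.
Qed.

Lemma preimage_affine_cc (p q a b : R) : p < 0 ->
  (fun x => p * x + q) @^-1` `[a, b]%classic = `[(b - q) / p, (a - q) / p]%classic.
Proof.
move=> p0; apply/seteqP; split => x /=; rewrite !in_itv/=;
  by rewrite ler_ndivrMr// ler_ndivlMr// lerBlDr lerBrDr mulrC andbC.
Qed.

Lemma measurable_affine (p q : R) :
  measurable_fun setT ((fun x => p * x + q) : measurableTypeR R -> measurableTypeR R).
Proof. by apply: measurable_funD => //; apply: measurable_funM. Qed.

Lemma lebesgue_measure_affine (p q : R) (A : set (measurableTypeR R)) :
  p < 0 -> measurable A ->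
  (mu A = (- p)%:E * mu ((fun x : R => (p * x + q)%R) @^-1` A))%E.
Proof.
move=> p0 mA.
pose phi : measurableTypeR R -> measurableTypeR R := fun x => p * x + q.
have mphi : measurable_fun setT phi := measurable_affine p q.
have Np0 : 0 < - p by rewrite oppr_gt0.
pose nu := mscale (NngNum (ltW Np0)) (pushforward mu phi).
have -> // := @lebesgue_measure_unique R (nu mphi) _ A mA.
move=> _ [[a b] _ <-].
transitivity ((- p)%:E * mu (phi @^-1` `]a, b]))%E; last by [].
rewrite (preimage_affine_oc q a b p0 : phi @^-1` _ = _) !lebesgue_measure_itv/=.
rewrite !lte_fin ltr_nM2r ?invr_lt0// ltrD2r; case: ifPn => _; last by rewrite mule0.
by rewrite -!EFinB -EFinM; congr EFin; field; rewrite lt_eqF.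
Qed.

Lemma ge0_integral_change (phi : measurableTypeR R -> measurableTypeR R) (c a b a' b' : R)
    (g : R -> \bar R) :
  measurable_fun setT phi -> 0 < c ->
  (forall A, measurable A -> mu A = (c%:E * mu (phi @^-1` A))%E) ->
  phi @^-1` `[a, b]%classic = `[a', b']%classic ->
  measurable_fun `[a, b] g -> (forall x, 0 <= g x)%E ->
  (\int[mu]_(x in `[a, b]) g x = c%:E * \int[mu]_(x in `[a', b']) g (phi x))%E.
Proof.
move=> mphi c0 muE pre mg g0.
pose nu := mscale (NngNum (ltW c0)) (pushforward mu phi).
rewrite (@eq_measure_integral _ _ _ _ (nu mphi)); last by move=> A mA _; exact: muE.
rewrite ge0_integral_mscale// ge0_integral_pushforward//= ?pre//.
Qed.

Lemma sint_change f (phi : R -> R) (c a b a' b' : R) :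
  measurable_fun setT (phi : measurableTypeR R -> measurableTypeR R) -> 0 < c ->
  (forall A : set (measurableTypeR R), measurable A -> mu A = (c%:E * mu (phi @^-1` A))%E) ->
  phi @^-1` `[a, b]%classic = `[a', b']%classic -> sintegrable f a b ->
  sintegrable (f \o phi) a' b' /\ sint f a b = c * sint (f \o phi) a' b'.
Proof.
move=> mphi c0 muE pre fi.
have mab : measurable (`[a, b]%classic : set R) by [].
move: (fi) => /integrableP[mf fioo].
have mfphi : measurable_fun `[a', b'] (EFin \o (f \o phi)).
  rewrite -pre.
  have := @measurable_comp _ _ _ (measurableTypeR R) (measurableTypeR R) _
    `[a, b]%classic (EFin \o f) (phi @^-1` `[a, b]) phi mab.
  apply => //; first by move=> _ [x /= + <-].
  exact: measurable_funTS.
have key := ge0_integral_change mphi c0 muE pre.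
have fphi : sintegrable (f \o phi) a' b'.
  apply/integrableP; split => //.
  move: fioo; rewrite key//; last exact: measurableT_comp.
  rewrite [X in (_ * X)%E](_ : _ = \int[mu]_(x in `[a', b']) `|(EFin \o (f \o phi)) x|)%E//.
  set I := (\int[mu]_(x in _) _)%E; case: I => [r _|/=|//]; first exact: ltry.
  by rewrite gt0_muley ?lte_fin.
split => //.
apply: EFin_inj; rewrite EFinM /sint /Rintegral !fineK; [|exact: integrable_fin_num..].
have fp : (\int[mu]_(x in `[a', b']) (EFin \o (f \o phi))^\+ x)%E \is a fin_num.
  exact: integrable_pos_fin_num.
have fn : (\int[mu]_(x in `[a', b']) (EFin \o (f \o phi))^\- x)%E \is a fin_num.
  exact: integrable_neg_fin_num.
rewrite [LHS]integralE [X in (_ * X)%E]integralE.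
rewrite (key (EFin \o f)^\+%E)//; last exact: measurable_funepos.
rewrite (key (EFin \o f)^\-%E)//; last exact: measurable_funeneg.
have -> : (\int[mu]_(x in `[a', b']) (EFin \o f)^\+ (phi x) =
    \int[mu]_(x in `[a', b']) ((EFin \o f) \o phi)^\+ x)%E.
  by rewrite (funepos_comp (EFin \o f) phi).
have -> : (\int[mu]_(x in `[a', b']) (EFin \o f)^\- (phi x) =
    \int[mu]_(x in `[a', b']) ((EFin \o f) \o phi)^\- x)%E.
  by rewrite (funeneg_comp (EFin \o f) phi).
have lin (P N : \bar R) : P \is a fin_num -> N \is a fin_num ->
    (c%:E * P - c%:E * N = c%:E * (P - N))%E.
  by case: P => // p; case: N => // n _ _; rewrite -!EFinM -!EFinB mulrBr.
exact: lin.
Qed.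

Lemma sint_affine f (p q a b : R) : p < 0 -> sintegrable f a b ->
  sintegrable (fun x => f (p * x + q)) ((b - q) / p) ((a - q) / p) /\
  sint f a b = - p * sint (fun x => f (p * x + q)) ((b - q) / p) ((a - q) / p).
Proof.
move=> p0; apply: (@sint_change f (fun x => p * x + q) (- p)); rewrite ?oppr_gt0//.
- exact: measurable_affine.
- by move=> A mA; exact: lebesgue_measure_affine.
- exact: preimage_affine_cc.
Qed.

Lemma sint_opp f (a b : R) : sintegrable f a b ->
  sintegrable (fun x => f (- x)) (- b) (- a) /\
  sint f a b = sint (fun x => f (- x)) (- b) (- a).
Proof.
move=> fi; have := sint_affine 0 (ltrN10 R) fi.
rewrite !subr0 invrN1 !mulrN1 opprK mul1r.
by under eq_fun do rewrite mulN1r addr0.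
Qed.

(** Absolute continuity with derivative [w], in integrated form: [w] may blow up
where [F] has a vertical tangent, as for [asin] at the ends of its domain. *)
Definition density w F a b : Prop := sintegrable w a b /\
  forall x y, a <= x -> x <= y -> y <= b -> sint w x y = F y - F x.

Lemma ge0_density w F a b : a <= b -> {within `[a, b], continuous F} ->
  (forall x, a < x < b -> is_derive x 1 F (w x)) ->
  (forall x, a < x < b -> {for x, continuous w}) ->
  (forall x, a < x < b -> 0 <= w x) -> density w F a b.
Proof.
move=> ab cF dF cw w0; split; first by have [] := ge0_FTC2 ab cF dF cw w0.
move=> x y ax xy yb; have in_ab z : x < z < y -> a < z < b.
  by move=> /andP[xz zy]; rewrite (le_lt_trans ax xz) (lt_le_trans zy yb).
have [] // := @ge0_FTC2 w F x y xy.
- exact: within_sub cF.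
- by move=> z /in_ab; exact: dF.
- by move=> z /in_ab; exact: cw.
- by move=> z /in_ab; exact: w0.
Qed.

Lemma density_cat w F a b c : a <= b -> b <= c ->
  density w F a b -> density w F b c -> density w F a c.
Proof.
move=> ab bc [s1 d1] [s2 d2]; have s := sintegrable_cat ab bc s1 s2; split => // x y ax xy yc.
have [yb|by_] := leP y b; first exact: d1.
have [bx|xb] := leP b x; first exact: d2.
rewrite (@sint_cat _ x b y) ?(ltW by_) ?(ltW xb)//; last exact: sintegrable_sub s.
by rewrite (d1 x b) ?(d2 b y) ?(ltW by_) ?(ltW xb)//; ring.
Qed.

Lemma density_sub w F a b x y : a <= x -> y <= b -> density w F a b -> density w F x y.
Proof.
move=> ax yb [s d]; split; first exact: sintegrable_sub s.
move=> u v xu uv vy; apply: d => //; first exact: le_trans xu.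
exact: le_trans yb.
Qed.

Lemma eq_density w w' F F' a b : (forall x, a < x < b -> w x = w' x) ->
  (forall x, a <= x <= b -> F x = F' x) -> density w F a b -> density w' F' a b.
Proof.
move=> ww FF [s d]; split; first exact: eq_sintegrable s.
move=> x y ax xy yb; rewrite -!FF ?ax ?yb ?(le_trans ax xy) ?(le_trans xy yb)//.
rewrite -d//; apply/esym/eq_sint.
  by move=> z /andP[xz zy]; apply: ww; rewrite (le_lt_trans ax xz) (lt_le_trans zy yb).
exact: sintegrable_sub s.
Qed.

Lemma density_cst (F : R -> R) a b :
  (forall x y, a <= x <= b -> a <= y <= b -> F x = F y) -> density (fun=> 0) F a b.
Proof.
move=> FE; split; first by apply: sintegrable_continuous; apply: continuous_subspaceT => ?; exact: cvg_cst.
move=> x y ax xy yb; rewrite (FE y x) ?ax ?yb ?(le_trans ax xy) ?(le_trans xy yb)//.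
by rewrite subrr /sint Rintegral_cst// mul0r.
Qed.

End SegmentIntegrals.

(** * Differentiation of explicit expressions *)

Section ExplicitDerivatives.
Variable R : realType.
Implicit Types (f g : R -> R) (x c : R).

Lemma slope_cst c x : is_derive x (1 : R) (fun=> c) 0.
Proof. exact: is_derive_cst. Qed.

Lemma slope_id x : is_derive x (1 : R) (fun y => y) 1.
Proof. exact: is_derive_id. Qed.

Lemma slope_add f g x df dg : is_derive x 1 f df -> is_derive x 1 g dg ->
  is_derive x (1 : R) (fun y => f y + g y) (df + dg).
Proof. by move=> hf hg; exact: is_deriveD. Qed.

Lemma slope_opp f x df : is_derive x 1 f df -> is_derive x (1 : R) (fun y => - f y) (- df).
Proof. by move=> hf; exact: is_deriveN. Qed.

Lemma slope_mul f g x df dg : is_derive x 1 f df -> is_derive x 1 g dg ->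
  is_derive x (1 : R) (fun y => f y * g y) (df * g x + f x * dg).
Proof.
move=> hf hg; have := is_deriveM hf hg.
by rewrite (_ : _ + _ = df * g x + f x * dg)// /GRing.scale/= addrC [g x * _]mulrC.
Qed.

Lemma slope_sqr f x df : is_derive x 1 f df ->
  is_derive x (1 : R) (fun y => f y ^+ 2) (2 * f x * df).
Proof.
move=> hf; have := slope_mul hf hf.
rewrite (_ : df * f x + f x * df = 2 * f x * df); last by ring.
by [].
Qed.

Lemma slope_inv f x df : f x != 0 -> is_derive x 1 f df ->
  is_derive x (1 : R) (fun y => (f y)^-1) (- df / f x ^+ 2).
Proof.
move=> fx hf; have := is_deriveV fx hf.
by rewrite (_ : _ *: _ = - df / f x ^+ 2)// /GRing.scale/= mulrC mulrN mulNr.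
Qed.

Lemma slope_sqrt f x df : 0 < f x -> is_derive x 1 f df ->
  is_derive x (1 : R) (fun y => Num.sqrt (f y)) (df / (2 * Num.sqrt (f x))).
Proof.
move=> fx hf; apply: is_derive_eq.
  exact: (@is_derive1_comp _ Num.sqrt f x _ _ (is_derive1_sqrt fx) hf).
by rewrite mulrC.
Qed.

Lemma slope_comp f g x df dg : is_derive (g x) 1 f df -> is_derive x 1 g dg ->
  is_derive x (1 : R) (fun y => f (g y)) (df * dg).
Proof. by move=> hf hg; exact: (@is_derive1_comp _ f g x _ _ hf hg). Qed.

Lemma slope_continuous f x df : is_derive x 1 f df -> {for x, continuous f}.
Proof. by move=> [df' _]; apply/differentiable_continuous/derivable1_diffP. Qed.

Lemma within_diff f a b : (forall x, a <= x <= b -> {for x, continuous f}) ->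
  {within `[a, b], continuous f}.
Proof.
by move=> cf; apply: continuous_in_subspaceT => x; rewrite inE/= in_itv; exact: cf.
Qed.

Lemma within_derivable f df a b : (forall x, a <= x <= b -> is_derive x 1 f (df x)) ->
  {within `[a, b], continuous f}.
Proof.
move=> hf; apply: within_diff => x /hf[dfx _].
exact/differentiable_continuous/derivable1_diffP.
Qed.

Lemma eq_within f g a b : (forall x, a <= x <= b -> f x = g x) ->
  {within `[a, b], continuous f} -> {within `[a, b], continuous g}.
Proof.
by move=> fg; apply: subspace_eq_continuous => x; rewrite inE/= in_itv/= => /fg.
Qed.

Lemma slope_eq_near f g x df a b : a < x < b -> (forall y, a < y < b -> f y = g y) ->
  is_derive x 1 f df -> is_derive x (1 : R) g df.
Proof.
move=> xab fg; apply: near_eq_is_derive.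
have : x \in `]a, b[ by rewrite in_itv.
by move=> /near_in_itvoo; apply: filterS => y; rewrite in_itv/= => /fg.
Qed.

End ExplicitDerivatives.

(** Differentiates explicit expressions, leaving the sign conditions under roots
and inverses. *)
Ltac slope_step := lazymatch goal with
  | |- is_derive _ _ (fun y => y) _ => apply slope_id
  | |- is_derive _ _ (fun _ => ?c) _ => apply slope_cst
  | |- is_derive _ _ (fun y => @?f y + @?g y) _ => eapply (@slope_add _ f g)
  | |- is_derive _ _ (fun y => - @?f y) _ => eapply (@slope_opp _ f)
  | |- is_derive _ _ (fun y => @?f y ^+ 2) _ => eapply (@slope_sqr _ f)
  | |- is_derive _ _ (fun y => @?f y * @?g y) _ => eapply (@slope_mul _ f g)
  | |- is_derive _ _ (fun y => (@?f y)^-1) _ => eapply (@slope_inv _ f)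
  | |- is_derive _ _ (fun y => Num.sqrt (@?f y)) _ => eapply (@slope_sqrt _ f)
  end.

(** * Clasp arcs *)

Section ClaspArc.
Variable R : realType.
Variables t t' : R.
Implicit Types u x y : R.
Hypotheses (t0 : 0 < t) (t1 : t <= 1) (t'0 : 0 < t') (t'1 : t' <= 1).

(** The parameter of the point of the other arc to which the point at [u] is
joined by a strut. *)
Definition conj_param (a b u : R) : R := b - b / a * u.
Local Notation v := (conj_param t t').

Lemma conj_paramE u : t' * (1 - u / t) = v u.
Proof. by rewrite /conj_param; ring. Qed.

Lemma conj_bounds u : 0 <= u <= t -> 0 <= v u <= t'.
Proof.
move=> /andP[u0 ut]; rewrite -conj_paramE.
have a0 : 0 <= u / t by rewrite divr_ge0// ltW.
have a1 : u / t <= 1 by rewrite ler_pdivrMr// mul1r.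
by rewrite mulr_ge0 ?subr_ge0 ?(ltW t'0)//= ler_piMr ?(ltW t'0)// lerBlDr lerDl.
Qed.

Lemma conj_bounds_oo u : 0 < u < t -> 0 < v u < t'.
Proof.
move=> /andP[u0 ut]; rewrite -conj_paramE.
have a0 : 0 < u / t by rewrite divr_gt0.
have a1 : u / t < 1 by rewrite ltr_pdivrMr// mul1r.
by rewrite mulr_gt0 ?subr_gt0//= gtr_pMr// ltrBlDr ltrDl.
Qed.

Lemma conj_mul u : u * v u <= 4^-1.
Proof.
rewrite -conj_paramE; set a := u / t; have -> : u = a * t by rewrite /a divfK ?gt_eqF.
have h1 : 0 <= (2 * a - 1) ^+ 2 by exact: sqr_ge0.
have : t * t' <= 1 by rewrite mulr_ile1// ltW.
have : 0 < t * t' by rewrite mulr_gt0.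
have -> : a * t * (t' * (1 - a)) = (a * (1 - a)) * (t * t') by ring.
move: (t * t') => c c0 c1; have : a * (1 - a) <= 4^-1 by nra.
have [|/ltW] := leP (a * (1 - a)) 0; nra.
Qed.

(** Since [u * v u <= 1/4], the denominator of [clasp_X] stays away from 0. *)
Lemma conj_denom u : 0 <= u <= t -> 15 / 16 <= 1 - u ^+ 2 * v u ^+ 2.
Proof.
move=> ut; have /andP[v0 _] := conj_bounds ut; case/andP: ut => u0 _.
have h := conj_mul u.
have h0 : 0 <= u * v u by rewrite mulr_ge0.
by rewrite -exprMn; nra.
Qed.

(** If [t' = 1], then [1 - v u ^+ 2] vanishes at the tip; this linear bound
controls the quotients by its square root there. *)
Lemma conj_defect u : 0 <= u <= t -> t' / t * u <= 1 - v u ^+ 2.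
Proof.
move=> ut; have /andP[v0 vt] := conj_bounds ut.
have vE : v u = t' - t' / t * u by [].
have : v u ^+ 2 <= v u by rewrite expr2 ler_piMl// (le_trans vt).
have -> : t' / t * u = t' - v u by rewrite vE; ring.
by move=> h; exact: lerB.
Qed.

Lemma conj_defect_oo u : 0 < u <= t -> 0 < 1 - v u ^+ 2.
Proof.
move=> /andP[u0 ut]; apply: (lt_le_trans _ (@conj_defect u _)); last by rewrite ltW.
by rewrite mulr_gt0// divr_gt0.
Qed.

Lemma clasp_XE u : 0 <= u -> clasp_X t t' u =
  Num.sqrt (u ^+ 2 * (1 - v u ^+ 2) * (1 - u ^+ 2 * v u ^+ 2)^-1).
Proof. by move=> u0; rewrite /clasp_X u0 !conj_paramE. Qed.

Lemma clasp_X_odd u : clasp_X t t' (- u) = - clasp_X t t' u.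
Proof.
rewrite /clasp_X oppr_ge0; case: (ltgtP u 0) => [u0|u0|->].
- by rewrite opprK.
- by rewrite opprK.
- by rewrite oppr0 expr0n/= !mul0r sqrtr0 oppr0.
Qed.

Lemma clasp_X0 : clasp_X t t' 0 = 0.
Proof. by rewrite clasp_XE// expr0n/= !mul0r sqrtr0. Qed.

Lemma clasp_X_end : clasp_X t t' t = t.
Proof.
rewrite clasp_XE ?ltW// (_ : v t = 0); last by rewrite /conj_param divfK ?gt_eqF// subrr.
by rewrite expr0n/= !(subr0, mulr0, mulr1, invr1) sqrtr_sqr gtr0_norm.
Qed.

(** The derivative of [clasp_X], with the square roots of its factors separated. *)
Definition clasp_dX u : R :=
  (Num.sqrt (1 - v u ^+ 2) + t' / t * u * v u * (1 - u ^+ 2) * (Num.sqrt (1 - v u ^+ 2))^-1)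
  * (Num.sqrt (1 - u ^+ 2 * v u ^+ 2) ^+ 2 * Num.sqrt (1 - u ^+ 2 * v u ^+ 2))^-1.

Lemma diff_clasp_X u : 0 < u < t -> is_derive u 1 (clasp_X t t') (clasp_dX u).
Proof.
move=> ut; have [u0 u_t] := andP ut.
apply: (@slope_eq_near _ (fun y => Num.sqrt (y ^+ 2 * (1 - (t' - t' / t * y) ^+ 2)
   * (1 - y ^+ 2 * (t' - t' / t * y) ^+ 2)^-1)) _ _ _ 0 t) => //.
  by move=> y /andP[y0 _]; rewrite clasp_XE ?ltW.
have ut' : 0 < u <= t by rewrite u0 ltW.
have p0 := conj_defect_oo ut'.
have q0 : 0 < 1 - u ^+ 2 * v u ^+ 2.
  by apply: lt_le_trans (@conj_denom u _); rewrite ?divr_gt0// !ltW.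
apply: is_derive_eq.
  repeat slope_step; rewrite -/(v u) ?gt_eqF//.
  by rewrite !mulr_gt0 ?exprn_gt0 ?invr_gt0.
rewrite /clasp_dX -/(v u).
have -> : Num.sqrt (u ^+ 2 * (1 - v u ^+ 2) * (1 - u ^+ 2 * v u ^+ 2)^-1) =
   u * Num.sqrt (1 - v u ^+ 2) * (Num.sqrt (1 - u ^+ 2 * v u ^+ 2))^-1.
  have uu0 : 0 <= u ^+ 2 by exact: sqr_ge0.
  rewrite sqrtrM; last by rewrite mulr_ge0// ltW.
  rewrite (@sqrtrM _ (u ^+ 2))//.
  by rewrite sqrtr_sqr gtr0_norm// sqrtrV// ltW.
have P0 : 0 < Num.sqrt (1 - v u ^+ 2) by rewrite sqrtr_gt0.
have Q0 : 0 < Num.sqrt (1 - u ^+ 2 * v u ^+ 2) by rewrite sqrtr_gt0.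
have PE := sqr_sqrtr (ltW p0). have QE := sqr_sqrtr (ltW q0).
move: P0 Q0 PE QE; move: (Num.sqrt (1 - v u ^+ 2)) (Num.sqrt (1 - u ^+ 2 * v u ^+ 2)).
move: p0 q0; move: (v u) (t' / t) => w k p0 q0 p q P0 Q0 PE QE.
transitivity (((p ^+ 2 + u * w * k) * q ^+ 2 + (u * w * p) ^+ 2 - u ^+ 3 * w * k * p ^+ 2)
  / (p * q ^+ 3)).
  by rewrite -!PE -!QE; field; rewrite ?gt_eqF// !exprn_gt0.
have -> : (p ^+ 2 + u * w * k) * q ^+ 2 + (u * w * p) ^+ 2 - u ^+ 3 * w * k * p ^+ 2 =
    p ^+ 2 + k * u * w * (1 - u ^+ 2).
  by rewrite exprMn QE PE; ring.
by field; rewrite ?gt_eqF.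
Qed.

Lemma clasp_dX_gt0 u : 0 < u < t -> 0 < clasp_dX u.
Proof.
move=> ut; have [u0 u_t] := andP ut; have /andP[v0 _] := conj_bounds_oo ut.
have ut' : 0 < u <= t by rewrite u0 ltW.
have ut'' : 0 <= u <= t by rewrite !ltW.
have p0 := conj_defect_oo ut'.
have q0 : 0 < 1 - u ^+ 2 * v u ^+ 2.
  by apply: lt_le_trans (conj_denom ut''); rewrite divr_gt0.
rewrite /clasp_dX mulr_gt0 ?invr_gt0 ?mulr_gt0 ?exprn_gt0 ?sqrtr_gt0//.
apply: ltr_pwDl; first by rewrite sqrtr_gt0.
have u1 : u < 1 by apply: lt_le_trans u_t t1.
rewrite !mulr_ge0 ?invr_ge0 ?sqrtr_ge0 ?ltW//.
nra.
Qed.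

Lemma clasp_dX_le u : 0 < u < t -> clasp_dX u <= 16.
Proof.
move=> ut; have [u0 u_t] := andP ut; have /andP[v0 vt] := conj_bounds_oo ut.
have ut' : 0 < u <= t by rewrite u0 ltW.
have ut'' : 0 <= u <= t by rewrite !ltW.
have p0 := conj_defect_oo ut'.
have q0 := conj_denom ut''.
have kp := conj_defect ut''.
have k0 : 0 < t' / t * u by rewrite mulr_gt0// divr_gt0.
have u1 : u < 1 by apply: lt_le_trans u_t t1.
rewrite /clasp_dX.
have P0 : 0 < Num.sqrt (1 - v u ^+ 2) by rewrite sqrtr_gt0.
have PE := sqr_sqrtr (ltW p0).
have Q0 : 2^-1 <= Num.sqrt (1 - u ^+ 2 * v u ^+ 2).
  rewrite -(@ler_pXn2r _ 2) ?nnegrE ?sqrtr_ge0// sqr_sqrtr; lra.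
move: (Num.sqrt (1 - v u ^+ 2)) (Num.sqrt (1 - u ^+ 2 * v u ^+ 2)) P0 PE Q0 => p q P0 PE Q0.
have p1 : p <= 1 by nra.
have h1 : t' / t * u * v u * (1 - u ^+ 2) / p <= 1.
  rewrite ler_pdivrMr// mul1r.
  have : t' / t * u * v u * (1 - u ^+ 2) <= t' / t * u.
    rewrite -mulrA ler_piMr// ?ltW//.
    have : 0 <= u ^+ 2 by exact: sqr_ge0.
    have : u ^+ 2 <= 1 by rewrite expr_le1 ?ltW.
    nra.
  nra.
rewrite ler_pdivrMr; last by rewrite mulr_gt0 ?exprn_gt0//; lra.
have : 8^-1 <= q ^+ 2 * q.
  have : 4^-1 <= q ^+ 2 by nra.
  nra.
nra.
Qed.

Lemma within_clasp_X : {within `[0, t], continuous (clasp_X t t')}.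
Proof.
apply: (@eq_within _ (fun y => Num.sqrt (y ^+ 2 * (1 - (t' - t' / t * y) ^+ 2)
   * (1 - y ^+ 2 * (t' - t' / t * y) ^+ 2)^-1))).
  by move=> y /andP[y0 _]; rewrite clasp_XE.
apply: within_diff => u ut; apply: continuous_comp; last exact: sqrt_continuous.
have q0 : 0 < 1 - u ^+ 2 * v u ^+ 2.
  by apply: lt_le_trans (conj_denom ut); rewrite divr_gt0.
eapply slope_continuous.
by repeat slope_step; rewrite -/(v u) ?gt_eqF.
Qed.

Lemma continuous_clasp_dX u : 0 < u < t -> {for u, continuous clasp_dX}.
Proof.
move=> ut; have [u0 u_t] := andP ut.
have ut' : 0 < u <= t by rewrite u0 ltW.
have ut'' : 0 <= u <= t by rewrite !ltW.
have p0 := conj_defect_oo ut'.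
have q0 : 0 < 1 - u ^+ 2 * v u ^+ 2.
  by apply: lt_le_trans (conj_denom ut''); rewrite divr_gt0.
eapply slope_continuous; rewrite /clasp_dX /conj_param.
repeat slope_step; rewrite -/(v u) ?gt_eqF ?mulr_gt0 ?exprn_gt0 ?sqrtr_gt0//.
Qed.

Definition clasp_slope s : R := s / Num.sqrt (1 - s ^+ 2) * derive1 (clasp_X t t') s.

Lemma clasp_slopeE u : 0 < u < t ->
  clasp_slope u = u / Num.sqrt (1 - u ^+ 2) * clasp_dX u.
Proof.
move=> ut; rewrite /clasp_slope derive1E; congr (_ * _).
by have [_ ->] := diff_clasp_X ut.
Qed.

Lemma sqr_lt1 u : 0 < u < t -> 0 < 1 - u ^+ 2.
Proof.
move=> /andP[u0 ut]; rewrite subr_gt0 expr_lt1 ?(ltW u0)//.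
exact: lt_le_trans t1.
Qed.

Lemma continuous_clasp_slope u : 0 < u < t -> {for u, continuous clasp_slope}.
Proof.
move=> ut.
have : {for u, continuous (fun s : R => s / Num.sqrt (1 - s ^+ 2) * clasp_dX s)}.
  move=> A; apply: cvgM; last exact: continuous_clasp_dX.
  have s0 := sqr_lt1 ut.
  have : {for u, continuous (fun s : R => s / Num.sqrt (1 - s ^+ 2))}.
    eapply slope_continuous; repeat slope_step => //.
    by rewrite gt_eqF// sqrtr_gt0.
  exact.
rewrite /prop_for /continuous_at clasp_slopeE//; apply: cvg_trans.
apply: near_eq_cvg; have : u \in `]0, t[ by rewrite in_itv.
by move=> /near_in_itvoo; apply: filterS => y; rewrite in_itv/= => /clasp_slopeE.
Qed.

End ClaspArc.

Section ArcSine.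
Variable R : realType.

Lemma asin1 : asin (1 : R) = pi / 2.
Proof.
have p0 := @pi_gt0 R.
have /sinK : pi / 2 \in `[(- (pi / 2)), (pi / 2 : R)] by rewrite in_itv/= lexx andbT; lra.
by rewrite sin_pihalf.
Qed.

Lemma asinN1 : asin (-1 : R) = - (pi / 2).
Proof.
have p0 := @pi_gt0 R.
have /sinK : - (pi / 2) \in `[(- (pi / 2)), (pi / 2 : R)] by rewrite in_itv/= lexx /=; lra.
by rewrite sinN sin_pihalf.
Qed.

Lemma asin0 : asin (0 : R) = 0.
Proof.
have p0 := @pi_gt0 R; rewrite -[in LHS]sin0; apply: sinK.
by rewrite in_itv/=; apply/andP; split; lra.
Qed.

Lemma within_asin : {within `[(-1 : R), 1], continuous (@asin R)}.
Proof.
apply: segment_inc_surj_continuous.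
  move=> x y; rewrite !in_itv/= => xI yI.
  rewrite !leNgt -ltr_sin ?in_itv/= ?asin_geNpi2 ?asin_lepi2//.
  by rewrite !asinK// in_itv.
rewrite asin1 asinN1 => y /= yI; exists (sin y).
  by rewrite /= in_itv/= sin_geN1 sin_le1.
by rewrite sinK.
Qed.

Definition arc_weight (s : R) : R := (Num.sqrt (1 - s ^+ 2))^-1.

Lemma arc_weight_ge0 s : 0 <= arc_weight s.
Proof. by rewrite invr_ge0 sqrtr_ge0. Qed.

Lemma oo11 (x : R) : -1 < x < 1 -> 0 < 1 - x ^+ 2.
Proof.
move=> /andP[x1 x2]; rewrite subr_gt0 -[ltRHS](expr1n _ 2) -real_normK ?num_real//.
by rewrite ltr_pXn2r ?nnegrE// ltr_norml x1.
Qed.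

Lemma density_asin : density arc_weight (@asin R) (-1) 1.
Proof.
apply: ge0_density; first by lra.
- exact: within_asin.
- move=> x xI; eapply slope_continuous; rewrite /arc_weight; repeat slope_step.
    by rewrite gt_eqF// sqrtr_gt0 oo11.
  exact: oo11.
- by move=> x _; exact: arc_weight_ge0.
Qed.

End ArcSine.

Section ClaspHeight.
Variable R : realType.
Variables t t' : R.
Implicit Types u x y : R.
Hypotheses (t0 : 0 < t) (t1 : t <= 1) (t'0 : 0 < t') (t'1 : t' <= 1).

(** The derivative of [clasp_X] is bounded, hence the integrand is dominated by
the density of [asin], also when [t = 1]. *)
Lemma sintegrable_clasp_slope : sintegrable (clasp_slope t t') 0 t.
Proof.
have := (@density_asin R).1; move=> /(@sintegrable_sub _ _ _ _ 0 t).
move=> /(_ _ t1) wi; have {}wi := wi (ltac:(lra)).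
have wi16 := sintegrableZ 16 wi.
apply: sintegrable_oo.
have mf : measurable_fun `]0, t[ (clasp_slope t t').
  apply: open_continuous_measurable_fun => // x; rewrite inE/= in_itv/=.
  exact: continuous_clasp_slope.
have wi16' : lebesgue_measure.-integrable `]0, t[ (EFin \o (fun x : R => 16 * arc_weight x)).
  by apply: integrableS wi16 => //; exact: subset_itv_oo_cc.
apply: le_integrable wi16' => //.
- exact/measurable_EFinP.
- move=> x /=; rewrite in_itv/= => xI; rewrite lee_fin clasp_slopeE//.
  have dX0 := clasp_dX_gt0 t0 t1 t'0 t'1 xI.
  have dX16 := clasp_dX_le t0 t1 t'0 t'1 xI.
  have [x0 xt] := andP xI; have x1 : x <= 1 by rewrite ltW// (lt_le_trans xt).
  rewrite (ger0_norm (mulr_ge0 (divr_ge0 (ltW x0) (sqrtr_ge0 _)) (ltW dX0))).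
  rewrite ger0_norm; last by rewrite mulr_ge0// arc_weight_ge0.
  rewrite mulrAC mulrC -/(arc_weight x) [leRHS]mulrC ler_wpM2l ?arc_weight_ge0//.
  by rewrite (le_trans _ dX16)// ler_piMl// ltW.
Qed.

Lemma clasp_ZE u : 0 <= u -> clasp_Z t t' u = sint (clasp_slope t t') 0 u.
Proof. by move=> u0; rewrite /clasp_Z ger0_norm. Qed.

Lemma clasp_ZN u : clasp_Z t t' (- u) = clasp_Z t t' u.
Proof. by rewrite /clasp_Z normrN. Qed.

Lemma clasp_Z0 : clasp_Z t t' 0 = 0.
Proof. by rewrite clasp_ZE// sint_pt. Qed.

Lemma within_clasp_Z : {within `[0, t], continuous (clasp_Z t t')}.
Proof.
apply: (@eq_within _ (fun x => sint (clasp_slope t t') 0 x)).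
  by move=> x /andP[x0 _]; rewrite clasp_ZE.
apply: parameterized_integral_continuous; first exact: ltW.
exact: sintegrable_clasp_slope.
Qed.

Lemma diff_clasp_Z u : 0 < u < t ->
  is_derive u 1 (clasp_Z t t') (u / Num.sqrt (1 - u ^+ 2) * clasp_dX t t' u).
Proof.
move=> uI; have [u0 ut] := andP uI.
apply: (@slope_eq_near _ (fun x => sint (clasp_slope t t') 0 x) _ _ _ 0 t) => //.
  by move=> x /andP[x0 _]; rewrite clasp_ZE ?ltW.
have [] := continuous_FTC1_closed ut sintegrable_clasp_slope u0
  (continuous_clasp_slope t0 t1 t'0 t'1 uI).
by rewrite derive1E clasp_slopeE// => d1 d2.
Qed.

Lemma clasp_Z_homo : {in `[0, t] &, {homo clasp_Z t t' : x y / x < y}}.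
Proof.
apply: gtr0_derive1_lt_cc; last exact: within_clasp_Z.
- by move=> x; rewrite in_itv/= => /diff_clasp_Z [].
- move=> x; rewrite in_itv/= => xI; rewrite derive1E.
  have [_ ->] := diff_clasp_Z xI; have [x0 _] := andP xI.
  rewrite mulr_gt0 ?clasp_dX_gt0// divr_gt0// sqrtr_gt0.
  exact: sqr_lt1 t1 _ xI.
Qed.

End ClaspHeight.

(** * The two clasp arcs *)

Section ClaspPair.
Variable R : realType.
Variables a b : R.
Implicit Types u x y : R.
Hypotheses (a0 : 0 < a) (a1 : a <= 1) (b0 : 0 < b) (b1 : b <= 1).
Local Notation v := (conj_param a b).

Definition clasp_height : R := clasp_Z a b a + Num.sqrt (1 - a ^+ 2).

(** The vertical distance between conjugate points of the two arcs, by
[clasp_height_split] below. *)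
Definition clasp_gap (u : R) : R :=
  Num.sqrt ((1 - u ^+ 2) * (1 - v u ^+ 2) * (1 - u ^+ 2 * v u ^+ 2)^-1).

Lemma conj_paramK u : conj_param b a (v u) = u.
Proof. by rewrite /conj_param; field; rewrite ?gt_eqF. Qed.

Lemma conj_param0 : v 0 = b.
Proof. by rewrite /conj_param mulr0 subr0. Qed.

Lemma conj_param_end : v a = 0.
Proof. by rewrite /conj_param divfK ?gt_eqF// subrr. Qed.

Lemma clasp_gap_sqr u : 0 <= u <= a -> 0 <= 1 - u ^+ 2 /\ 0 <= 1 - v u ^+ 2 /\
  0 < 1 - u ^+ 2 * v u ^+ 2 /\
  clasp_gap u ^+ 2 = (1 - u ^+ 2) * (1 - v u ^+ 2) / (1 - u ^+ 2 * v u ^+ 2).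
Proof.
move=> uI; have [u0 ua] := andP uI; have /andP[v0 vb] := conj_bounds a0 b0 uI.
have q0 : 0 < 1 - u ^+ 2 * v u ^+ 2.
  by apply: lt_le_trans (conj_denom a0 a1 b0 b1 uI); rewrite divr_gt0.
have h1 : 0 <= 1 - u ^+ 2 by rewrite subr_ge0 expr_le1// (le_trans ua).
have h2 : 0 <= 1 - v u ^+ 2 by rewrite subr_ge0 expr_le1// (le_trans vb).
by do 3 split => //; rewrite sqr_sqrtr// mulr_ge0 ?invr_ge0 ?(ltW q0)// mulr_ge0.
Qed.

Lemma clasp_gap_ge0 u : 0 <= clasp_gap u.
Proof. exact: sqrtr_ge0. Qed.

Lemma clasp_X_sqr u : 0 <= u <= a ->
  clasp_X a b u ^+ 2 = u ^+ 2 * (1 - v u ^+ 2) / (1 - u ^+ 2 * v u ^+ 2).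
Proof.
move=> uI; have [h1 [h2 [q0 _]]] := clasp_gap_sqr uI; have [u0 _] := andP uI.
rewrite clasp_XE// sqr_sqrtr// mulr_ge0 ?invr_ge0 ?(ltW q0)// mulr_ge0//.
exact: sqr_ge0.
Qed.

Lemma clasp_X_ge0 u : 0 <= u -> 0 <= clasp_X a b u.
Proof. by move=> u0; rewrite /clasp_X u0 sqrtr_ge0. Qed.

(** The strut from a point of one arc to its conjugate on the other arc is
normal to the first arc, and by symmetry to both. *)
Lemma clasp_X_gap u : 0 <= u <= a ->
  clasp_X a b u * Num.sqrt (1 - u ^+ 2) = u * clasp_gap u.
Proof.
move=> uI; have [h1 [h2 [q0 ge]]] := clasp_gap_sqr uI; have [u0 _] := andP uI.
apply/eqP; rewrite -(@eqrXn2 _ 2) ?mulr_ge0 ?clasp_X_ge0 ?sqrtr_ge0//.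
rewrite !exprMn ge clasp_X_sqr// sqr_sqrtr//; apply/eqP.
by move: (v u) (_^-1) => w q; ring.
Qed.

End ClaspPair.

Section ClaspBalance.
Variable R : realType.
Variables a b : R.
Implicit Types u x y : R.
Hypotheses (a0 : 0 < a) (a1 : a <= 1) (b0 : 0 < b) (b1 : b <= 1).
Local Notation v := (conj_param a b).

Lemma clasp_gap_conj u : 0 <= u <= a -> clasp_gap b a (v u) = clasp_gap a b u.
Proof.
by move=> uI; rewrite /clasp_gap conj_paramK// [_ * (1 - u ^+ 2)]mulrC [_ * u ^+ 2]mulrC.
Qed.

Lemma clasp_strut_unit u : 0 <= u <= a ->
  clasp_X a b u ^+ 2 + clasp_X b a (v u) ^+ 2 + clasp_gap a b u ^+ 2 = 1.
Proof.
move=> uI; have [h1 [h2 [q0 ge]]] := clasp_gap_sqr a0 a1 b0 b1 uI.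
rewrite ge clasp_X_sqr// clasp_X_sqr//; last exact: conj_bounds.
rewrite conj_paramK// [in X in _ + X + _]mulrC [_ * u ^+ 2]mulrC.
move: (v u) q0 => w q0; rewrite [_^-1 * _]mulrC -!mulrDl.
by rewrite [X in X / _](_ : _ = 1 - u ^+ 2 * w ^+ 2) ?divff ?gt_eqF//; ring.
Qed.

Lemma clasp_X_conj_gap u : 0 <= u <= a ->
  clasp_X b a (v u) * Num.sqrt (1 - v u ^+ 2) = v u * clasp_gap a b u.
Proof.
by move=> uI; rewrite clasp_X_gap// ?clasp_gap_conj//; exact: conj_bounds.
Qed.

Lemma clasp_gap_gt0 u : 0 < u < a -> 0 < clasp_gap a b u.
Proof.
move=> uI; have uI' : 0 <= u <= a by case/andP: uI => ? ?; rewrite !ltW.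
have [h1 [h2 [q0 ge]]] := clasp_gap_sqr a0 a1 b0 b1 uI'.
rewrite sqrtr_gt0 mulr_gt0 ?invr_gt0// mulr_gt0//; first exact: sqr_lt1 a1 _ uI.
exact: sqr_lt1 b1 _ (conj_bounds_oo a0 b0 uI).
Qed.

(** The balance of the struts between the arcs involves the inverse of the gap;
its singularity is no worse than that of the two curvatures. *)
Lemma clasp_gap_inv u : 0 < u < a ->
  (clasp_gap a b u)^-1 <= arc_weight u + arc_weight (v u).
Proof.
move=> uI; have uI' : 0 <= u <= a by case/andP: uI => ? ?; rewrite !ltW.
have [_ [_ [q0 ge]]] := clasp_gap_sqr a0 a1 b0 b1 uI'.
have p1 := sqr_lt1 a1 uI.
have p2 := sqr_lt1 b1 (conj_bounds_oo a0 b0 uI).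
rewrite /clasp_gap /arc_weight; move: (v u) q0 p1 p2 => w q0 p1 p2.
rewrite sqrtrM; last by rewrite mulr_ge0 ?(ltW p1) ?(ltW p2).
rewrite sqrtrM ?(ltW p1)// sqrtrV ?(ltW q0)//.
have P1 : 0 < Num.sqrt (1 - u ^+ 2) by rewrite sqrtr_gt0.
have P2 : 0 < Num.sqrt (1 - w ^+ 2) by rewrite sqrtr_gt0.
have Q : 0 < Num.sqrt (1 - u ^+ 2 * w ^+ 2) by rewrite sqrtr_gt0.
have Q1 : Num.sqrt (1 - u ^+ 2 * w ^+ 2) <= Num.sqrt (1 - u ^+ 2) + Num.sqrt (1 - w ^+ 2).
  rewrite -(@ler_pXn2r _ 2) ?nnegrE ?sqrtr_ge0 ?addr_ge0 ?sqrtr_ge0//.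
  rewrite sqr_sqrtr ?(ltW q0)// [leRHS]sqrrD !sqr_sqrtr ?(ltW p1) ?(ltW p2)//.
  have h1 : 0 < Num.sqrt (1 - u ^+ 2) * Num.sqrt (1 - w ^+ 2) by rewrite mulr_gt0.
  have h2 : 0 <= (1 - u ^+ 2) * (1 - w ^+ 2) by rewrite mulr_ge0 ?ltW.
  rewrite -mulr_natl; nra.
move: P1 P2 Q Q1; move: (Num.sqrt (1 - u ^+ 2)) (Num.sqrt (1 - w ^+ 2)).
move: (Num.sqrt _) => q p p' P1 P2 Q Q1.
have -> : (p * p' / q)^-1 = q / (p * p') by field; rewrite ?gt_eqF.
have -> : p^-1 + p'^-1 = (p + p') / (p * p') by field; rewrite ?gt_eqF.
by rewrite ler_pM2r// invr_gt0 mulr_gt0.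
Qed.

Lemma diff_conj_param u : is_derive u (1 : R) v (- (b / a)).
Proof.
have : is_derive u (1 : R) (fun y => b - b / a * y) (0 - (0 * u + b / a * 1)).
  by repeat slope_step.
rewrite (_ : 0 - _ = - (b / a)); last by ring.
by [].
Qed.

Lemma continuous_conj_param u : {for u, continuous v}.
Proof. by eapply slope_continuous; exact: diff_conj_param. Qed.

Lemma diff_clasp_gap u : 0 < u < a -> is_derive u 1 (clasp_gap a b)
  (- (u / Num.sqrt (1 - u ^+ 2) * clasp_dX a b u)
   + b / a * (v u / Num.sqrt (1 - v u ^+ 2) * clasp_dX b a (v u))).
Proof.
move=> uI; have uI' : 0 <= u <= a by case/andP: uI => ? ?; rewrite !ltW.
have vI := conj_bounds_oo a0 b0 uI.
have g0 := clasp_gap_gt0 uI.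
have p1 := sqr_lt1 a1 uI.
have p2 := sqr_lt1 b1 vI.
have dX := diff_clasp_X a0 a1 b0 b1 uI.
have dY : is_derive u 1 (fun y => clasp_X b a (v y)) (clasp_dX b a (v u) * (- (b / a))).
  eapply (@slope_comp _ (clasp_X b a) v); [exact: diff_clasp_X|exact: diff_conj_param].
have h : is_derive u 1 (fun y => Num.sqrt (1 - clasp_X a b y ^+ 2 - clasp_X b a (v y) ^+ 2))
   ((0 - 2 * clasp_X a b u * clasp_dX a b u - 2 * clasp_X b a (v u) * (clasp_dX b a (v u) * (- (b / a))))
     / (2 * clasp_gap a b u)).
  have E : Num.sqrt (1 - clasp_X a b u ^+ 2 - clasp_X b a (v u) ^+ 2) = clasp_gap a b u.
    rewrite (_ : _ - _ = clasp_gap a b u ^+ 2) ?sqrtr_sqr ?gtr0_norm//.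
    by rewrite -(clasp_strut_unit uI'); ring.
  rewrite -[in X in is_derive _ _ _ X]E.
  eapply (@slope_sqrt _ (fun y => 1 - clasp_X a b y ^+ 2 - clasp_X b a (v y) ^+ 2)).
    by rewrite -sqrtr_gt0 E.
  repeat slope_step; [exact: dX|exact: dY].
have {}h := slope_eq_near uI _ h; apply: is_derive_eq.
  apply: h => y yI; have yI' : 0 <= y <= a by case/andP: yI => ? ?; rewrite !ltW.
  rewrite (_ : _ - _ = clasp_gap a b y ^+ 2) ?sqrtr_sqr ?ger0_norm// ?clasp_gap_ge0//.
  by rewrite -(clasp_strut_unit yI'); ring.
have e1 := clasp_X_gap a0 a1 b0 b1 uI'.
have e2 := clasp_X_conj_gap uI'.
have P1 : 0 < Num.sqrt (1 - u ^+ 2) by rewrite sqrtr_gt0.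
have P2 : 0 < Num.sqrt (1 - v u ^+ 2) by rewrite sqrtr_gt0.
have -> : clasp_X a b u = u / Num.sqrt (1 - u ^+ 2) * clasp_gap a b u.
  by rewrite mulrAC -e1 mulfK ?gt_eqF.
have -> : clasp_X b a (v u) = v u / Num.sqrt (1 - v u ^+ 2) * clasp_gap a b u.
  by rewrite mulrAC -e2 mulfK ?gt_eqF.
by field; rewrite ?gt_eqF.
Qed.

Lemma within_clasp_gap : {within `[0, a], continuous (clasp_gap a b)}.
Proof.
apply: within_diff => u uI; apply: continuous_comp; last exact: sqrt_continuous.
have [_ [_ [q0 _]]] := clasp_gap_sqr a0 a1 b0 b1 uI.
eapply slope_continuous; rewrite /conj_param; repeat slope_step.
by rewrite gt_eqF.
Qed.

Lemma within_comp_conj (f : R -> R) : {within `[0, b], continuous f} ->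
  {within `[0, a], continuous (fun x => f (v x))}.
Proof.
move=> cf; apply/subspace_continuousP => x /= xI.
move/subspace_continuousP: cf => /(_ (v x)) cf.
have vx : `[0, b]%classic (v x) by move: xI; rewrite /= !in_itv; exact: conj_bounds.
have {}cf := cf vx.
apply: (@cvg_comp _ _ _ v f _ (within `[0, b]%classic (nbhs (v x)))) => //.
move=> P /= ; rewrite /within/= => hP.
have h : \forall y \near x, `[0, b]%classic (v y) -> P (v y) := @continuous_conj_param x _ hP.
change (\forall y \near x, `[0, a]%classic y -> P (v y)).
apply: filterS h => y h yI; apply: h; move: yI; rewrite /= !in_itv; exact: conj_bounds.
Qed.

(** The sum has derivative 0: the struts are normal to both arcs. At the two
ends of the parameter range this says that both expressions for the height of
the clasp agree. *)
Lemma clasp_height_split u : 0 <= u <= a ->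
  clasp_Z a b u + clasp_Z b a (v u) + clasp_gap a b u = clasp_height a b.
Proof.
pose S x := clasp_Z a b x + clasp_Z b a (v x) + clasp_gap a b x.
have cS : {within `[0, a], continuous S}.
  move=> x; apply: cvgD; last exact: within_clasp_gap.
  apply: cvgD; first exact: within_clasp_Z.
  by apply: within_comp_conj; exact: within_clasp_Z.
have dS x : x \in `]0, a[ -> is_derive x 1 S (cst 0 x).
  rewrite in_itv/= => xI; apply: is_derive_eq.
    apply: (@slope_add _ (fun x => clasp_Z a b x + clasp_Z b a (v x))).
      apply: slope_add; first exact: diff_clasp_Z.
      eapply (@slope_comp _ (clasp_Z b a) v); last exact: diff_conj_param.
      by apply: diff_clasp_Z => //; exact: conj_bounds_oo.
    exact: diff_clasp_gap.
  by rewrite /=; ring.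
have Sa : S a = clasp_height a b.
  rewrite /S conj_param_end// clasp_Z0 addr0 /clasp_gap conj_param_end//.
  by rewrite expr0n/= !(mulr0, subr0, invr1, mulr1).
move=> /andP[u0]; rewrite le_eqVlt => /predU1P[->//|ua].
have dS' x : x \in `]u, a[ -> is_derive x 1 S (cst 0 x).
  by rewrite in_itv/= => /andP[ux xa]; apply: dS; rewrite in_itv/= xa (le_lt_trans u0).
have cS' : {within `[u, a], continuous S} by exact: within_sub cS.
have [c _] := MVT ua dS' cS'.
by rewrite /cst mul0r Sa => /eqP; rewrite subr_eq0 => /eqP ->.
Qed.

End ClaspBalance.

Section ClaspDistance.
Variable R : realType.
Variables a b : R.
Implicit Types u x y w : R.
Hypotheses (a0 : 0 < a) (a1 : a <= 1) (b0 : 0 < b) (b1 : b <= 1).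
Local Notation v := (conj_param a b).
Local Notation h := (clasp_height a b).

Lemma clasp_height_sym : clasp_height b a = h.
Proof.
rewrite -(@clasp_height_split _ a b a0 a1 b0 b1 0) ?lexx ?(ltW a0)//.
rewrite clasp_Z0 add0r conj_param0 /clasp_height; congr (_ + _).
rewrite /clasp_gap conj_param0 expr0n/= mul0r !subr0 invr1 mulr1 mul1r //.
Qed.

Lemma clasp_gapE w : 0 <= w <= b ->
  clasp_gap b a w = h - clasp_Z a b (conj_param b a w) - clasp_Z b a w.
Proof.
move=> wI; rewrite -clasp_height_sym -(@clasp_height_split _ b a b0 b1 a0 a1 w wI).
by move: (clasp_Z _ _ _) (clasp_Z _ _ _) (clasp_gap _ _ _) => p q r; ring.
Qed.

Lemma clasp_Z_nd x y : 0 <= x -> x <= y -> y <= a -> clasp_Z a b x <= clasp_Z a b y.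
Proof.
move=> x0; rewrite le_eqVlt => /predU1P[->//|xy] ya.
apply/ltW; apply: (clasp_Z_homo a0 a1 b0 b1) => //; rewrite in_itv/=; apply/andP; split => //.
- by rewrite (le_trans (ltW xy)).
- by rewrite (le_trans x0) ?ltW.
Qed.

(** Squared distance from the axis point at height [c] to the lower arc. *)
Let axis_sqdist c w := clasp_X b a w ^+ 2 + (c - clasp_Z b a w) ^+ 2.

Let axis_slope c w := 2 * clasp_dX b a w * (w / Num.sqrt (1 - w ^+ 2)) *
  (h - c - clasp_Z a b (conj_param b a w)).

Let diff_axis_sqdist c w : 0 < w < b -> is_derive w 1 (axis_sqdist c) (axis_slope c w).
Proof.
move=> wI; have wI' : 0 <= w <= b by case/andP: wI => ? ?; rewrite !ltW.
apply: is_derive_eq.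
  by rewrite /axis_sqdist; repeat slope_step; [exact: diff_clasp_X|exact: diff_clasp_Z].
have P : 0 < Num.sqrt (1 - w ^+ 2) by rewrite sqrtr_gt0; exact: sqr_lt1 b1 _ wI.
have -> : clasp_X b a w = w / Num.sqrt (1 - w ^+ 2) * clasp_gap b a w.
  by rewrite mulrAC -clasp_X_gap// mulfK ?gt_eqF.
rewrite clasp_gapE// /axis_slope.
move: (clasp_Z _ _ _) (clasp_Z _ _ _) h (_^-1) (clasp_dX _ _ _) => p q r i d.
ring.
Qed.

Let within_axis_sqdist c : {within `[0, b], continuous (axis_sqdist c)}.
Proof.
move=> x; apply: cvgD; rewrite /=.
  by apply: (@continuous_comp _ _ _ (clasp_X b a : subspace _ -> R) (fun y => y ^+ 2));
    [exact: within_clasp_X|exact: exprn_continuous].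
apply: (@continuous_comp _ _ _ (fun y : subspace _ => c - clasp_Z b a y) (fun y : R => y ^+ 2)).
  by apply: cvgB; [exact: cvg_cst|exact: within_clasp_Z].
exact: exprn_continuous.
Qed.

Let slope_factor_ge0 w : 0 < w < b ->
  0 <= 2 * clasp_dX b a w * (w / Num.sqrt (1 - w ^+ 2)).
Proof.
move=> wI; have [w0 _] := andP wI.
by rewrite mulr_ge0 ?divr_ge0 ?sqrtr_ge0 ?(ltW w0)// mulr_ge0// ltW// clasp_dX_gt0.
Qed.

Let axis_sqdist_mvt c x y : 0 <= x -> x <= y -> y <= b -> exists2 r, 0 <= r &
  (x = y \/ exists2 w, x < w < y & axis_sqdist c y - axis_sqdist c x =
    r * (h - c - clasp_Z a b (conj_param b a w))).
Proof.
move=> x0; rewrite le_eqVlt => /predU1P[->|xy] yb; first by exists 0 => //; left.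
have dS w : w \in `]x, y[ -> is_derive w 1 (axis_sqdist c) (axis_slope c w).
  rewrite in_itv/= => /andP[xw wy].
  by apply: diff_axis_sqdist; rewrite (le_lt_trans x0 xw) (lt_le_trans wy yb).
have [w + E] := MVT xy dS (within_sub x0 yb (@within_axis_sqdist c)).
rewrite in_itv/= => wI; have wb : 0 < w < b.
  by case/andP: wI => xw wy; rewrite (le_lt_trans x0 xw) (lt_le_trans wy yb).
exists (2 * clasp_dX b a w * (w / Num.sqrt (1 - w ^+ 2)) * (y - x)).
  by rewrite mulr_ge0 ?slope_factor_ge0// subr_ge0 ltW.
by right; exists w => //; rewrite E /axis_slope mulrAC.
Qed.

Let axis_sqdist_nd c x y : 0 <= x -> x <= y -> y <= b ->
  (forall w, x < w < y -> clasp_Z a b (conj_param b a w) <= h - c) ->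
  axis_sqdist c x <= axis_sqdist c y.
Proof.
move=> x0 xy yb hc; have [r r0 [->//|[w /hc wc E]]] := axis_sqdist_mvt c x0 xy yb.
by rewrite -subr_ge0 E mulr_ge0// subr_ge0.
Qed.

Let axis_sqdist_ni c x y : 0 <= x -> x <= y -> y <= b ->
  (forall w, x < w < y -> h - c <= clasp_Z a b (conj_param b a w)) ->
  axis_sqdist c y <= axis_sqdist c x.
Proof.
move=> x0 xy yb hc; have [r r0 [->//|[w /hc wc E]]] := axis_sqdist_mvt c x0 xy yb.
by rewrite -subr_le0 E mulr_ge0_le0// subr_le0.
Qed.

(** Along the lower arc, the distance from a fixed point of the upper arc
decreases until the conjugate point and increases afterwards, as shown by the
sign of [axis_slope]; at the conjugate point it equals 1. *)
Lemma clasp_arc_dist u w : 0 <= u <= a -> 0 <= w <= b ->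
  1 <= clasp_X a b u ^+ 2 + clasp_X b a w ^+ 2 + (h - clasp_Z a b u - clasp_Z b a w) ^+ 2.
Proof.
move=> uI /andP[w0 wb]; have [u0 ua] := andP uI; have /andP[v0 vb] := conj_bounds a0 b0 uI.
set c := h - clasp_Z a b u.
have hcE : h - c = clasp_Z a b u by rewrite /c; ring.
have at_v : clasp_X a b u ^+ 2 + axis_sqdist c (v u) = 1.
  rewrite -(clasp_strut_unit a0 a1 b0 b1 uI) /axis_sqdist addrA; congr (_ + _ ^+ 2).
  rewrite /c -(clasp_height_split a0 a1 b0 b1 uI).
  by move: (clasp_Z _ _ _) (clasp_Z _ _ _) (clasp_gap _ _ _) => p q r; ring.
rewrite -addrA -at_v lerD2l -/(axis_sqdist c w).
have conj_le x y : x <= y -> conj_param b a y <= conj_param b a x.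
  by move=> xy; rewrite /conj_param lerB// ler_wpM2l// divr_ge0 ?ltW.
have [wv|/ltW vw] := leP w (v u).
  apply: axis_sqdist_ni => // x /andP[wx xv]; rewrite hcE; apply: clasp_Z_nd => //.
    by rewrite -[u](conj_paramK a0 b0) conj_le ?ltW.
  have xI : 0 <= x <= b by rewrite (le_trans w0 (ltW wx)) (le_trans (ltW xv)).
  by have /andP[] := conj_bounds b0 a0 xI.
apply: axis_sqdist_nd => // x /andP[vx xw]; rewrite hcE; apply: clasp_Z_nd => //.
  have xI : 0 <= x <= b by rewrite (le_trans v0 (ltW vx)) (le_trans (ltW xw)).
  by have /andP[] := conj_bounds b0 a0 xI.
by rewrite -[u](conj_paramK a0 b0) conj_le ?ltW.
Qed.

(** The points of the circle lie so low that the distance increases already from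
the tip, the center of the circle. *)
Lemma clasp_circle_dist u w : a <= u <= 1 -> 0 <= w <= b ->
  1 <= u ^+ 2 + clasp_X b a w ^+ 2 + (Num.sqrt (1 - u ^+ 2) - clasp_Z b a w) ^+ 2.
Proof.
move=> /andP[au u1] /andP[w0 wb]; have u0 := le_trans (ltW a0) au.
set c := Num.sqrt (1 - u ^+ 2); rewrite -addrA -/(axis_sqdist c w).
have at0 : u ^+ 2 + axis_sqdist c 0 = 1.
  rewrite /axis_sqdist clasp_X0 clasp_Z0 expr0n/= add0r subr0 /c sqr_sqrtr; first by ring.
  by rewrite subr_ge0 expr_le1.
rewrite -at0 lerD2l; apply: axis_sqdist_nd => // x /andP[x0 xw].
have hca : clasp_Z a b a <= h - c.
  rewrite /clasp_height lerBrDr lerD2l /c ler_wsqrtr// lerB//.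
  by rewrite ler_pXn2r ?nnegrE// ltW.
apply: le_trans hca; apply: clasp_Z_nd => //.
  have xI : 0 <= x <= b by rewrite (ltW x0) (le_trans (ltW xw)).
  by have /andP[] := conj_bounds b0 a0 xI.
have xI : 0 <= x <= b by rewrite (ltW x0) (le_trans (ltW xw)).
by have /andP[] := conj_bounds b0 a0 xI.
Qed.

End ClaspDistance.

(** * Planar curves in space *)

Section EuclideanStructure.
Variable R : realType.
Local Notation V := 'rV[R]_3.
Implicit Types (p q r : V) (a : R).

Lemma dotE p q : dot p q = p 0 0 * q 0 0 + p 0 1 * q 0 1 + p 0 2 * q 0 2.
Proof.
rewrite /dot !big_ord_recl big_ord0 addr0 addrA.
by congr (_ + _ + _); congr (p _ _ * q _ _); apply/val_inj.
Qed.

Lemma dotC p q : dot p q = dot q p.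
Proof. by rewrite !dotE; ring. Qed.

Lemma dotDl p q r : dot (p + q) r = dot p r + dot q r.
Proof. by rewrite !dotE !mxE; ring. Qed.

Lemma dotDr p q r : dot r (p + q) = dot r p + dot r q.
Proof. by rewrite !dotE !mxE; ring. Qed.

Lemma dotZl a p q : dot (a *: p) q = a * dot p q.
Proof. by rewrite !dotE !mxE; ring. Qed.

Lemma dotZr a p q : dot p (a *: q) = a * dot p q.
Proof. by rewrite !dotE !mxE; ring. Qed.

Lemma dotNl p q : dot (- p) q = - dot p q.
Proof. by rewrite !dotE !mxE; ring. Qed.

Lemma dotNr p q : dot p (- q) = - dot p q.
Proof. by rewrite !dotE !mxE; ring. Qed.

Lemma dotBl p q r : dot (p - q) r = dot p r - dot q r.
Proof. by rewrite dotDl dotNl. Qed.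

Lemma dotBr p q r : dot r (p - q) = dot r p - dot r q.
Proof. by rewrite dotDr dotNr. Qed.

Lemma dot_ge0 p : 0 <= dot p p.
Proof. by rewrite dotE !addr_ge0// -expr2 sqr_ge0. Qed.

Lemma enormN p : enorm (- p) = enorm p.
Proof. by rewrite /enorm dotNl dotNr opprK. Qed.

Lemma enorm_ge1 p : 1 <= dot p p -> 1 <= enorm p.
Proof. by move=> h; rewrite /enorm -[1]sqrtr1 ler_wsqrtr. Qed.

(** An instance of the Cauchy-Schwarz inequality. *)
Lemma dot_ge1 w p : dot w w = 1 -> 1 <= dot w p -> 1 <= dot p p.
Proof.
by move=> w1 wp; have := dot_ge0 (p - w); rewrite dotBl !dotBr w1 (dotC p w); lra.
Qed.

Lemma enorm_ge1_dot w p : dot w w = 1 -> 1 <= dot w p -> 1 <= enorm p.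
Proof. by move=> w1 wp; apply/enorm_ge1/(dot_ge1 w1). Qed.

Lemma enorm_eq1 p : dot p p = 1 -> enorm p = 1.
Proof. by rewrite /enorm => ->; exact: sqrtr1. Qed.

Lemma direction_unit p : dot p p = 1 -> direction p = p.
Proof. by move=> h; rewrite /direction enorm_eq1// invr1 scale1r. Qed.

Lemma dot_vec3 p x y z : dot p (vec3 x y z) = p 0 0 * x + p 0 1 * y + p 0 2 * z.
Proof. by rewrite dotE !mxE. Qed.

Lemma vec3D (x y z x' y' z' : R) : vec3 x y z + vec3 x' y' z' = vec3 (x + x') (y + y') (z + z').
Proof. by apply/rowP => i; rewrite !mxE; case: i => [[|[|[|]]]]. Qed.

Lemma vec3Z a (x y z : R) : a *: vec3 x y z = vec3 (a * x) (a * y) (a * z).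
Proof. by apply/rowP => i; rewrite !mxE; case: i => [[|[|[|]]]]. Qed.

Lemma vec3N (x y z : R) : - vec3 x y z = vec3 (- x) (- y) (- z).
Proof. by apply/rowP => i; rewrite !mxE; case: i => [[|[|[|]]]]. Qed.

Lemma vec3B (x y z x' y' z' : R) : vec3 x y z - vec3 x' y' z' = vec3 (x - x') (y - y') (z - z').
Proof. by rewrite vec3N vec3D. Qed.

Lemma dot_vec33 (x y z x' y' z' : R) : dot (vec3 x y z) (vec3 x' y' z') = x * x' + y * y' + z * z'.
Proof. by rewrite dot_vec3 !mxE. Qed.

End EuclideanStructure.

Section Frames.
Variable R : realType.
Local Notation V := 'rV[R]_3.

Lemma cosBE (x y : R) : cos (x - y) = cos x * cos y + sin x * sin y.
Proof. by rewrite cosD cosN sinN mulrN opprK. Qed.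

Lemma sinBE (x y : R) : sin (x - y) = sin x * cos y - cos x * sin y.
Proof. by rewrite sinD cosN sinN mulrN. Qed.

Lemma cos_ge0_half (x : R) : `|x| <= pi / 2 -> 0 <= cos x.
Proof. by rewrite ler_norml => /cos_ge0_pihalf. Qed.

Lemma sin_lip (x y : R) : `|sin x - sin y| <= `|x - y|.
Proof.
wlog xy : x y / y <= x => [h|].
  by have [/h//|/ltW/h] := leP y x; rewrite distrC [leRHS]distrC.
have cS : {within `[y, x], continuous (@sin R)}.
  by apply: continuous_subspaceT => z; exact: continuous_sin.
have [c _ ->] := MVT_segment xy (fun z _ => is_derive_sin z) cS.
by rewrite normrM ler_piMl// ler_norml cos_geN1 cos_le1.
Qed.

Lemma cos_lip (x y : R) : `|cos x - cos y| <= `|x - y|.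
Proof.
have := sin_lip (x + pi / 2) (y + pi / 2).
by rewrite !sinDpihalf opprD addrACA subrr addr0.
Qed.

Variables e1 e2 : V.
Hypotheses (e11 : dot e1 e1 = 1) (e22 : dot e2 e2 = 1) (e12 : dot e1 e2 = 0).

Definition planar (x z : R) : V := x *: e1 + z *: e2.
(** Tangent and outward normal of a curve traversed clockwise, at angle [th]
below the first frame vector. *)
Definition unit_T (th : R) : V := planar (cos th) (- sin th).
Definition unit_N (th : R) : V := planar (sin th) (cos th).

Lemma dot_planar x z x' z' : dot (planar x z) (planar x' z') = x * x' + z * z'.
Proof.
by rewrite /planar !dotDl !dotDr !dotZl !dotZr (dotC e2 e1) e11 e22 e12; ring.
Qed.

Lemma planarB x z x' z' : planar x z - planar x' z' = planar (x - x') (z - z').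
Proof. by rewrite /planar !scalerBl opprD addrACA. Qed.

Lemma planarD x z x' z' : planar x z + planar x' z' = planar (x + x') (z + z').
Proof. by rewrite /planar !scalerDl addrACA. Qed.

Lemma planarZ a x z : a *: planar x z = planar (a * x) (a * z).
Proof. by rewrite /planar scalerDr !scalerA. Qed.

Lemma unit_T_dot th : dot (unit_T th) (unit_T th) = 1.
Proof. by rewrite dot_planar mulrNN -!expr2 cos2Dsin2. Qed.

Lemma unit_N_dot th : dot (unit_N th) (unit_N th) = 1.
Proof. by rewrite dot_planar -!expr2 addrC cos2Dsin2. Qed.

Lemma planar_frame x z th : planar x z =
  (x * cos th - z * sin th) *: unit_T th + (x * sin th + z * cos th) *: unit_N th.
Proof.
rewrite /unit_T /unit_N !planarZ planarD; have := cos2Dsin2 th => h.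
by congr planar; [rewrite -[LHS]mulr1|rewrite -[LHS]mulr1]; rewrite -h; ring.
Qed.

Local Notation along dx dz th := (dx * cos th - dz * sin th).
Local Notation across dx dz th := (dx * sin th + dz * cos th).

(** Pinching: a chord seen from opposite sides by the normals at two angles is
nearly parallel to the tangents at these angles. *)
Lemma secant_bound (dx dz th ph : R) : 2^-1 <= cos (ph - th) ->
  0 < along dx dz th -> across dx dz th * across dx dz ph <= 0 ->
  exists a b : R, direction (planar dx dz) = a *: unit_T th + b *: unit_N th /\
    `|a - 1| <= 2 * `|sin (ph - th)| /\ `|b| <= 2 * `|sin (ph - th)|.
Proof.
move=> hc A0 hB; set A := along dx dz th in A0 *; set B := across dx dz th in hB *.
pose r := Num.sqrt (A ^+ 2 + B ^+ 2).
have r2 : r ^+ 2 = A ^+ 2 + B ^+ 2 by rewrite sqr_sqrtr// addr_ge0 ?sqr_ge0.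
have r0 : 0 < r by rewrite sqrtr_gt0 ltr_pwDl ?exprn_gt0 ?sqr_ge0.
have dE : enorm (planar dx dz) = r.
  rewrite /enorm dot_planar /r; congr Num.sqrt; rewrite /A /B.
  by rewrite -[LHS]mulr1 -(cos2Dsin2 th); ring.
exists (A / r), (B / r); split.
  rewrite /direction dE (planar_frame dx dz th) -/A -/B scalerDr !scalerA.
  by rewrite ![r^-1 * _]mulrC.
have phE : across dx dz ph = B * cos (ph - th) + A * sin (ph - th).
  rewrite /A /B cosBE sinBE; rewrite -[LHS]mulr1 -(cos2Dsin2 th); ring.
rewrite phE in hB.
have a1 : A / r <= 1 by rewrite ler_pdivrMr// mul1r; nra.
have a0 : 0 < A / r by rewrite divr_gt0.
have ab : (A / r) ^+ 2 + (B / r) ^+ 2 = 1.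
  by rewrite !expr_div_n -mulrDl -r2 divff// expf_neq0// gt_eqF.
have {}hB : (B / r) * ((B / r) * cos (ph - th) + (A / r) * sin (ph - th)) <= 0.
  have -> : (B / r) * ((B / r) * cos (ph - th) + (A / r) * sin (ph - th)) =
    B * (B * cos (ph - th) + A * sin (ph - th)) / r ^+ 2 by field; rewrite gt_eqF.
  by rewrite mulr_le0_ge0// invr_ge0 sqr_ge0.
move: (A / r) (B / r) a1 a0 ab hB => a b a1 a0 ab hB.
have bs : `|b| <= 2 * `|sin (ph - th)|.
  have h1 : b ^+ 2 * 2^-1 <= `|b| * `|sin (ph - th)|.
    have h2 : b ^+ 2 * 2^-1 <= b ^+ 2 * cos (ph - th) by rewrite ler_wpM2l// sqr_ge0.
    have h3 : - (a * (b * sin (ph - th))) <= `|b * sin (ph - th)|.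
      rewrite -mulrN; apply: (le_trans (ler_norm _)).
      by rewrite normrM normrN gtr0_norm// ler_piMl.
    rewrite normrM in h3; nra.
  have [->|b0] := eqVneq b 0; first by rewrite normr0 mulr_ge0.
  have : 0 < `|b| by rewrite normr_gt0.
  rewrite -real_normK ?num_real// in h1; move: `|b| `|sin _| h1 => u v h1 u0; nra.
split => //.
apply: le_trans bs; rewrite ler0_norm ?subr_le0// opprB.
have : `|b| <= 1.
  rewrite -(@ler_pXn2r _ 2) ?nnegrE// real_normK ?num_real// expr1n.
  by have := sqr_ge0 a; lra.
have : `|b| ^+ 2 = b ^+ 2 by rewrite real_normK ?num_real.
have := normr_ge0 b; move: `|b| => u *; nra.
Qed.

(** Unit tangents, without differentiability of the parametrization: the speed of
the curves below vanishes or blows up at some points. *)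
Lemma secant_cvg (F : set_system R) (FF : ProperFilter F) (c : R -> V)
    (dx dz ph : R -> R) (th : R) :
  ph s @[s --> F] --> th ->
  (\forall s \near F, [/\ c s = planar (dx s) (dz s), 0 < along (dx s) (dz s) th
     & across (dx s) (dz s) th * across (dx s) (dz s) (ph s) <= 0]) ->
  lim (direction (c s) @[s --> F]) = unit_T th.
Proof.
move=> phth near_c; apply: cvg_lim; first exact: norm_hausdorff.
apply/cvgrPdist_le => e e0.
set M := `|unit_T th| + `|unit_N th| + 1.
have M0 : 0 < M by rewrite ltr_wpDl// addr_ge0.
have hs : sin (ph s - th) @[s --> F] --> (0 : R).
  rewrite -[0 in X in _ --> X]sin0 -(subrr th).
  apply: continuous_cvg; first exact: continuous_sin.
  by apply: cvgB => //; exact: cvg_cst.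
have hc : cos (ph s - th) @[s --> F] --> (1 : R).
  rewrite -[1 in X in _ --> X]cos0 -(subrr th).
  apply: continuous_cvg; first exact: continuous_cos.
  by apply: cvgB => //; exact: cvg_cst.
have e2M : 0 < e / (2 * M) by rewrite divr_gt0 ?mulr_gt0.
move/cvgrPdist_lt : hs => /(_ _ e2M) hs.
move/cvgrPdist_lt : hc => /(_ 2^-1); rewrite invr_gt0 ltr0n => /(_ isT) hc.
near=> s.
have [-> A0 B0] : [/\ c s = planar (dx s) (dz s), 0 < along (dx s) (dz s) th
     & across (dx s) (dz s) th * across (dx s) (dz s) (ph s) <= 0] by near: s.
have sins : `|sin (ph s - th)| < e / (2 * M).
  by rewrite -normrN -sub0r; near: s.
have coss : 2^-1 <= cos (ph s - th).
  have : `|1 - cos (ph s - th)| < 2^-1 by near: s.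
  by rewrite ltr_norml => /andP[_]; lra.
have [a [b [-> [ha hb]]]] := secant_bound coss A0 B0.
have -> : unit_T th - (a *: unit_T th + b *: unit_N th) =
    (1 - a) *: unit_T th - b *: unit_N th by rewrite scalerBl scale1r opprD addrA.
apply: (le_trans (ler_normB _ _)); rewrite !normrZ.
rewrite distrC in ha.
have : 2 * `|sin (ph s - th)| * M <= e.
  rewrite -ler_pdivlMr// ltW// -ltr_pdivlMl//.
  by apply: (lt_le_trans sins); rewrite invfM mulrCA mulrA [_^-1 * _ * _]mulrAC mulrC mulrA.
apply: le_trans; rewrite mulrDr mulr1.
apply: (@le_trans _ _ (2 * `|sin (ph s - th)| * (`|unit_T th| + `|unit_N th|))).
  by rewrite mulrDr lerD// ler_wpM2r.
by rewrite lerDl mulr_ge0.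
Unshelve. all: by end_near. Qed.

End Frames.

(** * Curves swept by a turning tangent *)

Section Sweeping.
Variable R : realType.
Implicit Types (x z th F : R -> R) (a b c s t r vth : R).

Definition progress x z vth s t : R :=
  (x t - x s) * cos vth - (z t - z s) * sin vth.

(** The curve [(x, z)] has tangent angle [th], in integrated form: where the
tangent makes an acute angle with the direction at angle [vth], chords advance in
that direction. This condition passes to concatenations, reflections and
parallels, without regularity at the junctions of the pieces. *)
Definition sweeps x z th a b : Prop := forall s t vth, a <= s -> s < t -> t <= b ->
  ((forall r, s <= r <= t -> 0 <= cos (th r - vth)) -> 0 <= progress x z vth s t) /\
  ((forall r, s <= r <= t -> 0 < cos (th r - vth)) -> 0 < progress x z vth s t).

Lemma progress_cat x z vth s r t :
  progress x z vth s t = progress x z vth s r + progress x z vth r t.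
Proof. by rewrite /progress; ring. Qed.

Lemma eq_sweeps x z th x' z' th' a b :
  (forall s, a <= s <= b -> [/\ x s = x' s, z s = z' s & th s = th' s]) ->
  sweeps x z th a b -> sweeps x' z' th' a b.
Proof.
move=> E sw s t vth as_ st tb; have st' := ltW st.
have [h1 h2] := sw s t vth as_ st tb.
have [xs zs _] : [/\ x s = x' s, z s = z' s & th s = th' s].
  by apply: E; rewrite as_ (le_trans st').
have [xt zt _] : [/\ x t = x' t, z t = z' t & th t = th' t].
  by apply: E; rewrite tb (le_trans as_).
have thE r : s <= r <= t -> th r = th' r.
  by move=> /andP[sr rt]; have [] := E r; rewrite ?(le_trans as_ sr) ?(le_trans rt tb).
rewrite /progress -xs -zs -xt -zt; split => hr.
  by apply: h1 => r rI; rewrite thE//; exact: hr.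
by apply: h2 => r rI; rewrite thE//; exact: hr.
Qed.

Lemma sweeps_sub x z th a b c d : a <= c -> d <= b -> sweeps x z th a b -> sweeps x z th c d.
Proof.
by move=> ac db sw s t vth cs st td; apply: sw => //; [exact: le_trans cs|exact: le_trans td db].
Qed.

Lemma sweeps_cat x z th a b c : sweeps x z th a b -> sweeps x z th b c -> sweeps x z th a c.
Proof.
move=> sw1 sw2 s t vth as_ st tc.
have [tb|bt] := leP t b; first exact: sw1.
have [bs|sb] := leP b s; first exact: sw2.
rewrite (progress_cat x z vth s b t).
have [h1 h2] := sw1 s b vth as_ sb (lexx b).
have [k1 k2] := sw2 b t vth (lexx b) bt tc.
have in1 r : s <= r <= b -> s <= r <= t by move=> /andP[-> rb]; rewrite (le_trans rb (ltW bt)).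
have in2 r : b <= r <= t -> s <= r <= t by move=> /andP[br ->]; rewrite (le_trans (ltW sb)).
split => hr.
  by rewrite addr_ge0// ?h1 ?k1// => r rI; apply: hr; [exact: in1|exact: in2].
by rewrite addr_gt0// ?h2 ?k2// => r rI; apply: hr; [exact: in1|exact: in2].
Qed.

(** On a smooth piece the velocity is a positive multiple of the tangent. *)
Lemma sweeps_smooth x z th (rho : R -> R) a b :
  {within `[a, b], continuous x} -> {within `[a, b], continuous z} ->
  (forall s, a < s < b -> 0 < rho s) ->
  (forall s, a < s < b -> is_derive s 1 x (rho s * cos (th s))) ->
  (forall s, a < s < b -> is_derive s 1 z (- (rho s * sin (th s)))) ->
  sweeps x z th a b.
Proof.
move=> cx cz rho0 dx dz s t vth as_ st tb.
pose f u := x u * cos vth - z u * sin vth.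
have fE : progress x z vth s t = f t - f s by rewrite /progress /f; ring.
have cf : {within `[s, t], continuous f}.
  move=> u; apply: cvgB; apply: cvgM; try exact: cvg_cst.
    by apply: (within_sub as_ tb cx).
  by apply: (within_sub as_ tb cz).
have df u : u \in `]s, t[ -> is_derive u 1 f (rho u * cos (th u - vth)).
  rewrite in_itv/= => /andP[su ut].
  have uI : a < u < b by rewrite (le_lt_trans as_ su) (lt_le_trans ut tb).
  have := dx u uI; have := dz u uI => dzu dxu; apply: is_derive_eq.
  by rewrite !scaler0 !add0r /GRing.scale/= cosBE; ring.
have [u uI fts] := MVT st df cf.
move: (uI); rewrite in_itv/= => /andP[su ut].
have rhou : 0 < rho u by apply: rho0; rewrite (le_lt_trans as_ su) (lt_le_trans ut tb).
have uI' : s <= u <= t by rewrite !ltW.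
rewrite fE fts; split => hr.
  by rewrite !mulr_ge0 ?subr_ge0 ?(ltW st) ?(ltW rhou) ?hr.
by rewrite !mulr_gt0 ?subr_gt0 ?hr.
Qed.

Lemma sweeps_opp x z th a b : sweeps x z th a b ->
  sweeps (fun s => - x (- s)) (fun s => z (- s)) (fun s => - th (- s)) (- b) (- a).
Proof.
move=> sw s t vth bs st ta.
have [h1 h2] := sw (- t) (- s) (- vth) (ltac:(by rewrite lerNr)) (ltac:(by rewrite ltrN2)) (ltac:(by rewrite lerNl)).
have -> : progress (fun s => - x (- s)) (fun s => z (- s)) vth s t =
    progress x z (- vth) (- t) (- s) by rewrite /progress cosN sinN; ring.
have cE r : cos (th r - - vth) = cos (- th r - vth) by rewrite -[LHS]cosN; congr cos; ring.
have rI r : - t <= r <= - s -> s <= - r <= t.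
  by move=> /andP[h k]; rewrite lerNr k lerNl h.
split => hr; [apply: h1|apply: h2] => r /rI/hr; by rewrite opprK -cE.
Qed.

(** The offset adds an increment of the sine of the angle to the direction, which
is nonnegative as long as the tangents make acute angles with the direction. *)
Lemma sweeps_offset x z th (d : R) a b : 0 <= d -> {within `[a, b], continuous th} ->
  {in `[a, b] &, {homo th : s t / s <= t}} -> sweeps x z th a b ->
  sweeps (fun s => x s + d * sin (th s)) (fun s => z s + d * cos (th s)) th a b.
Proof.
move=> d0 cth ndth sw s t vth as_ st tb.
have [h1 h2] := sw s t vth as_ st tb.
have -> : progress (fun s => x s + d * sin (th s)) (fun s => z s + d * cos (th s)) vth s t =
    progress x z vth s t + d * (sin (th t - vth) - sin (th s - vth)).
  by rewrite /progress !sinBE; ring.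
have st' := ltW st.
have key : (forall r, s <= r <= t -> 0 <= cos (th r - vth)) ->
    0 <= d * (sin (th t - vth) - sin (th s - vth)).
  move=> hr; rewrite mulr_ge0// subr_ge0.
  have thst : th s <= th t.
    by apply: ndth; rewrite ?in_itv/= ?as_ ?tb ?(le_trans as_ st') ?(le_trans st' tb).
  have cst : {within `[s, t], continuous th} := within_sub as_ tb cth.
  have onto u : th s - vth <= u <= th t - vth -> 0 <= cos u.
    move=> /andP[su ut].
    have hv : Num.min (th s) (th t) <= u + vth <= Num.max (th s) (th t).
      by rewrite min_l// max_r// -lerBlDr su -lerBrDr.
    have [r rI ru] := IVT st' cst hv.
    rewrite -(addrK vth u) -ru; apply: hr; by rewrite in_itv/= in rI.
  apply: (@ger0_derive1_le_cc _ sin (th s - vth) (th t - vth)).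
  - by move=> u _; exact: derivable_sin.
  - by move=> u; rewrite in_itv/= derive1E derive_val => /andP[su ut]; rewrite onto// !ltW.
  - by apply: continuous_subspaceT => u; exact: continuous_sin.
  - by rewrite in_itv/= lexx lerB.
  - by rewrite in_itv/= lexx lerB.
  - by rewrite lerB.
split => hr.
  by rewrite addr_ge0 ?h1 ?key.
by rewrite ltr_pwDl ?h2 ?key// => r /hr/ltW.
Qed.

Lemma sweeps_line (x0 z0 th0 s0 : R) a b :
  sweeps (fun s => x0 + (s - s0) * cos th0) (fun s => z0 - (s - s0) * sin th0) (fun=> th0) a b.
Proof.
move=> s t vth as_ st tb.
have -> : progress (fun s => x0 + (s - s0) * cos th0) (fun s => z0 - (s - s0) * sin th0) vth s t =
  (t - s) * cos (th0 - vth) by rewrite /progress cosBE; ring.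
have sI : s <= s <= t by rewrite lexx ltW.
split => /(_ s sI) h.
  by rewrite mulr_ge0// subr_ge0 ltW.
by rewrite mulr_gt0// subr_gt0.
Qed.

(** Supporting lines: the curve stays on the inner side of its tangents while
the total turning is at most a half turn. *)
Lemma sweeps_support x z th a b s c : sweeps x z th a b ->
  {in `[a, b] &, {homo th : s t / s <= t}} -> th b - th a <= pi ->
  a <= s <= b -> a <= c <= b ->
  x s * sin (th c) + z s * cos (th c) <= x c * sin (th c) + z c * cos (th c).
Proof.
move=> sw nd tot sI cI; have [as_ sb] := andP sI; have [ac cb] := andP cI.
have aI : a <= a <= b by rewrite lexx (le_trans as_).
have bI : a <= b <= b by rewrite lexx (le_trans as_).
have [sc|cs|->//] := ltgtP s c.
- have [h _] := sw s c (th c - pi / 2) as_ sc cb.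
  have {}h : 0 <= progress x z (th c - pi / 2) s c.
    apply: h => r /andP[sr rc].
    have ra : a <= r <= b by rewrite (le_trans as_ sr) (le_trans rc cb).
    have h1 : th r <= th c by apply: nd; rewrite ?in_itv.
    have h2 : th a <= th r by apply: nd; rewrite ?in_itv//=; case/andP: ra.
    have h3 : th c <= th b by apply: nd; rewrite ?in_itv.
    by apply: cos_ge0_half; rewrite ler_norml; apply/andP; split; lra.
  move: h; rewrite /progress cosBE sinBE sin_pihalf cos_pihalf; lra.
- have [h _] := sw c s (th c + pi / 2) ac cs sb.
  have {}h : 0 <= progress x z (th c + pi / 2) c s.
    apply: h => r /andP[cr rs].
    have ra : a <= r <= b by rewrite (le_trans ac cr) (le_trans rs sb).
    have h1 : th c <= th r by apply: nd; rewrite ?in_itv.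
    have h2 : th r <= th b by apply: nd; rewrite ?in_itv//=; case/andP: ra.
    have h3 : th a <= th c by apply: nd; rewrite ?in_itv.
    by apply: cos_ge0_half; rewrite ler_norml; apply/andP; split; lra.
  move: h; rewrite /progress cosDpihalf sinDpihalf; lra.
Qed.

End Sweeping.

Section SweptTangent.
Variable R : realType.
Local Notation V := 'rV[R]_3.
Variables e1 e2 : V.
Hypotheses (e11 : dot e1 e1 = 1) (e22 : dot e2 e2 = 1) (e12 : dot e1 e2 = 0).
Local Notation planar := (planar e1 e2).
Local Notation unit_T := (unit_T e1 e2).

Variables (x z th : R -> R) (a b : R) (K : R -> V).
Hypothesis sw : sweeps x z th a b.
Hypothesis cth : {within `[a, b], continuous th}.
Hypothesis nd : {in `[a, b] &, {homo th : s t / s <= t}}.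
Hypothesis KE : forall s, a <= s <= b -> K s = planar (x s) (z s).

Let turn_small (s t r : R) : a <= s -> s <= t -> t <= b -> th t - th s < pi / 2 ->
  s <= r <= t -> th s <= th r /\ th r <= th t.
Proof.
move=> as_ st tb _ /andP[sr rt]; split; apply: nd; rewrite ?in_itv/=.
- by rewrite as_ (le_trans st tb).
- by rewrite (le_trans as_ sr) (le_trans rt tb).
- exact: sr.
- by rewrite (le_trans as_ sr) (le_trans rt tb).
- by rewrite tb (le_trans as_ st).
- exact: rt.
Qed.

Let chord_facts (s t : R) : a <= s -> s < t -> t <= b -> th t - th s < pi / 2 ->
  let dx := x t - x s in let dz := z t - z s in
  [/\ 0 < dx * cos (th s) - dz * sin (th s), 0 < dx * cos (th t) - dz * sin (th t),
      dx * sin (th s) + dz * cos (th s) <= 0 & 0 <= dx * sin (th t) + dz * cos (th t)].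
Proof.
move=> as_ st tb small dx dz; have st' := ltW st.
have tr r : s <= r <= t -> th s <= th r /\ th r <= th t by exact: turn_small.
have pi0 := @pi_gt0 R.
have [_ p1] := sw (th s) as_ st tb; have [_ p2] := sw (th t) as_ st tb.
have [p3 _] := sw (th s + pi / 2) as_ st tb.
have [p4 _] := sw (th t - pi / 2) as_ st tb.
split.
- by apply: p1 => r /tr[h1 h2]; apply: cos_gt0_pihalf; apply/andP; split; lra.
- by apply: p2 => r /tr[h1 h2]; apply: cos_gt0_pihalf; apply/andP; split; lra.
- have : 0 <= progress x z (th s + pi / 2) s t.
    by apply: p3 => r /tr[h1 h2]; apply: cos_ge0_half; rewrite ler_norml; apply/andP; split; lra.
  rewrite /progress cosDpihalf sinDpihalf -/dx -/dz; lra.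
- have : 0 <= progress x z (th t - pi / 2) s t.
    by apply: p4 => r /tr[h1 h2]; apply: cos_ge0_half; rewrite ler_norml; apply/andP; split; lra.
  rewrite /progress cosBE sinBE sin_pihalf cos_pihalf -/dx -/dz; lra.
Qed.

Lemma swept_forward (t : R) : a <= t < b ->
  lim (direction (K s - K t) @[s --> t^'+]) = unit_T (th t).
Proof.
move=> /andP[at_ tb].
have tI : t \in `[t, b[ by rewrite in_itv/= lexx.
have ct : th s @[s --> t^'+] --> th t.
  have : {within `[t, b], continuous th} by exact: within_sub cth.
  by move/(continuous_within_itvP _ tb) => [].
apply: (@secant_cvg _ _ _ e11 e22 e12 t^'+ _ (fun s => K s - K t)
  (fun s => x s - x t) (fun s => z s - z t) th (th t) ct).
have pi0 := @pi_gt0 R; have pi20 : 0 < pi / 2 :> R by rewrite divr_gt0.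
move/cvgrPdist_lt : (ct) => /(_ _ pi20) small.
near=> s.
have ts : t < s by near: s; exact: nbhs_right_gt.
have sb : s <= b by near: s; exact: nbhs_right_le.
have sm : th s - th t < pi / 2.
  have : `|th t - th s| < pi / 2 by near: s.
  by rewrite ltr_norml => /andP[]; lra.
have [h1 h2 h3 h4] := chord_facts at_ ts sb sm.
split => //.
- by rewrite !KE ?planarB// ?at_ ?sb ?(ltW tb)// (le_trans at_ (ltW ts)).
- by rewrite mulr_le0_ge0.
Unshelve. all: by end_near. Qed.

Lemma swept_backward (t : R) : a < t <= b ->
  lim (direction (K t - K s) @[s --> t^'-]) = unit_T (th t).
Proof.
move=> /andP[at_ tb].
have ct : th s @[s --> t^'-] --> th t.
  have : {within `[a, t], continuous th} by exact: within_sub cth.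
  by move/(continuous_within_itvP _ at_) => [].
apply: (@secant_cvg _ _ _ e11 e22 e12 t^'- _ (fun s => K t - K s)
  (fun s => x t - x s) (fun s => z t - z s) th (th t) ct).
have pi0 := @pi_gt0 R; have pi20 : 0 < pi / 2 :> R by rewrite divr_gt0.
move/cvgrPdist_lt : (ct) => /(_ _ pi20) small.
near=> s.
have ts : s < t by near: s; exact: nbhs_left_lt.
have sb : a <= s by near: s; exact: nbhs_left_ge.
have sm : th t - th s < pi / 2.
  have : `|th t - th s| < pi / 2 by near: s.
  by rewrite ltr_norml => /andP[]; lra.
have [h1 h2 h3 h4] := chord_facts sb ts tb sm.
split => //.
- by rewrite !KE ?planarB// ?at_ ?sb ?(ltW at_)// (le_trans (ltW ts)).
- by rewrite mulr_ge0_le0.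
Unshelve. all: by end_near. Qed.

End SweptTangent.

Section CurveTangent.
Variable R : realType.
Local Notation V := 'rV[R]_3.
Variables e1 e2 : V.
Hypotheses (e11 : dot e1 e1 = 1) (e22 : dot e2 e2 = 1) (e12 : dot e1 e2 = 0).

Lemma swept_tangent (K : curve R) (x z th : R -> R) (t : R) :
  sweeps x z th (lo K) (hi K) -> {within `[lo K, hi K], continuous th} ->
  {in `[lo K, hi K] &, {homo th : s t / s <= t}} ->
  (forall s, lo K <= s <= hi K -> K s = planar e1 e2 (x s) (z s)) ->
  (closed_curve K -> unit_T e1 e2 (th (lo K)) = unit_T e1 e2 (th (hi K))) ->
  lo K < hi K -> lo K <= t <= hi K -> tangent K t = unit_T e1 e2 (th t).
Proof.
move=> sw cth nd KE cl lohi /andP[lt th_]; rewrite /tangent.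
case: ifPn => [tb|]; first by apply: (swept_forward e11 e22 e12 sw cth nd KE); rewrite lt.
rewrite -leNgt => hit; have -> : t = hi K by apply/le_anti; rewrite th_.
case: ifPn => [/cl <-|_].
  by apply: (swept_forward e11 e22 e12 sw cth nd KE); rewrite lexx.
by apply: (swept_backward e11 e22 e12 sw cth nd KE); rewrite lexx andbT.
Qed.

End CurveTangent.

(** * Riemann-Stieltjes integrals against a turning unit vector *)

Section RiemannStieltjes.
Variable R : realType.
Local Notation V := 'rV[R]_3.
Implicit Types (f g : R -> V) (a b d e I : R).

Lemma itv_partition_consE a b y (s : seq R) :
  itv_partition a b (y :: s) -> a < y /\ itv_partition y b s.
Proof. by rewrite /itv_partition /= => -[/andP[-> ?] ?]. Qed.

Lemma itv_partition_ge a b (s : seq R) : itv_partition a b s -> a <= b.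
Proof.
elim: s a => [|y s IH] a; first by rewrite /itv_partition/= => -[_ /eqP ->].
by move=> /itv_partition_consE[ay /IH]; exact/le_trans/ltW.
Qed.

Lemma itv_partition_nth a b (s : seq R) i : itv_partition a b s -> (i < size s)%N ->
  let x := nth b (a :: s) in [/\ a <= x i, x i < x i.+1 & x i.+1 <= b].
Proof.
elim: s a i => [|y s IH] a i //= /itv_partition_consE[ay ys].
case: i => [_|i]; first by rewrite /= ay lexx; split => //; exact: itv_partition_ge ys.
rewrite ltnS => si; have [h1 h2 h3] := IH y i ys si; split => //.
exact: le_trans (ltW ay) h1.
Qed.

Lemma itv_partition_fine a b d : a < b -> 0 < d -> exists s : seq R,
  itv_partition a b s /\ (forall i, (i < size s)%N ->
    nth b (a :: s) i.+1 - nth b (a :: s) i < d).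
Proof.
move=> ab d0.
have [n hn] : exists n : nat, b - a <= d / 2 * n%:R.
  exists (Num.Def.archi_bound ((b - a) / (d / 2))).
  rewrite -ler_pdivrMl ?divr_gt0// mulrC ltW// archi_boundP// divr_ge0//.
    by rewrite ltW// subr_gt0.
  by rewrite ltW// divr_gt0.
elim: n a ab hn => [|n IH] a ab; first by rewrite mulr0 subr_le0 leNgt ab.
move=> hn; have [bad|dba] := ltP (b - a) d.
  exists [:: b]; split; first by rewrite /itv_partition/= ab eqxx.
  by case.
have ab' : a + d / 2 < b by lra.
have nE : n.+1%:R = n%:R + 1 :> R by rewrite natr1.
have hn' : b - (a + d / 2) <= d / 2 * n%:R by rewrite nE in hn; lra.
have [s [ps ms]] := IH _ ab' hn'.
exists ((a + d / 2) :: s); split.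
  by case: ps => p l; split => //=; rewrite p andbT ltrDl divr_gt0.
case=> [_|i]; first by rewrite /=; lra.
exact: ms.
Qed.

Lemma RS_integral_unique f g a b I I' : a < b ->
  is_RS_integral f g a b I -> is_RS_integral f g a b I' -> I = I'.
Proof.
move=> ab rs rs'; apply/eqP; rewrite -subr_eq0 -normr_le0 leNgt; apply/negP => h.
have e0 : 0 < `|I - I'| / 2 by rewrite divr_gt0.
have [d d0 hd] := rs _ e0; have [d' d'0 hd'] := rs' _ e0.
have m0 : 0 < Num.min d d' by rewrite lt_min d0.
have [s [ps ms]] := itv_partition_fine ab m0.
have := hd s (nth b (a :: s)) ps; have := hd' s (nth b (a :: s)) ps.
cbv zeta; set S := \sum_(i < _) _; move=> H' H.
have {}H : `|I - S| < `|I - I'| / 2.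
  apply: H => i si; have [h1 h2 h3] := itv_partition_nth ps si.
  by have := ms i si; rewrite lt_min => /andP[? _]; rewrite lexx (ltW h2).
have {}H' : `|I' - S| < `|I - I'| / 2.
  apply: H' => i si; have [h1 h2 h3] := itv_partition_nth ps si.
  by have := ms i si; rewrite lt_min => /andP[_ ?]; rewrite lexx (ltW h2).
have : `|I - I'| <= `|I - S| + `|I' - S|.
  by rewrite [`|I' - S|]distrC -[I - I'](subrKA S); exact: ler_normD.
by move: H H'; lra.
Qed.

Lemma RS_integralE f g a b I : a < b -> is_RS_integral f g a b I ->
  RS_integral f g a b = I.
Proof.
move=> ab rs; apply: (RS_integral_unique ab _ rs).
by have := @getPex _ [set J | is_RS_integral f g a b J] (ex_intro _ I rs).
Qed.

Lemma segment_uniform_continuity (f : R -> R) a b e : {within `[a, b], continuous f} ->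
  0 < e -> exists2 d : R, 0 < d & forall x y, a <= x <= b -> a <= y <= b ->
    `|x - y| < d -> `|f x - f y| < e.
Proof.
move=> cf e0.
have /compact_near_coveringP/near_covering_withinP cov := @segment_compact R a b.
have e20 : 0 < e / 2 by rewrite divr_gt0.
have := cov R (0^'+) (fun d x => forall y, a <= y <= b -> `|x - y| < d -> `|f x - f y| < e) _.
case.
  move=> x xI.
  have /subspace_continuousP/(_ x xI)/cvgrPdist_lt/(_ _ e20) := cf.
  rewrite near_withinE => /nbhs_ballP[r /= r0 hr].
  have r20 : 0 < r / 2 by rewrite divr_gt0.
  exists (ball x (r / 2), [set d | 0 < d < r / 2]) => /=.
    split; first exact: nbhsx_ballx.
    near=> d; apply/andP; split; near: d; [exact: nbhs_right_gt|exact: nbhs_right_lt].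
  move=> [x' d] /= [bx' /andP[d0 dr]] x'I y yI x'y.
  have yI' : `[a, b]%classic y by rewrite /= in_itv.
  have r2r : r / 2 <= r by lra.
  have h1 := hr x' (le_ball r2r bx') x'I.
  have h2 : `|f x - f y| < e / 2.
    apply: hr => //; rewrite /ball/= in bx' *.
    by rewrite -[x - y](subrKA x'); apply: le_lt_trans (ler_normD _ _) _; lra.
  rewrite -[f x' - f y](subrKA (f x)); apply: le_lt_trans (ler_normD _ _) _.
  by rewrite distrC; rewrite /= in h1; lra.
move=> r /= r0 hr; exists (r / 2); first by rewrite divr_gt0.
move=> x y xI yI xy; apply: (hr (r / 2)) => //=.
- by rewrite sub0r normrN gtr0_norm ?divr_gt0// ltr_pdivrMr// ltr_pMr// ltr1n.
- by rewrite divr_gt0.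
Unshelve. all: by end_near. Qed.

Lemma partition_sum (h F : R -> R) (c : nat -> R) (eta : R) (s : seq R) a b :
  itv_partition a b s -> sintegrable h a b ->
  (forall i, (i < size s)%N -> let x := nth b (a :: s) in
    `|sint h (x i) (x i.+1) - c i| <= eta * (F (x i.+1) - F (x i))) ->
  `|sint h a b - \sum_(i < size s) c i| <= eta * (F b - F a).
Proof.
elim: s a c => [|y s IH] a c.
  rewrite /itv_partition /= => -[_ /eqP ->] _ _.
  by rewrite sint_pt big_ord0 subrr normr0 subrr mulr0.
move=> ps hi hc; have [ay ys] := itv_partition_consE ps.
have yb := itv_partition_ge ys; have ay' := ltW ay.
rewrite big_ord_recl/= (sint_cat ay' yb hi) opprD addrACA.
have -> : eta * (F b - F a) = eta * (F y - F a) + eta * (F b - F y) by ring.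
apply: (le_trans (ler_normD _ _)); apply: lerD; first exact: (hc 0%N).
apply: (IH y (fun i => c i.+1) ys); first exact: sintegrable_sub hi.
by move=> i si; apply: (hc i.+1).
Qed.

Lemma density_within (w F : R -> R) a b : a <= b -> density w F a b ->
  {within `[a, b], continuous F}.
Proof.
move=> ab [wi wF].
apply: (@eq_within _ (fun x => F a + sint w a x)).
  by move=> x /andP[ax xb]; rewrite wF// addrC subrK.
move=> x; apply: cvgD; first exact: cvg_cst.
exact: parameterized_integral_continuous ab wi x.
Qed.

Lemma density_nd (w F : R -> R) a b : (forall x, 0 <= w x) -> density w F a b ->
  {in `[a, b] &, {homo F : s t / s <= t}}.
Proof.
move=> w0 [wi wF] x y; rewrite !in_itv/= => /andP[ax _] /andP[_ yb] xy.
by rewrite -subr_ge0 -wF//; apply: Rintegral_ge0.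
Qed.

Lemma slope_turning (p q c : R) :
  is_derive c (1 : R) (fun c : R => p * cos c + - (q * sin c)) (- (p * sin c + q * cos c)).
Proof.
apply: is_derive_eq.
by rewrite /GRing.scale/=; ring.
Qed.

Lemma turning_increment (p q x y : R) : x <= y -> exists2 c : R, x <= c <= y &
  p * cos y - q * sin y - (p * cos x - q * sin x) = - (p * sin c + q * cos c) * (y - x).
Proof.
move=> xy; pose F c := p * cos c - q * sin c.
have dF (c : R) : c \in `]x, y[ -> is_derive c 1 F (- (p * sin c + q * cos c)).
  by move=> _; exact: slope_turning.
have cF : {within `[x, y], continuous F}.
  by apply: within_derivable => c _; exact: slope_turning.
have [c cI cE] := MVT_segment xy dF cF.
by exists c => //; rewrite in_itv/= in cI.
Qed.

Variables e1 e2 : V.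

(** A unit vector turning with angular density [w] moves with velocity [- w]
times its normal. On each step of a partition the mean value theorem expresses
its increment by the normal at an intermediate angle; uniform continuity of the
angle replaces boundedness of [w]. *)
Lemma RS_integral_turning f g (th w : R -> R) a b : a < b ->
  {within `[a, b], continuous f} -> (forall x, 0 <= w x) -> density w th a b ->
  (forall s, a <= s <= b -> g s = unit_T e1 e2 (th s)) ->
  sintegrable (fun s => dot (f s) (unit_N e1 e2 (th s)) * w s) a b /\
  RS_integral f g a b = - sint (fun s => dot (f s) (unit_N e1 e2 (th s)) * w s) a b.
Proof.
move=> ab cf w0 dw gE; have ab' := ltW ab.
have cth := density_within ab' dw; have nd := density_nd w0 dw.
have [wi wth] := dw.
have coord i : {within `[a, b], continuous (fun s => f s ord0 i)}.
  by move=> s; apply: (@continuous_comp _ _ _ (f : subspace _ -> V) (fun v : V => v ord0 i));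
    [exact: cf|exact: coord_continuous].
have cdot (v : V) : {within `[a, b], continuous (fun s => dot (f s) v)}.
  apply: (@eq_within _ (fun s => f s 0 0 * v 0 0 + f s 0 1 * v 0 1 + f s 0 2 * v 0 2)).
    by move=> s _; rewrite dotE.
  move=> s; apply: cvgD; [apply: cvgD|]; apply: cvgM; try exact: cvg_cst; exact: coord.
pose p s := dot (f s) e1; pose q s := dot (f s) e2.
have cp : {within `[a, b], continuous p} := cdot e1.
have cq : {within `[a, b], continuous q} := cdot e2.
pose G s := p s * sin (th s) + q s * cos (th s).
have GE s : dot (f s) (unit_N e1 e2 (th s)) = G s.
  by rewrite /unit_N /planar dotDr !dotZr /G mulrC [cos _ * _]mulrC.
have cG : {within `[a, b], continuous G}.
  move=> s; apply: cvgD; apply: cvgM; try exact: cp; try exact: cq.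
    by apply: continuous_comp; [exact: cth|exact: continuous_sin].
  by apply: continuous_comp; [exact: cth|exact: continuous_cos].
have Gw : sintegrable (fun s => G s * w s) a b by exact: sintegrable_mul.
have hE : (fun s => dot (f s) (unit_N e1 e2 (th s)) * w s) = (fun s => G s * w s).
  by apply/funext => s; rewrite GE.
rewrite hE; split => //; apply: RS_integralE => // e e0.
have tot0 : 0 <= th b - th a.
  by rewrite subr_ge0; apply: nd; rewrite ?in_itv/= ?lexx ?ab'.
pose eta := e / (2 * (th b - th a + 1)).
have eta0 : 0 < eta by rewrite divr_gt0// mulr_gt0// ltr_wpDl.
have [Mp Mp0 hMp] := segment_bounded cp; have [Mq Mq0 hMq] := segment_bounded cq.
have eta4 : 0 < eta / 4 by rewrite divr_gt0.
have etaM : 0 < eta / (2 * (Mp + Mq)) by rewrite divr_gt0// mulr_gt0// addr_gt0.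
have [d1 d10 hd1] := segment_uniform_continuity cp eta4.
have [d2 d20 hd2] := segment_uniform_continuity cq eta4.
have [d3 d30 hd3] := segment_uniform_continuity cth etaM.
exists (Num.min d1 (Num.min d2 d3)); first by rewrite !lt_min d10 d20.
move=> s xi ps x hx.
have key i : (i < size s)%N ->
    `|sint (fun s => G s * w s) (x i) (x i.+1) - - dot (f (xi i)) (g (x i.+1) - g (x i))|
    <= eta * (th (x i.+1) - th (x i)).
  move=> si; have [ax xx xb] := itv_partition_nth ps si; have [mesh tag] := hx i si.
  move: mesh tag ax xx xb; rewrite -/x; move: (x i) (x i.+1) (xi i) => u v t.
  rewrite !lt_min => /and3P[m1 m2 m3] /andP[ut tv] au uv vb.
  have tI : a <= t <= b by rewrite (le_trans au ut) (le_trans tv vb).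
  have uI : a <= u <= b by rewrite au (le_trans (ltW uv)).
  have vI : a <= v <= b by rewrite vb (le_trans au (ltW uv)).
  have thuv : th u <= th v by apply: nd; rewrite ?in_itv// ltW.
  have [al alI alE] : exists2 al, th u <= al <= th v &
      dot (f t) (g v - g u) = - (p t * sin al + q t * cos al) * (th v - th u).
    have [c cI cE] := turning_increment (p t) (q t) thuv.
    exists c => //.
    rewrite -cE !gE// dotBr /unit_T /planar !dotDr !dotZr -/(p t) -/(q t); ring.
  rewrite opprK alE -(wth u v au (ltW uv) vb).
  have uvw : sintegrable w u v by exact: sintegrable_sub wi.
  have uvG : sintegrable (fun s => G s * w s) u v by exact: sintegrable_sub Gw.
  set g0 := p t * sin al + q t * cos al.
  have close r : u < r < v -> `|G r - g0| <= eta.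
    move=> /andP[ur rv]; have rI : a <= r <= b.
      by rewrite (le_trans au (ltW ur)) (le_trans (ltW rv)).
    have rt : `|r - t| <= v - u.
      by clear -ut tv ur rv; rewrite ler_norml; apply/andP; split; lra.
    have hp := hd1 r t rI tI (le_lt_trans rt m1).
    have hq := hd2 r t rI tI (le_lt_trans rt m2).
    have uv_small : th v - th u <= eta / (2 * (Mp + Mq)).
      have vu : `|v - u| < d3 by rewrite gtr0_norm ?subr_gt0.
      have /ltW := hd3 v u vI uI vu; apply: le_trans; exact: ler_norm.
    have thur : th u <= th r by apply: nd; rewrite ?in_itv// ltW.
    have thrv : th r <= th v by apply: nd; rewrite ?in_itv// ltW.
    have ang : `|th r - al| <= eta / (2 * (Mp + Mq)).
      apply: le_trans uv_small; case/andP: alI => h1 h2.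
      clear -thur thrv h1 h2; rewrite ler_norml; apply/andP; split; lra.
    have -> : G r - g0 = (p r - p t) * sin (th r) + (q r - q t) * cos (th r) +
      (p t * (sin (th r) - sin al) + q t * (cos (th r) - cos al)) by rewrite /G /g0; ring.
    have s1 : `|sin (th r)| <= 1 by rewrite ler_norml sin_geN1 sin_le1.
    have c1 : `|cos (th r)| <= 1 by rewrite ler_norml cos_geN1 cos_le1.
    have b1 : `|(p r - p t) * sin (th r)| <= eta / 4 by rewrite normrM -[leRHS]mulr1 ler_pM// ltW.
    have b2 : `|(q r - q t) * cos (th r)| <= eta / 4 by rewrite normrM -[leRHS]mulr1 ler_pM// ltW.
    have b3 : `|p t * (sin (th r) - sin al)| <= Mp * (eta / (2 * (Mp + Mq))).
      by rewrite normrM ler_pM// ?hMp// (le_trans (sin_lip _ _)).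
    have b4 : `|q t * (cos (th r) - cos al)| <= Mq * (eta / (2 * (Mp + Mq))).
      by rewrite normrM ler_pM// ?hMq// (le_trans (cos_lip _ _)).
    have b5 : Mp * (eta / (2 * (Mp + Mq))) + Mq * (eta / (2 * (Mp + Mq))) = eta / 2.
      by field; rewrite gt_eqF// addr_gt0.
    apply: (le_trans (ler_normD _ _)).
    have n1 := ler_normD ((p r - p t) * sin (th r)) ((q r - q t) * cos (th r)).
    have n2 := ler_normD (p t * (sin (th r) - sin al)) (q t * (cos (th r) - cos al)).
    apply: (le_trans (lerD n1 n2)).
    apply: (le_trans (lerD (lerD b1 b2) (lerD b3 b4))); rewrite b5; clear; lra.
  have up : sint (fun s => G s * w s) u v <= (g0 + eta) * sint w u v.
    rewrite -sintZ//; apply: le_sint => //; first exact: sintegrableZ.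
    move=> r /close; rewrite ler_norml => /andP[_ h]; apply: ler_wpM2r => //; clear -h; lra.
  have down : (g0 - eta) * sint w u v <= sint (fun s => G s * w s) u v.
    rewrite -sintZ//; apply: le_sint => //; first exact: sintegrableZ.
    move=> r /close; rewrite ler_norml => /andP[h _]; apply: ler_wpM2r => //; clear -h; lra.
  move: up down; move: (sint w u v) (sint _ u v) => W S up down.
  by clear -up down; rewrite ler_norml; apply/andP; split; lra.
have := partition_sum (F := th) ps Gw key; rewrite sumrN opprK -normrN opprD.
move=> /le_lt_trans; apply; rewrite /eta.
rewrite -mulrA gtr_pMr// mulrC ltr_pdivrMr; last by rewrite mulr_gt0// ltr_wpDl.
lra.
Qed.

End RiemannStieltjes.

(** * The tangent angle of the closed curve *)

Section OddExtension.
Variable R : realType.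

Lemma density_opp (w F : R -> R) (a b : R) : density w F a b ->
  density (fun x => w (- x)) (fun x => - F (- x)) (- b) (- a).
Proof.
move=> [wi wF]; split; first by have [] := sint_opp wi.
move=> x y bx xy ya.
have wi' : sintegrable w (- y) (- x).
  by apply: sintegrable_sub wi; [rewrite lerNr|rewrite lerNl].
have [_] := sint_opp wi'; rewrite !opprK => <-.
by rewrite wF ?lerN2//; [ring|rewrite lerNr|rewrite lerNl].
Qed.

Lemma sweeps_sym (x z th X Z Th : R -> R) (H : R) :
  x 0 = 0 -> th 0 = 0 -> sweeps x z th 0 H ->
  (forall s, 0 <= s <= H -> [/\ X s = x s, Z s = z s & Th s = th s]) ->
  (forall s, - H <= s < 0 -> [/\ X s = - x (- s), Z s = z (- s) & Th s = - th (- s)]) ->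
  sweeps X Z Th (- H) H.
Proof.
move=> x0 th0 sw pos neg; apply: (@sweeps_cat _ _ _ _ _ 0).
  have := sweeps_opp sw; rewrite oppr0; apply: eq_sweeps => s /andP[Hs].
  rewrite le_eqVlt => /predU1P[s0|s0]; last first.
    by have [-> -> ->] : [/\ X s = - x (- s), Z s = z (- s) & Th s = - th (- s)]
      by apply: neg; rewrite Hs.
  have [-> -> ->] : [/\ X s = x s, Z s = z s & Th s = th s].
    by apply: pos; rewrite s0 lexx -oppr_le0 -s0.
  by rewrite s0 oppr0 x0 th0 oppr0.
by apply: eq_sweeps sw => s sI; have [-> -> ->] := pos s sI.
Qed.

End OddExtension.

Section TurningAngle.
Variable R : realType.
Variable m : nat.
Hypothesis m1 : (1 <= m)%N.
Implicit Types r s t : R.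
Let M : R := m%:R.
Local Notation H := (M + pi / 2).

Let M1 : 1 <= M.
Proof. by rewrite /M ler1n. Qed.

Let pi0 : 0 < pi / 2 :> R.
Proof. by rewrite divr_gt0// pi_gt0. Qed.

(** Angle turned by the right half of the convex closed curve, from its top:
an arc parametrized by the sine of the angle, a vertical segment and a
quarter circle. *)
Definition turn r : R :=
  if r <= 1 then asin r else if r <= m%:R then pi / 2 else pi / 2 + (r - m%:R).
Definition turn_weight r : R :=
  if r <= 1 then arc_weight r else if r <= m%:R then 0 else 1.

Definition angle s : R := if 0 <= s then turn s else - turn (- s).
Definition weight s : R := turn_weight `|s|.

Lemma turn_weight_ge0 r : 0 <= turn_weight r.
Proof. by rewrite /turn_weight; case: ifP => _; [exact: arc_weight_ge0|case: ifP]. Qed.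

Lemma weight_ge0 s : 0 <= weight s.
Proof. exact: turn_weight_ge0. Qed.

Lemma weightN s : weight (- s) = weight s.
Proof. by rewrite /weight normrN. Qed.

Lemma turn0 : turn 0 = 0.
Proof. by rewrite /turn ler01 asin0. Qed.

Lemma angle0 : angle 0 = 0.
Proof. by rewrite /angle lexx turn0. Qed.

Lemma angleN s : angle (- s) = - angle s.
Proof.
rewrite /angle oppr_ge0; case: (ltgtP s 0) => [s0|s0|->].
- by rewrite opprK.
- by rewrite opprK.
- by rewrite oppr0 turn0 oppr0.
Qed.

Lemma turn_low r : r <= 1 -> turn r = asin r.
Proof. by rewrite /turn => ->. Qed.

Lemma turn_mid r : 1 <= r <= M -> turn r = pi / 2.
Proof.
move=> /andP[r1 rM]; rewrite /turn; case: ifPn => [r1'|_]; last by rewrite rM.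
by have -> : r = 1; [apply/le_anti; rewrite r1'|exact: asin1].
Qed.

Lemma turn_high r : M <= r -> turn r = pi / 2 + (r - M).
Proof.
move=> Mr; have [rM|] := leP r M; last first.
  move=> h; rewrite /turn -/M (leNgt r M) h /= leNgt ifF//.
  by apply/negbTE; rewrite negbK (le_lt_trans M1).
have -> : r = M by apply/le_anti; rewrite rM.
by rewrite turn_mid ?M1 ?lexx// subrr addr0.
Qed.

Lemma density_turn : density turn_weight turn 0 H.
Proof.
apply: (@density_cat _ _ _ 0 1); [exact: ler01|by rewrite (le_trans M1)// lerDl ltW| |].
  have /(@density_sub _ _ _ _ _ 0 1) := @density_asin R.
  move=> /(_ (lerN10 _) (lexx 1)); apply: eq_density.
    by move=> x /andP[_ /ltW x1]; rewrite /turn_weight x1.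
  by move=> x /andP[_ x1]; rewrite turn_low.
apply: (@density_cat _ _ _ 1 M) => //; first by rewrite lerDl ltW.
  apply: (@eq_density _ (fun=> 0) _ (fun=> pi / 2)).
  - by move=> x /andP[x1 /ltW xM]; rewrite /turn_weight leNgt x1 /= xM.
  - by move=> x xI; rewrite turn_mid.
  - exact: density_cst.
apply: (@eq_density _ (fun=> 1) _ (fun r => pi / 2 + (r - M))).
- move=> x /andP[Mx _]; rewrite /turn_weight -/M (leNgt x M) Mx.
  by rewrite leNgt (le_lt_trans M1 Mx).
- by move=> x /andP[Mx _]; rewrite turn_high.
- have dr x : is_derive x (1 : R) (fun r => pi / 2 + (r - M)) (0 + (1 + 0)).
    by repeat slope_step.
  rewrite addr0 add0r in dr.
  apply: ge0_density; first by rewrite lerDl ltW.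
  + by apply: (@within_derivable _ _ (fun=> 1)) => x _; exact: dr.
  + by move=> x _; exact: cst_continuous.
  + by [].
Qed.

Lemma density_angle : density weight angle (- H) H.
Proof.
have H0 : 0 <= H by rewrite addr_ge0 ?(le_trans ler01 M1)// ltW.
apply: (@density_cat _ _ _ _ 0) => //; first by rewrite oppr_le0.
  have := density_opp density_turn; rewrite oppr0; apply: eq_density.
    by move=> x /andP[_ x0]; rewrite /weight ltr0_norm.
  move=> x /andP[_ x0]; rewrite /angle; case: ifPn => // x0'.
  by have -> : x = 0 by [apply/le_anti; rewrite x0]; rewrite oppr0 turn0 oppr0.
apply: eq_density density_turn.
  by move=> x /andP[x0 _]; rewrite /weight gtr0_norm.
by move=> x /andP[x0 _]; rewrite /angle x0.
Qed.

Lemma angle_nd : {in `[(- H), H] &, {homo angle : s t / s <= t}}.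
Proof. exact: density_nd weight_ge0 density_angle. Qed.

Lemma angle_asin s : -1 <= s <= 1 -> angle s = asin s.
Proof.
move=> /andP[s1 s2]; rewrite /angle; case: ifPn => [_|]; first exact: turn_low.
rewrite -ltNge => s0; rewrite turn_low; last by rewrite lerNl.
apply/esym/eqP; rewrite -subr_eq0 opprK.
have h : sin (- asin (- s)) = s by rewrite sinN asinK ?opprK// in_itv/= lerNl opprK s2 lerNl s1.
have b : - s \in `[(-1 : R), 1] by rewrite in_itv/= lerNl opprK s2 lerNl s1.
have b' : -1 <= - s <= 1 by rewrite in_itv in b.
have := @sinK R (- asin (- s)); rewrite h => ->; first by rewrite addNr.
by rewrite in_itv/= lerN2 asin_lepi2//= lerNl asin_geNpi2.
Qed.

Lemma sin_angle s : -1 <= s <= 1 -> sin (angle s) = s.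
Proof. by move=> sI; rewrite angle_asin// asinK// in_itv. Qed.

Lemma cos_angle s : -1 <= s <= 1 -> cos (angle s) = Num.sqrt (1 - s ^+ 2).
Proof. by move=> sI; rewrite angle_asin// cos_asin. Qed.

Lemma angle_end : angle H = pi.
Proof.
have H0 : 0 <= H by rewrite addr_ge0 ?(le_trans ler01 M1)// ltW.
rewrite /angle H0 turn_high; last by rewrite lerDl ltW.
by field.
Qed.

Lemma angle_bounds s : 0 <= s <= H -> 0 <= angle s <= pi.
Proof.
move=> /andP[s0 sH].
have H0 : 0 <= H := le_trans s0 sH.
have I x : 0 <= x <= H -> x \in `[(- H), H].
  by move=> /andP[x0 xH]; rewrite in_itv/= xH andbT (le_trans _ x0)// oppr_le0.
have -> : 0 = angle 0 by rewrite /angle lexx turn0.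
rewrite -[X in _ <= _ <= X]angle_end; apply/andP; split; apply: angle_nd => //;
  by apply: I; rewrite ?lexx ?s0 ?sH ?H0.
Qed.

Lemma angle_half_bounds s : -1 <= s <= 1 -> - (pi / 2) <= angle s <= pi / 2.
Proof. by move=> sI; rewrite angle_asin// asin_geNpi2// asin_lepi2. Qed.

Lemma weight_low s : -1 <= s <= 1 -> weight s = arc_weight s.
Proof.
move=> sI; rewrite /weight /turn_weight ler_norml sI /arc_weight.
by rewrite real_normK ?num_real.
Qed.

End TurningAngle.

(** * The convex closed curve *)

Section ClaspSweep.
Variable R : realType.
Variables a b : R.
Hypotheses (a0 : 0 < a) (a1 : a <= 1) (b0 : 0 < b) (b1 : b <= 1).

(** By definition of [clasp_Z], the parameter is the sine of the tangent angle. *)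
Lemma clasp_sweeps (c : R) :
  sweeps (clasp_X a b) (fun s => c - clasp_Z a b s) (@asin R) 0 a.
Proof.
have in11 s : 0 < s < a -> -1 <= s <= 1.
  by move=> /andP[s0 sa]; rewrite (le_trans (lerN10 _) (ltW s0)) (le_trans (ltW sa)).
apply: (@sweeps_smooth _ _ _ _ (fun s => clasp_dX a b s / Num.sqrt (1 - s ^+ 2))).
- exact: within_clasp_X.
- move=> s; apply: cvgB; [exact: cvg_cst|exact: within_clasp_Z].
- move=> s sI; rewrite divr_gt0 ?clasp_dX_gt0// sqrtr_gt0; exact: sqr_lt1 a1 _ sI.
- move=> s sI; rewrite cos_asin ?in11// divfK ?gt_eqF ?sqrtr_gt0 ?(sqr_lt1 a1 sI)//.
  exact: diff_clasp_X.
- move=> s sI; rewrite asinK ?in_itv/= ?in11//.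
  have -> : - (clasp_dX a b s / Num.sqrt (1 - s ^+ 2) * s) =
    0 + - (s / Num.sqrt (1 - s ^+ 2) * clasp_dX a b s) by ring.
  have dZ := slope_opp (diff_clasp_Z a0 a1 b0 b1 sI).
  have d2 := slope_add (slope_cst c s) dZ.
  exact: d2.
Qed.

End ClaspSweep.

Section ConvexCurve.
Variable R : realType.
Variables (k l m : nat) (tau : R).
Hypotheses (l1 : (1 <= l)%N) (m1 : (1 <= m)%N).
Hypotheses (tau0 : 0 < tau) (taum : tau <= m%:R) (taul : tau <= l%:R).
Implicit Types s t : R.

Local Notation a := (tau / (k + l)%:R).
Local Notation b := (tau / m%:R).
Local Notation c := (tau / l%:R).
Local Notation H := (m%:R + pi / 2 : R).
Local Notation h := (height k l m tau).

Lemma l_gt0 : 0 < l%:R :> R. Proof. by rewrite ltr0n. Qed.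
Lemma m_gt0 : 0 < m%:R :> R. Proof. by rewrite ltr0n. Qed.
Lemma n_gt0 : 0 < (k + l)%:R :> R. Proof. by rewrite ltr0n addn_gt0 l1 orbT. Qed.
Lemma tip_b_gt0 : 0 < b. Proof. by rewrite divr_gt0// m_gt0. Qed.
Lemma tip_b_le1 : b <= 1. Proof. by rewrite ler_pdivrMr ?m_gt0// mul1r. Qed.
Lemma tip_a_gt0 : 0 < a. Proof. by rewrite divr_gt0// n_gt0. Qed.
Lemma tip_c_gt0 : 0 < c. Proof. by rewrite divr_gt0// l_gt0. Qed.
Lemma tip_c_le1 : c <= 1. Proof. by rewrite ler_pdivrMr ?l_gt0// mul1r. Qed.
Lemma tip_a_le_c : a <= c.
Proof. by rewrite ler_pM2l// lef_pV2 ?posrE ?n_gt0 ?l_gt0// ler_nat leq_addl. Qed.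
Lemma tip_a_le1 : a <= 1. Proof. exact: le_trans tip_a_le_c tip_c_le1. Qed.

Let a0 := tip_a_gt0. Let a1 := tip_a_le1. Let b0 := tip_b_gt0. Let b1 := tip_b_le1.

Let M1 : 1 <= m%:R :> R. Proof. by rewrite ler1n. Qed.
Let pi0 : 0 < pi / 2 :> R. Proof. by rewrite divr_gt0// pi_gt0. Qed.

Let H0 : 0 < H. Proof. by rewrite addr_gt0// m_gt0. Qed.

Lemma heightE : h = clasp_height a b. Proof. by []. Qed.

Let xr s := (A_right k l m tau s).1.
Let zr s := (A_right k l m tau s).2.

Lemma A_right_clasp s : s <= a -> A_right k l m tau s = (clasp_X a b s, h - clasp_Z a b s).
Proof. by rewrite /A_right => ->. Qed.

Lemma A_right_circle s : a <= s <= 1 -> A_right k l m tau s = (s, Num.sqrt (1 - s ^+ 2)).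
Proof.
move=> /andP[as_ s1]; rewrite /A_right; case: ifPn => [sa|_]; last by rewrite s1.
have -> : s = a by apply/le_anti; rewrite sa.
by rewrite clasp_X_end// heightE /clasp_height; congr pair; ring.
Qed.

Lemma A_right_vertical s : 1 <= s <= m%:R -> A_right k l m tau s = (1, 1 - s).
Proof.
move=> /andP[s1 sm]; have [->|s1'] := eqVneq s 1.
  by rewrite A_right_circle ?a1 ?lexx// expr1n !subrr sqrtr0.
have {}s1 : 1 < s by rewrite lt_neqAle eq_sym s1'.
by rewrite /A_right leNgt (le_lt_trans a1 s1) leNgt s1 /= sm.
Qed.

Lemma A_right_bottom s : m%:R <= s ->
  A_right k l m tau s = (cos (s - m%:R), 1 - m%:R - sin (s - m%:R)).
Proof.
move=> ms; have [->|ms'] := eqVneq s m%:R.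
  by rewrite A_right_vertical ?M1 ?lexx// subrr cos0 sin0 subr0.
have {}ms : m%:R < s by rewrite lt_neqAle eq_sym ms'.
have s1 := le_lt_trans M1 ms.
by rewrite /A_right leNgt (le_lt_trans a1 s1) leNgt s1 leNgt ms.
Qed.

Lemma A_right_sweeps : sweeps xr zr (turn m) 0 H.
Proof.
apply: (@sweeps_cat _ _ _ _ _ a).
  apply: eq_sweeps (clasp_sweeps a0 a1 b0 b1 h) => s /andP[s0 sa].
  by rewrite /xr /zr A_right_clasp//= turn_low// (le_trans sa).
apply: (@sweeps_cat _ _ _ _ _ 1).
  apply: (@eq_sweeps _ (fun s => s) (fun s => Num.sqrt (1 - s ^+ 2)) (@asin R)).
    by move=> s sI; rewrite /xr /zr A_right_circle//= turn_low//; case/andP: sI.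
  have in11 s : a < s < 1 -> -1 <= s <= 1.
    by move=> /andP[as_ s1]; rewrite (ltW s1) andbT (le_trans (lerN10 _))// (le_trans (ltW a0))// ltW.
  have d0 s : a < s < 1 -> 0 < 1 - s ^+ 2.
    move=> /andP[as_ s1]; apply: oo11; rewrite s1 andbT (lt_le_trans (ltrN10 _))//.
    by rewrite (le_trans (ltW a0))// ltW.
  have S0 s : a < s < 1 -> 0 < Num.sqrt (1 - s ^+ 2) by move=> /d0; rewrite sqrtr_gt0.
  apply: (@sweeps_smooth _ _ _ _ (fun s => (Num.sqrt (1 - s ^+ 2))^-1)).
  - by apply: (@within_derivable _ _ (fun=> 1)) => s _; exact: slope_id.
  - apply: within_diff => s _; apply: continuous_comp; last exact: sqrt_continuous.
    have : is_derive s 1 (fun y : R => 1 - y ^+ 2) (0 + - (2 * s * 1)) by repeat slope_step.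
    by move=> [ds _]; exact/differentiable_continuous/derivable1_diffP.
  - by move=> s sI; rewrite invr_gt0 S0.
  - move=> s sI; rewrite cos_asin ?in11// mulVf ?gt_eqF ?S0//; exact: slope_id.
  - move=> s sI; rewrite asinK ?in_itv/= ?in11//; apply: is_derive_eq.
      by repeat slope_step; exact: d0.
    by field; rewrite gt_eqF// S0.
apply: (@sweeps_cat _ _ _ _ _ m%:R).
  apply: eq_sweeps (sweeps_line 1 0 (pi / 2) 1 (a := 1) (b := m%:R)) => s sI.
  rewrite /xr /zr A_right_vertical//= turn_mid//.
  by rewrite cos_pihalf sin_pihalf mulr0 addr0 mulr1 sub0r opprB.
apply: (@eq_sweeps _ (fun s => cos (s - m%:R)) (fun s => 1 - m%:R - sin (s - m%:R))
  (fun s => pi / 2 + (s - m%:R))).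
  by move=> s /andP[ms _]; rewrite /xr /zr A_right_bottom//= turn_high.
have dm s : is_derive s (1 : R) (fun s => s - m%:R) (1 + 0) by repeat slope_step.
have dcos s : is_derive s (1 : R) (fun s => cos (s - m%:R)) (- sin (s - m%:R) * (1 + 0)).
  exact: (@slope_comp _ cos (fun s => s - m%:R) _ _ _ (is_derive_cos _) (dm s)).
have dsin s : is_derive s (1 : R) (fun s => 1 - m%:R - sin (s - m%:R))
    (0 + - (cos (s - m%:R) * (1 + 0))).
  have d := @slope_comp _ sin (fun s => s - m%:R) _ _ _ (is_derive_sin _) (dm s).
  exact: (slope_add (slope_cst (1 - m%:R) s) (slope_opp d)).
apply: (@sweeps_smooth _ _ _ _ (fun=> 1)).
- by apply: (within_derivable (df := fun s => _)) => s _; exact: dcos.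
- by apply: (within_derivable (df := fun s => _)) => s _; exact: dsin.
- by [].
- move=> s _; rewrite [pi / 2 + _]addrC cosDpihalf mul1r; have := dcos s.
  by rewrite addr0 mulr1.
- move=> s _; rewrite [pi / 2 + _]addrC sinDpihalf mul1r; have := dsin s.
  by rewrite !addr0 mulr1 add0r.
Qed.

Definition A_x t : R := (if 0 <= t then 1 else -1) * (A_right k l m tau `|t|).1.
Definition A_z t : R := (A_right k l m tau `|t|).2.

Lemma A_xN t : A_x (- t) = - A_x t.
Proof.
rewrite /A_x normrN oppr_ge0; case: (ltgtP t 0) => [_|_|->].
- by rewrite mul1r mulN1r opprK.
- by rewrite mul1r mulN1r.
- by rewrite normr0 A_right_clasp ?ltW//= clasp_X0 mulr0 oppr0.
Qed.

Lemma A_zN t : A_z (- t) = A_z t.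
Proof. by rewrite /A_z normrN. Qed.

Lemma A_sweeps : sweeps A_x A_z (angle m) (- H) H.
Proof.
apply: (sweeps_sym (x := xr) (z := zr) (th := turn m)) A_right_sweeps _ _.
- by rewrite /xr A_right_clasp ?ltW//= clasp_X0.
- exact: turn0.
- by move=> s /andP[s0 _]; rewrite /A_x /A_z /angle s0 ger0_norm// mul1r.
- by move=> s /andP[_ s0]; rewrite /A_x /A_z /angle leNgt s0/= ltr0_norm// mulN1r.
Qed.

Lemma A_x_ge0 s : 0 <= s <= H -> 0 <= A_x s.
Proof.
move=> /andP[s0 sH]; rewrite /A_x s0 ger0_norm// mul1r.
have [sa|/ltW as_] := leP s a; first by rewrite A_right_clasp//= clasp_X_ge0.
have [s1|/ltW s1] := leP s 1; first by rewrite A_right_circle ?as_.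
have [sm|/ltW ms] := leP s m%:R; first by rewrite A_right_vertical ?s1//= ler01.
rewrite A_right_bottom//=; apply: cos_ge0_half; rewrite ger0_norm ?subr_ge0//.
by rewrite lerBlDl.
Qed.

(** Convexity: each half turns by at most a half turn, and reflection in the
axis moves a point of the other half outwards. *)
Lemma A_support s t : - H <= s <= H -> - H <= t <= H ->
  A_x s * sin (angle m t) + A_z s * cos (angle m t) <=
  A_x t * sin (angle m t) + A_z t * cos (angle m t).
Proof.
have half u v : 0 <= u <= H -> 0 <= v <= H ->
    A_x u * sin (angle m v) + A_z u * cos (angle m v) <=
    A_x v * sin (angle m v) + A_z v * cos (angle m v).
  apply: sweeps_support.
  - by apply: sweeps_sub A_sweeps; rewrite ?lexx// oppr_le0 ltW.
  - have sub x : x \in `[0, H] -> x \in `[(- H), H].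
      rewrite !in_itv/= => /andP[x0 ->]; rewrite andbT; apply: le_trans x0.
      by rewrite oppr_le0 ltW.
    by move=> x y /sub xI /sub yI; exact: angle_nd.
  - by rewrite angle_end// {1}/angle lexx turn0 subr0.
have pos u v : - H <= u <= H -> 0 <= v <= H ->
    A_x u * sin (angle m v) + A_z u * cos (angle m v) <=
    A_x v * sin (angle m v) + A_z v * cos (angle m v).
  move=> /andP[Hu uH] vI; have [u0|u0] := leP 0 u; first by apply: half; rewrite ?u0.
  have uI : 0 <= - u <= H by rewrite oppr_ge0 (ltW u0) lerNl.
  apply: le_trans (half (- u) v uI vI); rewrite A_zN lerD2r ler_wpM2r//.
    by apply: sin_ge0_pi; exact: angle_bounds.
  by have := A_x_ge0 uI; rewrite A_xN; lra.
move=> sI tI; have [t0|t0] := leP 0 t; first by apply: pos => //; case/andP: tI => _ ->; rewrite t0.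
have sI' : - H <= - s <= H by case/andP: sI => h1 h2; rewrite lerN2 h2 lerNl.
have tI' : 0 <= - t <= H by case/andP: tI => h1 h2; rewrite oppr_ge0 (ltW t0) lerNl.
have := pos (- s) (- t) sI' tI'.
by rewrite angleN sinN cosN !A_xN !A_zN !mulrNN.
Qed.

End ConvexCurve.

(** * Parallels of swept arcs, stretched by straight ends *)

Section Clamp.
Variable R : realType.
Implicit Types (c t : R).

(** The parameter at which the straight extension through the point at [t]
leaves the arc. *)
Definition clamp c t : R := Num.max (- c) (Num.min t c).

Lemma clamp_id c t : - c <= t <= c -> clamp c t = t.
Proof. by move=> /andP[h1 h2]; rewrite /clamp min_l// max_r. Qed.

Lemma clamp_hi c t : 0 <= c -> c <= t -> clamp c t = c.
Proof.
move=> c0 ct; rewrite /clamp min_r// max_r//.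
by rewrite (le_trans _ c0)// oppr_le0.
Qed.

Lemma clamp_lo c t : 0 <= c -> t <= - c -> clamp c t = - c.
Proof.
move=> c0 tc; rewrite /clamp min_l ?max_l//.
by rewrite (le_trans tc)// (le_trans _ c0)// oppr_le0.
Qed.

End Clamp.

Section SweptDensity.
Variable R : realType.
Local Notation V := 'rV[R]_3.
Variables e1 e2 : V.
Hypotheses (e11 : dot e1 e1 = 1) (e22 : dot e2 e2 = 1) (e12 : dot e1 e2 = 0).
Local Notation planar := (planar e1 e2).
Local Notation unit_T := (unit_T e1 e2).
Local Notation unit_N := (unit_N e1 e2).

(** Without boundary terms the first variation of length is the integral of the
curvature against the outward normal component of the field. *)
Lemma dLen_swept (K : curve R) (x z th w : R -> R) (xi : V -> V) :
  lo K < hi K -> sweeps x z th (lo K) (hi K) -> (forall s, 0 <= w s) ->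
  density w th (lo K) (hi K) ->
  (forall s, lo K <= s <= hi K -> K s = planar (x s) (z s)) ->
  {within `[lo K, hi K], continuous (xi \o K)} ->
  (if closed_curve K then unit_T (th (lo K)) = unit_T (th (hi K)) else
    dot (unit_T (th (lo K))) (xi (K (lo K))) = 0 /\
    dot (unit_T (th (hi K))) (xi (K (hi K))) = 0) ->
  let g s := dot (xi (planar (x s) (z s))) (unit_N (th s)) * w s in
  sintegrable g (lo K) (hi K) /\ dLen_curve xi K = sint g (lo K) (hi K).
Proof.
move=> lohi sw w0 dw KE cxi ends g.
have cth := density_within (ltW lohi) dw; have nd := density_nd w0 dw.
have tg s : lo K <= s <= hi K -> tangent K s = unit_T (th s).
  move=> sI; apply: (swept_tangent e11 e22 e12 sw cth nd KE) => // cl.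
  by move: ends; rewrite cl.
have [gi gE] := RS_integral_turning lohi cxi w0 dw tg.
have eqg s : lo K < s < hi K -> dot ((xi \o K) s) (unit_N (th s)) * w s = g s.
  by move=> /andP[h1 h2]; rewrite /= /g KE// !ltW.
split; first exact: eq_sintegrable eqg gi.
rewrite /dLen_curve gE (eq_sint eqg gi) opprK.
case: ifP ends => [_ _|_ [el eh]]; first by rewrite add0r.
by rewrite !tg ?lexx ?(ltW lohi)// el eh subrr add0r.
Qed.

End SweptDensity.

Section Travel.
Variable R : realType.
Local Notation V := 'rV[R]_3.

Lemma travel_ge0 (e : V) (q : R) (p : V) : 0 <= travel e q p.
Proof.
rewrite /travel; set S := [set t | _]; have [->|/set0P S0] := eqVneq S set0.
  by rewrite inf0.
by apply: lb_le_inf => // t [].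
Qed.

Lemma travelE (e : V) (q : R) (p : V) : dot e e = 1 -> dot e p <= q ->
  travel e q p = q - dot e p.
Proof.
move=> ee epq; rewrite /travel.
rewrite (_ : [set t | _] = [set q - dot e p]) ?inf1//.
apply/seteqP; split => t /=.
  by move=> [_]; rewrite /plane/= dotDr dotZr ee mulr1 => <-; rewrite addrAC subrr add0r.
by move=> ->; rewrite /plane/= dotDr dotZr ee mulr1 subr_ge0 addrC subrK.
Qed.

End Travel.

Section OffsetArc.
Variable R : realType.
Local Notation V := 'rV[R]_3.
Variables e1 e2 : V.
Hypotheses (e11 : dot e1 e1 = 1) (e22 : dot e2 e2 = 1) (e12 : dot e1 e2 = 0).
Local Notation planar := (planar e1 e2).
Local Notation unit_T := (unit_T e1 e2).
Local Notation unit_N := (unit_N e1 e2).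

Variables (x z th w : R -> R) (c d : R).
Implicit Types s r ph : R.
Hypotheses (c0 : 0 < c) (d0 : 0 <= d).
Hypothesis sw : sweeps x z th (- c) c.
Hypothesis w0 : forall s, 0 <= w s.
Hypothesis dw : density w th (- c) c.

Definition offset_point s : V := planar (x s) (z s) + d *: unit_N (th s).

Lemma offset_pointE s :
  offset_point s = planar (x s + d * sin (th s)) (z s + d * cos (th s)).
Proof. by rewrite /offset_point planarZ planarD. Qed.

Let c0' : - c < c. Proof. by rewrite gtrN. Qed.
Let cth : {within `[(- c), c], continuous th}.
Proof. exact: (density_within (ltW c0') dw). Qed.
Let nd : {in `[(- c), c] &, {homo th : s t / s <= t}}.
Proof. exact: (density_nd w0 dw). Qed.
Let sw_off : sweeps (fun s => x s + d * sin (th s)) (fun s => z s + d * cos (th s)) th (- c) c.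
Proof. exact: sweeps_offset. Qed.

Section Parallel.
Variables (N : V -> V) (K0 : curve R).
Hypothesis NT : forall ph, N (unit_T ph) = unit_N ph.
Hypotheses (loK0 : lo K0 = - c) (hiK0 : hi K0 = c).
Hypothesis K0E : forall s, - c <= s <= c -> K0 s = planar (x s) (z s).
Hypothesis K0cl : closed_curve K0 -> unit_T (th (- c)) = unit_T (th c).

Lemma tangent_arc s : - c <= s <= c -> tangent K0 s = unit_T (th s).
Proof.
by move=> sI; apply: (swept_tangent (x := x) (z := z) e11 e22 e12); rewrite ?loK0 ?hiK0.
Qed.

Lemma parallel_arcE s : - c <= s <= c -> parallel N d K0 s = offset_point s.
Proof. by move=> sI; rewrite /parallel/= tangent_arc// NT K0E. Qed.

Lemma dLen_closed_parallel (xi : V -> V) : closed_curve K0 ->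
  {within `[(- c), c], continuous (xi \o parallel N d K0)} ->
  let g s := dot (xi (offset_point s)) (unit_N (th s)) * w s in
  sintegrable g (- c) c /\ dLen_curve xi (parallel N d K0) = sint g (- c) c.
Proof.
move=> cl cxi g.
have := @dLen_swept _ _ _ e11 e22 e12 (parallel N d K0) _ _ th w xi.
rewrite /= loK0 hiK0 => /(_ _ _ c0' sw_off w0 dw).
case => //.
- by move=> s sI; rewrite -offset_pointE -parallel_arcE.
- by rewrite cl; exact: K0cl.
- move=> gi gE; split.
    by apply: eq_sintegrable gi => s _; rewrite /g offset_pointE.
  by rewrite gE; apply: eq_sint gi => s _; rewrite /g offset_pointE.
Qed.

End Parallel.

Section Stretched.
Variables (elo ehi : V) (q : R) (P : curve R).
Hypotheses (loP : lo P = - c) (hiP : hi P = c).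
Hypothesis PE : forall s, - c <= s <= c -> P s = offset_point s.
Hypotheses (eloE : elo = - unit_T (th (- c))) (ehiE : ehi = unit_T (th c)).
Local Notation K := (extend elo ehi q P).
Local Notation l1 := (travel elo q (P (- c))).
Local Notation l2 := (travel ehi q (P c)).

Let l1_ge0 : 0 <= l1. Proof. exact: travel_ge0. Qed.
Let l2_ge0 : 0 <= l2. Proof. exact: travel_ge0. Qed.
Let loK : lo K = - c - l1. Proof. by rewrite /= loP. Qed.
Let hiK : hi K = c + l2. Proof. by rewrite /= hiP. Qed.
Let c0_ : 0 <= c. Proof. exact: ltW. Qed.
Let loc : - c - l1 <= - c. Proof. by rewrite lerBlDr lerDl. Qed.
Let hic : c <= c + l2. Proof. by rewrite lerDl. Qed.

Let cI1 : - c <= - c <= c. Proof. by rewrite lexx ltW. Qed.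
Let cI2 : - c <= c <= c. Proof. by rewrite lexx ltW. Qed.

Let KE s : K s = offset_point (clamp c s) + (s - clamp c s) *: unit_T (th (clamp c s)).
Proof.
rewrite /extend/= loP hiP; case: ifPn => [sc|].
  rewrite (clamp_lo c0_ (ltW sc)) PE// eloE scalerN -scaleNr; congr (_ + _ *: _).
  by rewrite opprB.
rewrite -leNgt => cs; case: ifPn => [sc|].
  have sI : - c <= s <= c by rewrite cs.
  by rewrite (clamp_id sI) subrr scale0r addr0 PE.
by rewrite -ltNge => sc; rewrite (clamp_hi c0_ (ltW sc)) PE// ehiE.
Qed.

Lemma extend_points s : - c <= s <= c -> points K (offset_point s).
Proof.
move=> sI; have [h1 h2] := andP sI.
have sK : lo K <= s <= hi K by rewrite loK hiK (le_trans loc h1) (le_trans h2 hic).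
exists s; first by rewrite /= in_itv; exact: sK.
by rewrite KE clamp_id// subrr scale0r addr0.
Qed.

Lemma extend_point_cases p : points K p -> exists s r, [/\ - c <= s <= c,
  p = offset_point s + r *: unit_T (th s) & [\/ r = 0, s = c /\ 0 <= r | s = - c /\ r <= 0]].
Proof.
move=> [s _ <-]; exists (clamp c s), (s - clamp c s).
have [cs|sc] := leP c s.
  rewrite KE (clamp_hi c0_ cs); split.
  - by rewrite lexx ltW.
  - by [].
  - by apply: Or32; rewrite subr_ge0.
have [sc'|cs] := leP s (- c).
  rewrite KE (clamp_lo c0_ sc'); split.
  - by rewrite lexx ltW.
  - by [].
  - by apply: Or33; rewrite subr_le0.
have sI : - c <= s <= c by rewrite !ltW.
rewrite KE (clamp_id sI); split.
- exact: sI.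
- by [].
- by apply: Or31; rewrite subrr.
Qed.

Let sx s := x (clamp c s) + d * sin (th (clamp c s)) + (s - clamp c s) * cos (th (clamp c s)).
Let sz s := z (clamp c s) + d * cos (th (clamp c s)) - (s - clamp c s) * sin (th (clamp c s)).
Let sth s := th (clamp c s).
Let sww s := if `|s| < c then w s else 0.

Let Kplanar s : K s = planar (sx s) (sz s).
Proof.
rewrite KE offset_pointE [X in _ + _ *: X]/(planar _ _) planarZ planarD.
by congr planar; rewrite mulrN.
Qed.

Let lohi : lo K < hi K.
Proof. by rewrite loK hiK; apply: (le_lt_trans loc); exact: (lt_le_trans c0' hic). Qed.

Let ssw : sweeps sx sz sth (lo K) (hi K).
Proof.
rewrite loK hiK; apply: (@sweeps_cat _ _ _ _ _ (- c)).
  apply: eq_sweeps (sweeps_line (x (- c) + d * sin (th (- c))) (z (- c) + d * cos (th (- c)))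
    (th (- c)) (- c) (a := - c - l1) (b := - c)) => s /andP[_ sc].
  by rewrite /sx /sz /sth (clamp_lo c0_ sc).
apply: (@sweeps_cat _ _ _ _ _ c).
  apply: eq_sweeps sw_off => s sI.
  by rewrite /sx /sz /sth (clamp_id sI) subrr !mul0r addr0 subr0.
apply: eq_sweeps (sweeps_line (x c + d * sin (th c)) (z c + d * cos (th c))
    (th c) c (a := c) (b := c + l2)) => s /andP[cs _].
by rewrite /sx /sz /sth (clamp_hi c0_ cs).
Qed.

Let out s : c <= `|s| -> sww s = 0.
Proof. by rewrite /sww leNgt => /negbTE ->. Qed.

Let out_lo s : s <= - c -> c <= `|s|.
Proof. by move=> sc; rewrite ler_normr; apply/orP; right; rewrite lerNr. Qed.

Let out_hi s : c <= s -> c <= `|s|.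
Proof. by move=> sc; rewrite ler_normr sc. Qed.

Let sdw : density sww sth (lo K) (hi K).
Proof.
rewrite loK hiK; apply: (@density_cat _ _ _ _ (- c)).
- exact: loc.
- exact: (le_trans (ltW c0') hic).
- apply: (@eq_density _ (fun=> 0) _ (fun=> th (- c))).
  + by move=> s /andP[_ sc]; rewrite (out (out_lo (ltW sc))).
  + by move=> s /andP[_ sc]; rewrite /sth (clamp_lo c0_ sc).
  + by apply: density_cst.
- apply: (@density_cat _ _ _ _ c).
  + exact: ltW.
  + exact: hic.
  + apply: eq_density dw.
      by move=> s sI; rewrite /sww ltr_norml sI.
    by move=> s sI; rewrite /sth (clamp_id sI).
  + apply: (@eq_density _ (fun=> 0) _ (fun=> th c)).
    * by move=> s /andP[cs _]; rewrite (out (out_hi (ltW cs))).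
    * by move=> s /andP[cs _]; rewrite /sth (clamp_hi c0_ cs).
    * by apply: density_cst.
Qed.

Let extend_lo : K (lo K) = offset_point (- c) - l1 *: unit_T (th (- c)).
Proof.
rewrite KE loK (clamp_lo c0_ loc) -scaleNr; congr (_ + _ *: _).
by rewrite addrAC subrr add0r.
Qed.

Let extend_hi : K (hi K) = offset_point c + l2 *: unit_T (th c).
Proof. by rewrite KE hiK (clamp_hi c0_ hic) [c + _]addrC addrK. Qed.

Let dLen_stretched (xi : V -> V) :
  {within `[lo K, hi K], continuous (xi \o K)} ->
  dot (unit_T (th (- c))) (xi (K (lo K))) = 0 ->
  dot (unit_T (th c)) (xi (K (hi K))) = 0 ->
  let g s := dot (xi (offset_point s)) (unit_N (th s)) * w s in
  sintegrable g (- c) c /\ dLen_curve xi K = sint g (- c) c.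
Proof.
move=> cxi el eh g.
have sww0 s : 0 <= sww s by rewrite /sww; case: ifP.
have KE' s : lo K <= s <= hi K -> K s = planar (sx s) (sz s) by rewrite Kplanar.
have [|gi gE] := dLen_swept e11 e22 e12 lohi ssw sww0 sdw KE' cxi.
  split.
    by rewrite /sth {1}loK (clamp_lo c0_ loc).
  by rewrite /sth {1}hiK (clamp_hi c0_ hic).
set G := (fun s : R => _) in gi gE.
have inner s : - c < s < c -> G s = g s.
  move=> sI; have sI' : - c <= s <= c by case/andP: sI => ? ?; rewrite !ltW.
  rewrite /G -Kplanar KE /sth /sww /g (clamp_id sI') subrr scale0r addr0.
  by rewrite ltr_norml sI.
have h1 : lo K <= - c by rewrite loK.
have h2 : c <= hi K by rewrite hiK.
have h3 : - c <= hi K by exact: (le_trans (ltW c0') h2).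
have gi' : sintegrable G (- c) c by exact: (sintegrable_sub h1 h2 gi).
have gi2 : sintegrable G (- c) (hi K) by exact: (sintegrable_sub h1 (lexx _) gi).
have gi3 : sintegrable G (lo K) (- c) by exact: (sintegrable_sub (lexx _) h3 gi).
have gi4 : sintegrable G c (hi K) by exact: (sintegrable_sub (ltW c0') (lexx _) gi2).
split; first exact: (eq_sintegrable inner gi').
have zero a' b' : (forall s, a' < s < b' -> c <= `|s|) -> sintegrable G a' b' -> sint G a' b' = 0.
  move=> o hi'; have E s : a' < s < b' -> G s = 0 by move=> /o /out so; rewrite /G so mulr0.
  by rewrite (eq_sint (g := fun=> 0) E hi') /sint Rintegral_cst// mul0r.
rewrite gE (sint_cat h1 h3 gi) (sint_cat (ltW c0') h2 gi2) (eq_sint inner gi').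
rewrite (zero _ _ _ gi3); last by move=> s /andP[_ /ltW]; exact: out_lo.
rewrite (zero _ _ _ gi4); last by move=> s /andP[/ltW + _]; exact: out_hi.
by rewrite add0r addr0.
Qed.

Hypothesis beyond : forall p, points K p -> dot elo p <= q /\ dot ehi p <= q.

(** The straight ends reach the planes, so that a compatible field is orthogonal
to the tangents there and the boundary terms vanish. *)
Lemma dLen_extend (xi : V -> V) :
  {within `[lo K, hi K], continuous (xi \o K)} ->
  plane elo q (K (lo K) + xi (K (lo K))) -> plane ehi q (K (hi K) + xi (K (hi K))) ->
  let g s := dot (xi (offset_point s)) (unit_N (th s)) * w s in
  sintegrable g (- c) c /\ dLen_curve xi K = sint g (- c) c.
Proof.
move=> cxi plo phi.
have loE : unit_T (th (- c)) = - elo by rewrite eloE opprK.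
have ee1 : dot elo elo = 1 by rewrite eloE dotNl dotNr opprK unit_T_dot.
have ee2 : dot ehi ehi = 1 by rewrite ehiE unit_T_dot.
have [q1 _] := beyond (extend_points cI1); have [_ q2] := beyond (extend_points cI2).
have Klo : dot elo (K (lo K)) = q.
  rewrite extend_lo PE// (travelE ee1 q1) loE dotBr dotZr dotNr ee1.
  by rewrite mulrN1 opprK addrC subrK.
have Khi : dot ehi (K (hi K)) = q.
  rewrite extend_hi PE// (travelE ee2 q2) -ehiE dotDr dotZr ee2.
  by rewrite mulr1 addrC subrK.
apply: dLen_stretched => //.
  have : dot elo (K (lo K) + xi (K (lo K))) = q by exact: plo.
  by rewrite dotDr Klo loE dotNl; lra.
have : dot ehi (K (hi K) + xi (K (hi K))) = q by exact: phi.
by rewrite dotDr Khi -ehiE; lra.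
Qed.

End Stretched.

End OffsetArc.

(** * Distances between parallels *)

Section ParallelDistance.
Variable R : realType.
Local Notation V := 'rV[R]_3.
Variables (e1 e2 : V) (x z ph : R -> R).
Hypotheses (e11 : dot e1 e1 = 1) (e22 : dot e2 e2 = 1) (e12 : dot e1 e2 = 0).
Implicit Types d s t r : R.

(** The normal at [t] separates the two points: by convexity the inner parallel
is at most [d] beyond the supporting line at [t]. *)
Lemma parallel_dist d d' s t r r' :
  0 <= d -> d + 1 <= d' ->
  x s * sin (ph t) + z s * cos (ph t) <= x t * sin (ph t) + z t * cos (ph t) ->
  r * sin (ph t - ph s) <= 0 ->
  1 <= enorm (offset_point e1 e2 x z ph d' t + r' *: unit_T e1 e2 (ph t)
              - (offset_point e1 e2 x z ph d s + r *: unit_T e1 e2 (ph s))).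
Proof.
move=> d0 dd' supp rs; apply: (enorm_ge1_dot (unit_N_dot e11 e22 e12 (ph t))).
have E u q v : dot (unit_N e1 e2 (ph t)) (offset_point e1 e2 x z ph u q + v *: unit_T e1 e2 (ph q)) =
    x q * sin (ph t) + z q * cos (ph t) + u * cos (ph t - ph q) + v * sin (ph t - ph q).
  rewrite offset_pointE planarZ planarD (dot_planar e11 e22 e12) cosBE sinBE; ring.
rewrite dotBr !E subrr sin0 cos0 mulr0 addr0 mulr1.
have dc : d * cos (ph t - ph s) <= d by rewrite ler_piMr// cos_le1.
lra.
Qed.

End ParallelDistance.

(** * Curvature integrals *)

Section TurningIntegrals.
Variable R : realType.
Local Notation V := 'rV[R]_3.
Implicit Types (x y e p q : R) (f g w th : R -> R).

Lemma sint_even f x : 0 <= x -> sintegrable f (- x) x ->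
  sintegrable (fun s => f s + f (- s)) 0 x /\
  sint f (- x) x = sint (fun s => f s + f (- s)) 0 x.
Proof.
move=> x0 fi; have Nx0 : - x <= 0 by rewrite oppr_le0.
have fi1 : sintegrable f (- x) 0 by exact: (sintegrable_sub (lexx _) x0 fi).
have fi2 : sintegrable f 0 x by exact: (sintegrable_sub Nx0 (lexx _) fi).
have [gi gE] := sint_opp fi1; rewrite oppr0 opprK in gi gE.
split; first exact: sintegrableD.
by rewrite (sint_cat Nx0 x0 fi) gE sintD// addrC.
Qed.

Lemma sint_conj f p q : 0 < p -> 0 < q -> sintegrable f 0 q ->
  sintegrable (fun u => f (conj_param p q u)) 0 p /\
  p * sint f 0 q = q * sint (fun u => f (conj_param p q u)) 0 p.
Proof.
move=> p0 q0 fi; have qp0 : - (q / p) < 0 by rewrite oppr_lt0 divr_gt0.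
have := sint_affine q qp0 fi; rewrite subrr mul0r opprK.
rewrite (_ : (0 - q) / - (q / p) = p); last by field; rewrite !gt_eqF.
rewrite (_ : (fun x => f (- (q / p) * x + q)) = fun u => f (conj_param p q u)); last first.
  by apply/funext => u; rewrite /conj_param addrC mulNr.
by move=> [hi ->]; split => //; field; rewrite gt_eqF.
Qed.

Lemma telescope_partition (g : R -> V) (s : seq R) x y : itv_partition x y s ->
  \sum_(i < size s) (g (nth y (x :: s) i.+1) - g (nth y (x :: s) i)) = g y - g x.
Proof.
elim: s x => [|z s IH] x; first by rewrite /itv_partition/= => -[_ /eqP ->]; rewrite big_ord0 subrr.
move=> /itv_partition_consE[_ zs]; rewrite big_ord_recl/= IH//.
by rewrite addrC addrA subrK.
Qed.

Lemma dot_sumr (p : V) n (F : 'I_n -> V) : dot p (\sum_(i < n) F i) = \sum_(i < n) dot p (F i).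
Proof.
elim/big_rec2: _ => [|i u v _ <-]; last by rewrite dotDr.
by rewrite dotE !mxE !mulr0 !addr0.
Qed.

Variables e1 e2 : V.
Local Notation unit_T := (unit_T e1 e2).
Local Notation unit_N := (unit_N e1 e2).

(** The Riemann-Stieltjes sums against a constant telescope. *)
Lemma sint_turning_cst (p : V) (th w : R -> R) x y : x <= y -> (forall s, 0 <= w s) ->
  density w th x y ->
  sintegrable (fun s => dot p (unit_N (th s)) * w s) x y /\
  sint (fun s => dot p (unit_N (th s)) * w s) x y =
    dot p (unit_T (th x)) - dot p (unit_T (th y)).
Proof.
rewrite le_eqVlt => /predU1P[->|xy] w0 dw.
  by split; [exact: sintegrable_pt|rewrite sint_pt subrr].
have cp : {within `[x, y], continuous (fun=> p)} by apply: continuous_subspaceT => ?; exact: cvg_cst.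
have [gi gE] := RS_integral_turning xy cp w0 dw (fun s _ => erefl (unit_T (th s))).
split=> //; rewrite -[LHS]opprK -gE.
have rs : is_RS_integral (fun=> p) (fun s => unit_T (th s)) x y
    (dot p (unit_T (th y)) - dot p (unit_T (th x))).
  move=> e e0; exists 1 => // s xi ps X _.
  rewrite -dot_sumr (telescope_partition (fun s => unit_T (th s)) ps) dotBr subrr normr0//.
by rewrite (RS_integralE xy rs) opprB.
Qed.

Lemma sint_weight_ge f g w th e x y : x <= y -> (forall s, 0 <= w s) -> density w th x y ->
  sintegrable (fun s => f s * w s) x y -> sintegrable (fun s => g s * w s) x y ->
  (forall s, x < s < y -> g s - e <= f s) ->
  sint (fun s => g s * w s) x y - e * (th y - th x) <= sint (fun s => f s * w s) x y.
Proof.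
move=> xy w0 [wi wth] fi gi gf.
rewrite -(wth x y)// -mulNr -sintZ// -sintD//; last exact: sintegrableZ.
apply: le_sint => //; first by apply: sintegrableD => //; exact: sintegrableZ.
by move=> s sI; rewrite -mulrDl ler_wpM2r// gf.
Qed.

Lemma sint_turning_ge (p : V) f w th e x y : x <= y -> (forall s, 0 <= w s) ->
  density w th x y -> sintegrable (fun s => f s * w s) x y ->
  (forall s, x < s < y -> dot p (unit_N (th s)) - e <= f s) ->
  dot p (unit_T (th x)) - dot p (unit_T (th y)) - e * (th y - th x) <=
  sint (fun s => f s * w s) x y.
Proof.
move=> xy w0 dw fi pf; have [gi <-] := sint_turning_cst p xy w0 dw.
exact: sint_weight_ge.
Qed.

End TurningIntegrals.

Section BalanceArithmetic.
Variable R : realType.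

Lemma total_arith (k l m n a c t e p I0 J0 u1 um S1 S2 S3 : R) :
  n = k + l -> n * a = t -> l * c = t ->
  - (e * ((n + m) * p)) <= n * I0 + m * J0 -> - (2 * k * (m * e)) <= 2 * k * (u1 - um) ->
  k * (I0 + (2 * 1 - 2 * a) * u1 - 2 * um - n * e * (2 * p)) <= S1 ->
  l * (I0 + (2 * c - 2 * a) * u1 - n * e * (2 * p)) <= S2 ->
  m * (J0 - m * e * (2 * p)) <= S3 ->
  - (e * ((n + m) * p + 2 * k * m + 2 * p * (n ^+ 2 + m ^+ 2))) <= S1 + S2 + S3.
Proof.
move=> -> na lc h1 h2 h3 h4 h5.
have {na lc} E : (k + l) * a * u1 = l * c * u1 by rewrite na lc.
lra.
Qed.

Lemma upper_arith (a r E I0 S1 S2 S3 Ca Ca' Cr Cr' ta ta' tr tr' up1 : R) :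
  I0 - E * (ta - ta') <= S2 -> Ca - Cr - E * (tr - ta) <= S3 ->
  Cr' - Ca' - E * (ta' - tr') <= S1 -> Ca - Ca' = - (2 * a) * up1 ->
  Cr - Cr' = - (2 * r) * up1 ->
  I0 + (2 * r - 2 * a) * up1 - E * (tr - tr') <= S1 + (S2 + S3).
Proof. by lra. Qed.

Lemma alpha_arith (p E U S1 S3 S5 BH BH' Bm Bm' upm : R) :
  BH' - Bm' - E * (- (p / 2) - - p) <= S1 -> U - E * (p / 2 - - (p / 2)) <= S3 ->
  Bm - BH - E * (p - p / 2) <= S5 -> Bm - Bm' = - (2 * 1) * upm -> BH = BH' ->
  U - 2 * upm - E * (2 * p) <= S1 + (0 + (S3 + (0 + S5))).
Proof. by lra. Qed.

End BalanceArithmetic.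

(** * Distances between strands and hoops *)

Section LinkGeometry.
Variable R : realType.
Local Notation V := 'rV[R]_3.
Variables (k l m : nat) (tau : R).
Hypotheses (l1 : (1 <= l)%N) (m1 : (1 <= m)%N).
Hypotheses (tau0 : 0 < tau) (taum : tau <= m%:R) (taul : tau <= l%:R).
Implicit Types s t u v d e r ph : R.
Implicit Types p q : V.

Local Notation a := (tau / (k + l)%:R).
Local Notation b := (tau / m%:R).
Local Notation c := (tau / l%:R).
Local Notation H := (m%:R + pi / 2 : R).
Local Notation h := (height k l m tau).
Local Notation th := (@angle R m).
Local Notation w := (@weight R m).

Let a0 : 0 < a := tip_a_gt0 k l1 tau0. Let a1 : a <= 1 := tip_a_le1 k l1 tau0 taul.
Let b0 : 0 < b := tip_b_gt0 m1 tau0. Let b1 : b <= 1 := tip_b_le1 m1 taum.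
Let c0 : 0 < c := tip_c_gt0 l1 tau0. Let c1 : c <= 1 := tip_c_le1 l1 taul.
Let ac : a <= c := tip_a_le_c k l1 tau0.
Let M1 : 1 <= m%:R :> R. Proof. by rewrite ler1n. Qed.
Let pi0 : 0 < pi / 2 :> R. Proof. by rewrite divr_gt0// pi_gt0. Qed.
Let MH : m%:R <= H. Proof. by rewrite lerDl ltW. Qed.
Let oneH : 1 <= H := le_trans M1 MH.
Let H0 : 0 < H. Proof. exact: lt_le_trans oneH. Qed.
Let cH : c <= H := le_trans c1 oneH.
Let bH : b <= H := le_trans b1 oneH.

Let aI : -1 <= a <= 1. Proof. by rewrite a1 (le_trans (lerN10 _) (ltW a0)). Qed.
Let bI : -1 <= b <= 1. Proof. by rewrite b1 (le_trans (lerN10 _) (ltW b0)). Qed.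
Let cI : -1 <= c <= 1. Proof. by rewrite c1 (le_trans (lerN10 _) (ltW c0)). Qed.

Definition frame_x : V := vec3 1 0 0.
Definition frame_y : V := vec3 0 1 0.
Definition frame_up : V := vec3 0 0 1.
Definition frame_down : V := vec3 0 0 (-1).

Lemma frame_xx : dot frame_x frame_x = 1. Proof. by rewrite dot_vec33; ring. Qed.
Lemma frame_yy : dot frame_y frame_y = 1. Proof. by rewrite dot_vec33; ring. Qed.
Lemma frame_uu : dot frame_up frame_up = 1. Proof. by rewrite dot_vec33; ring. Qed.
Lemma frame_dd : dot frame_down frame_down = 1. Proof. by rewrite dot_vec33; ring. Qed.
Lemma frame_xu : dot frame_x frame_up = 0. Proof. by rewrite dot_vec33; ring. Qed.
Lemma frame_yd : dot frame_y frame_down = 0. Proof. by rewrite dot_vec33; ring. Qed.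

Lemma planar_up x z : planar frame_x frame_up x z = vec3 x 0 z.
Proof. by rewrite /planar !vec3Z vec3D; congr vec3; ring. Qed.

Lemma planar_down x z : planar frame_y frame_down x z = vec3 0 x (- z).
Proof. by rewrite /planar !vec3Z vec3D; congr vec3; ring. Qed.

(** The parallel of the closed curve at distance [d]; inner strands run all
around it, outer ones follow its upper part. *)
Definition strand : R -> R -> V :=
  offset_point frame_x frame_up (A_x k l m tau) (A_z k l m tau) th.
Definition strand_T s : V := unit_T frame_x frame_up (th s).
Definition strand_N s : V := unit_N frame_x frame_up (th s).

(** The hoops hang upside down: their outward normal points down at the tip. *)
Definition hoop : R -> R -> V :=
  offset_point frame_y frame_down (clasp_X b a) (fun v => - clasp_Z b a v) th.
Definition hoop_T v : V := unit_T frame_y frame_down (th v).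
Definition hoop_N v : V := unit_N frame_y frame_down (th v).

Lemma strand_TE s : strand_T s = vec3 (cos (th s)) 0 (- sin (th s)).
Proof. exact: planar_up. Qed.

Lemma strand_NE s : strand_N s = vec3 (sin (th s)) 0 (cos (th s)).
Proof. exact: planar_up. Qed.

Lemma hoop_TE v : hoop_T v = vec3 0 (cos (th v)) (sin (th v)).
Proof. by rewrite /hoop_T /unit_T planar_down opprK. Qed.

Lemma hoop_NE v : hoop_N v = vec3 0 (sin (th v)) (- cos (th v)).
Proof. exact: planar_down. Qed.

Lemma strandE d s :
  strand d s = vec3 (A_x k l m tau s + d * sin (th s)) 0 (A_z k l m tau s + d * cos (th s)).
Proof. by rewrite /strand offset_pointE planar_up. Qed.

Lemma hoopE e v :
  hoop e v = vec3 0 (clasp_X b a v + e * sin (th v)) (clasp_Z b a v - e * cos (th v)).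
Proof. by rewrite /hoop offset_pointE planar_down; congr vec3; ring. Qed.

Lemma strandD d e s : strand (d + e) s = strand d s + e *: strand_N s.
Proof. by rewrite /strand /offset_point scalerDl addrA. Qed.

Lemma hoopD d e v : hoop (d + e) v = hoop d v + e *: hoop_N v.
Proof. by rewrite /hoop /offset_point scalerDl addrA. Qed.

Lemma density_angle_sub t : 0 < t -> t <= H -> density w th (- t) t.
Proof. by move=> t0 tH; apply: (density_sub _ tH (density_angle R m1)); rewrite lerN2. Qed.

Lemma strand_sweeps t : t <= H -> sweeps (A_x k l m tau) (A_z k l m tau) th (- t) t.
Proof.
move=> tH; apply: sweeps_sub (A_sweeps k l1 m1 tau0 taum taul); last exact: tH.
by rewrite lerN2.
Qed.

Lemma hoop_sweeps : sweeps (clasp_X b a) (fun v => - clasp_Z b a v) th (- b) b.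
Proof.
apply: (sweeps_sym (x := clasp_X b a) (z := fun v => 0 - clasp_Z b a v) (th := @asin R)).
- exact: clasp_X0.
- exact: asin0.
- exact: clasp_sweeps.
- move=> s /andP[s0 sb]; rewrite sub0r angle_asin//.
  by rewrite (le_trans (lerN10 _) s0) (le_trans sb).
- move=> s /andP[bs s0]; rewrite clasp_ZN sub0r clasp_X_odd// opprK; split => //.
  have sI : -1 <= - s <= 1.
    by rewrite (le_trans (lerN10 _)) ?oppr_ge0 ?(ltW s0)// (le_trans _ b1)// lerNl.
  by rewrite -(angle_asin m)// angleN opprK.
Qed.

Lemma A_normal_T ph : A_normal (unit_T frame_x frame_up ph) = unit_N frame_x frame_up ph.
Proof. by rewrite /unit_T /unit_N !planar_up /A_normal /zc /x1 !mxE/= opprK. Qed.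

Lemma gamma_normal_T ph :
  gamma_normal (unit_T frame_y frame_down ph) = unit_N frame_y frame_down ph.
Proof. by rewrite /unit_T /unit_N !planar_down opprK /gamma_normal /zc /x2 !mxE/=. Qed.

Lemma A_curveE s : A_curve k l m tau s = planar frame_x frame_up (A_x k l m tau s) (A_z k l m tau s).
Proof. by rewrite planar_up. Qed.

Lemma A_curve_tangent s : - H <= s <= H -> tangent (A_curve k l m tau) s = strand_T s.
Proof.
apply: (tangent_arc frame_xx frame_uu frame_xu H0 (strand_sweeps (lexx _)) (weight_ge0 m)
  (density_angle_sub H0 (lexx _))) => //.
- by move=> t _; exact: A_curveE.
- move=> _; rewrite angleN angle_end// /unit_T cosN sinN sinpi opprK oppr0 //.
Qed.

Lemma A_z_ge0 s : `|s| <= 1 -> 0 <= A_z k l m tau s.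
Proof.
move=> s1; rewrite /A_z; have [sa|/ltW sa] := leP `|s| a.
  rewrite A_right_clasp//= heightE.
  have := clasp_Z_nd a0 a1 b0 b1 (normr_ge0 s) sa (lexx a).
  rewrite /clasp_height; have := sqrtr_ge0 (1 - a ^+ 2).
  by move: (Num.sqrt _) (clasp_Z _ _ _) (clasp_Z _ _ _) => p q r; lra.
by rewrite A_right_circle ?sa//= sqrtr_ge0.
Qed.

Lemma A_z_lt0 s : 1 < `|s| -> `|s| <= H -> A_z k l m tau s < 0.
Proof.
move=> s1 sH; rewrite /A_z; have [sm|ms] := leP `|s| m%:R.
  by rewrite A_right_vertical ?(ltW s1)//= subr_lt0.
rewrite A_right_bottom ?(ltW ms)//=.
have : 0 < sin (`|s| - m%:R).
  apply: sin_gt0_pi; rewrite subr_gt0 ms/=; have := pi0; lra.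
have := M1; lra.
Qed.

(** On the side and the bottom of the closed curve the height is negative, and
on its upper part the parameter is the sine of the tangent angle. *)
Lemma beta_rangeE : beta_range k l m tau = `[- c, c]%classic.
Proof.
have loH : lo (A_curve k l m tau) = - H by [].
have hiH : hi (A_curve k l m tau) = H by [].
have zE (x y z : R) : zc (vec3 x y z) = z by rewrite /zc !mxE.
apply/seteqP; split => s /=.
  rewrite /beta_range/= => -[sH]; rewrite zE => Az0.
  have s1 : `|s| <= 1.
    rewrite leNgt; apply/negP => /A_z_lt0; rewrite ler_norml sH => /(_ isT).
    by rewrite ltNge Az0.
  rewrite (A_curve_tangent sH) strand_TE zE normrN sin_angle ?in_itv/= ?ler_norml//.
  by rewrite -ler_norml.
rewrite in_itv/= -ler_norml => sc; have s1 := le_trans sc c1.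
have sH : - H <= s <= H by rewrite -ler_norml (le_trans s1).
rewrite /beta_range/=; split => //; first by rewrite zE; exact: A_z_ge0.
by rewrite (A_curve_tangent sH) strand_TE zE normrN sin_angle// -ler_norml.
Qed.

Let cN : - c <= c. Proof. by rewrite ge0_cp// ltW. Qed.

Lemma beta_lo : lo (beta_tip_arc k l m tau) = - c.
Proof. by rewrite /= beta_rangeE inf_itv// bnd_simp. Qed.

Lemma beta_hi : hi (beta_tip_arc k l m tau) = c.
Proof. by rewrite /= beta_rangeE sup_itv// bnd_simp. Qed.

Lemma n_dir_lo : n_dir l tau true = - strand_T (- c).
Proof.
rewrite strand_TE vec3N angleN cosN sinN sin_angle// cos_angle// /n_dir.
by congr vec3; rewrite ?mulN1r ?oppr0 ?opprK// expr1 mulN1r.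
Qed.

Lemma n_dir_hi : n_dir l tau false = strand_T c.
Proof.
by rewrite strand_TE sin_angle// cos_angle// /n_dir expr0 mul1r.
Qed.

Lemma m_dir_lo : m_dir m tau true = - hoop_T (- b).
Proof.
rewrite hoop_TE vec3N angleN cosN sinN sin_angle// cos_angle// /m_dir.
by congr vec3; rewrite ?mulN1r ?oppr0 ?opprK// expr1 mulN1r.
Qed.

Lemma m_dir_hi : m_dir m tau false = hoop_T b.
Proof.
by rewrite hoop_TE sin_angle// cos_angle// /m_dir expr0 mul1r.
Qed.

(** Straight ends point away from all supporting lines of their arc. *)
Lemma turn_end t0 s t r : 0 < t0 <= 1 -> `|s| = t0 -> `|t| <= t0 -> 0 <= r * s ->
  r * sin (th t - th s) <= 0.
Proof.
move=> /andP[t00 t01] st tt rs.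
have sI : -1 <= s <= 1 by rewrite -ler_norml st.
have tI : -1 <= t <= 1 by rewrite -ler_norml (le_trans tt).
have /andP[s1 s2] := angle_half_bounds m sI; have /andP[u1 u2] := angle_half_bounds m tI.
have inH u : -1 <= u <= 1 -> u \in `[(- H), H].
  by move=> /andP[x1 x2]; rewrite in_itv/= (le_trans x2 oneH) andbT (le_trans _ x1)// lerN2.
move: tt; rewrite -st ler_norml => /andP[t1 t2].
have [s0|s0] := leP 0 s.
  have tls : th t <= th s.
    by apply: (angle_nd m1); rewrite ?inH//; rewrite ger0_norm in t2.
  have r0 : 0 <= r.
    by rewrite -(pmulr_lge0 _ (_ : 0 < s))// -(ger0_norm s0) st.
  apply: mulr_ge0_le0 => //; rewrite -[X in sin X]opprK sinN oppr_le0 sin_ge0_pi//.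
  by rewrite opprB subr_ge0 tls /=; have := s2; have := u1; lra.
have slt : th s <= th t.
  by apply: (angle_nd m1); rewrite ?inH//; rewrite ltr0_norm ?opprK// in t1.
have r0 : r <= 0 by rewrite -(nmulr_lge0 _ s0).
apply: mulr_le0_ge0 => //; apply: sin_ge0_pi.
by rewrite subr_ge0 slt /=; have := s1; have := u2; lra.
Qed.

Let N1 s : `|s| <= 1 -> -1 <= s <= 1. Proof. by rewrite ler_norml. Qed.

Lemma A_top : A_x k l m tau 0 = 0 /\ A_z k l m tau 0 = h.
Proof.
by rewrite /A_x /A_z normr0 A_right_clasp ?(ltW a0)//= clasp_X0 clasp_Z0 subr0 mulr0.
Qed.

Lemma A_clasp_dist s v : `|s| <= 1 -> `|v| <= b ->
  1 <= A_x k l m tau s ^+ 2 + clasp_X b a v ^+ 2 + (A_z k l m tau s - clasp_Z b a v) ^+ 2.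
Proof.
move=> s1 vb.
have XE : clasp_X b a v ^+ 2 = clasp_X b a `|v| ^+ 2.
  by case: (ger0P v) => // _; rewrite clasp_X_odd// sqrrN.
have ZE : clasp_Z b a v = clasp_Z b a `|v| by case: (ger0P v) => // _; rewrite clasp_ZN.
have vI : 0 <= `|v| <= b by rewrite normr_ge0.
rewrite XE ZE /A_x /A_z exprMn (_ : (if _ then _ else _) ^+ 2 = 1); last first.
  by case: ifP; rewrite ?sqrrN expr1n.
rewrite mul1r; have [sa|/ltW sa] := leP `|s| a.
  by rewrite A_right_clasp//= heightE; apply: clasp_arc_dist; rewrite ?normr_ge0.
by rewrite A_right_circle ?sa//=; apply: clasp_circle_dist; rewrite ?sa.
Qed.

Lemma A_circle s : a <= `|s| <= 1 ->
  A_x k l m tau s = sin (th s) /\ A_z k l m tau s = cos (th s).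
Proof.
move=> /andP[as_ s1]; rewrite sin_angle ?N1// cos_angle ?N1// /A_x /A_z.
rewrite A_right_circle ?as_//= real_normK ?num_real//; split => //.
by case: ifPn => s0; [rewrite mul1r ger0_norm|rewrite -ltNge in s0; rewrite ltr0_norm// mulrNN mul1r].
Qed.

Lemma hoop_support v v' : `|v| <= b -> `|v'| <= b ->
  clasp_X b a v' * sin (th v) - clasp_Z b a v' * cos (th v) <=
  clasp_X b a v * sin (th v) - clasp_Z b a v * cos (th v).
Proof.
move=> vb v'b; rewrite -!mulNr.
have bbH : b \in `[(- H), H] by rewrite in_itv/= bH andbT (le_trans _ (ltW b0))// oppr_le0 ltW.
have NbH : - b \in `[(- H), H] by rewrite in_itv/= lerN2 bH (le_trans _ (ltW H0))// oppr_le0 ltW.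
apply: (sweeps_support hoop_sweeps); rewrite -?ler_norml//.
  exact: (density_nd (weight_ge0 m) (density_angle_sub b0 bH)).
rewrite angleN opprK.
have /andP[_] : - (pi / 2) <= th b <= pi / 2.
  exact: angle_half_bounds.
by have := @pi_gt0 R; lra.
Qed.

Lemma hoop_Z_bounds v : `|v| <= b ->
  [/\ 0 <= clasp_Z b a v, clasp_Z b a v <= h &
      `|v| = b -> clasp_X b a v = v /\ h = clasp_Z b a v + Num.sqrt (1 - v ^+ 2)].
Proof.
move=> vb.
have ZE : clasp_Z b a v = clasp_Z b a `|v| by case: (ger0P v) => // _; rewrite clasp_ZN.
have hE : h = clasp_Z b a b + Num.sqrt (1 - b ^+ 2) by rewrite heightE -clasp_height_sym.
have z0 := clasp_Z_nd b0 b1 a0 a1 (lexx 0) (normr_ge0 v) vb.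
have zb := clasp_Z_nd b0 b1 a0 a1 (normr_ge0 v) vb (lexx b).
rewrite clasp_Z0 in z0; split.
- by rewrite ZE.
- rewrite ZE hE; apply: (le_trans zb); rewrite lerDl; exact: sqrtr_ge0.
- move=> vE; split.
    move: vE; case: (ger0P v) => v0 vE; first by rewrite vE clasp_X_end.
    by rewrite -[v]opprK clasp_X_odd// vE clasp_X_end.
  by rewrite ZE vE hE -(real_normK (num_real v)) vE.
Qed.

(** Moving outwards along the normals does not bring the two arcs closer: the
difference [p - q] of points on them has a nonnegative component along the
normal of the strand and a nonpositive one along that of the hoop. *)
Lemma strand_hoop_dist_arcs d e s v : 0 <= d -> 0 <= e -> `|s| <= 1 -> `|v| <= b ->
  1 <= dot (strand d s - hoop e v) (strand d s - hoop e v).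
Proof.
move=> d0 e0 s1 vb.
have base := A_clasp_dist s1 vb; have v1 := le_trans vb b1.
have sH : - H <= s <= H by rewrite -ler_norml (le_trans s1).
have cs : 0 <= cos (th s) by rewrite cos_angle ?N1// sqrtr_ge0.
have cv : 0 <= cos (th v) by rewrite cos_angle ?N1// sqrtr_ge0.
have Az := A_z_ge0 s1.
have [_ Zh _] := hoop_Z_bounds vb.
have supp : A_z k l m tau 0 * cos (th s) <=
    A_x k l m tau s * sin (th s) + A_z k l m tau s * cos (th s).
  have := A_support k l1 m1 tau0 taum taul (s := 0) (t := s).
  by rewrite (A_top).1 mul0r add0r; apply => //; rewrite oppr_le0 ltW.
have supp' : 0 <= clasp_X b a v * sin (th v) - clasp_Z b a v * cos (th v).
  have := hoop_support vb (v' := 0); rewrite clasp_X0 clasp_Z0 !mul0r subr0; apply.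
  by rewrite normr0 ltW.
rewrite (A_top).2 in supp.
rewrite strandE hoopE vec3B dot_vec33.
move: (A_x _ _ _ _ s) (A_z _ _ _ _ s) (clasp_X _ _ v) (clasp_Z _ _ v) base cs cv Az Zh supp supp'.
move: (height _ _ _ _) (sin (th s)) (cos (th s)) (sin (th v)) (cos (th v)).
move=> hh S C S' C' x z X Z base cs cv Az Zh supp supp'.
have f1 : 0 <= d * (x * S + (z - Z) * C).
  apply: mulr_ge0 => //; have : Z * C <= hh * C by rewrite ler_wpM2r.
  lra.
have f2 : 0 <= e * (X * S' + (z - Z) * C').
  apply: mulr_ge0 => //; have : 0 <= z * C' by rewrite mulr_ge0.
  lra.
have f3 := sqr_ge0 (d * S); have f4 := sqr_ge0 (e * S'); have f5 := sqr_ge0 (d * C + e * C').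
apply: (le_trans base).
have -> : (x + d * S - 0) * (x + d * S - 0) + (0 - (X + e * S')) * (0 - (X + e * S')) +
  (z + d * C - (Z - e * C')) * (z + d * C - (Z - e * C')) =
  x ^+ 2 + X ^+ 2 + (z - Z) ^+ 2 + (2 * (d * (x * S + (z - Z) * C)) +
   2 * (e * (X * S' + (z - Z) * C')) + (d * S) ^+ 2 + (e * S') ^+ 2 + (d * C + e * C') ^+ 2) by ring.
by rewrite lerDl !addr_ge0// mulr_ge0.
Qed.

Lemma dot_stretch (p T : V) r : dot T T = 1 -> 0 <= r * dot T p ->
  dot p p <= dot (p + r *: T) (p + r *: T).
Proof.
move=> TT h0; rewrite !dotDl !dotDr !dotZl !dotZr TT (dotC p T); have := sqr_ge0 r; nra.
Qed.

Lemma strand_N_dot s : dot (strand_N s) (strand_N s) = 1.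
Proof. exact: unit_N_dot frame_xx frame_uu frame_xu _. Qed.

Lemma hoop_N_dot v : dot (hoop_N v) (hoop_N v) = 1.
Proof. exact: unit_N_dot frame_yy frame_dd frame_yd _. Qed.

(** If the strand point is above the top of the closed curve, the normal at the
end of the hoop arc separates; otherwise the straight end of the hoop points away
from it. *)
Lemma strand_hoop_dist_strand d e s v r' : 0 <= d -> 0 <= e -> `|s| <= 1 -> `|v| <= b ->
  (r' = 0 \/ `|v| = b) -> 0 <= r' * v ->
  1 <= dot (strand d s - (hoop e v + r' *: hoop_T v)) (strand d s - (hoop e v + r' *: hoop_T v)).
Proof.
move=> d0 e0 s1 vb [->|vE] rv.
  by rewrite scale0r addr0; exact: strand_hoop_dist_arcs.
have v1 := le_trans vb b1; have [_ _ /(_ vE)[XE hE]] := hoop_Z_bounds vb.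
have cv : 0 <= Num.sqrt (1 - v ^+ 2) by exact: sqrtr_ge0.
have q1 : Num.sqrt (1 - v ^+ 2) ^+ 2 = 1 - v ^+ 2.
  by rewrite sqr_sqrtr// subr_ge0 -real_normK ?num_real// expr_le1.
pose z := A_z k l m tau s + d * cos (th s).
have [hz|zh] := leP h z.
  apply: (dot_ge1 (w := - hoop_N v)); first by rewrite dotNl dotNr opprK hoop_N_dot.
  rewrite strandE -/z hoopE hoop_NE hoop_TE sin_angle ?N1// cos_angle ?N1// XE.
  rewrite vec3Z vec3D vec3B vec3N dot_vec33; move: hE q1 hz cv.
  move: (clasp_Z _ _ _) (Num.sqrt _) z (height _ _ _ _) => Z C z' hh -> q1 hz cv.
  have f1 : 0 <= C * (z' - (Z + C)) by rewrite mulr_ge0// subr_ge0.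
  set x := A_x _ _ _ _ s + _; rewrite -/x.
  have -> : - 0 * (x - (0 + r' * 0)) + - v * (0 - (v + e * v + r' * C)) +
    - - C * (z' - (Z - e * C + r' * v)) =
    (C ^+ 2 + v ^+ 2) * (1 + e) + C * (z' - (Z + C)) by ring.
  by rewrite q1 subrK mul1r -addrA lerDl addr_ge0.
rewrite opprD addrA -scaleNr.
apply: (le_trans (strand_hoop_dist_arcs d0 e0 s1 vb)); apply: dot_stretch.
  exact: unit_T_dot frame_yy frame_dd frame_yd _.
rewrite strandE -/z hoopE hoop_TE sin_angle ?N1// cos_angle ?N1// XE vec3B dot_vec33.
move: hE zh; move: (clasp_Z _ _ _) (Num.sqrt _) z (height _ _ _ _) => Z C z' hh -> zh.
have -> : - r' * (0 * (A_x k l m tau s + d * sin (th s) - 0) + C * (0 - (v + e * v)) +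
  v * (z' - (Z - e * C))) = (r' * v) * (Z + C - z') by ring.
by rewrite mulr_ge0// subr_ge0 ltW.
Qed.

(** If the hoop point is below the tip of the first hoop, the normal at the end
of the strand separates; otherwise the straight end of the strand points away
from it. *)
Lemma strand_hoop_dist_upper d e s r v r' : 0 <= d -> 0 <= e -> `|s| <= 1 -> `|v| <= b ->
  (r = 0 \/ `|s| = c) -> 0 <= r * s -> (r' = 0 \/ `|v| = b) -> 0 <= r' * v ->
  1 <= dot (strand d s + r *: strand_T s - (hoop e v + r' *: hoop_T v))
           (strand d s + r *: strand_T s - (hoop e v + r' *: hoop_T v)).
Proof.
move=> d0 e0 s1 vb [->|sE] rs vr rv.
  by rewrite scale0r addr0; exact: strand_hoop_dist_strand.
have sI : a <= `|s| <= 1 by rewrite s1 sE ac.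
have [AxE AzE] := A_circle sI.
have cs : 0 <= cos (th s) by rewrite cos_angle ?N1// sqrtr_ge0.
have qE : exists y z, hoop e v + r' *: hoop_T v = vec3 0 y z.
  rewrite hoopE hoop_TE vec3Z vec3D mulr0 addr0; by do 2 eexists.
have := strand_hoop_dist_strand d0 e0 s1 vb vr rv.
have [y [z ->]] := qE => base.
have [z0|z0] := leP z 0.
  apply: (dot_ge1 (strand_N_dot s)).
  rewrite strandE strand_NE strand_TE AxE AzE vec3Z vec3D vec3B dot_vec33.
  have : 0 <= cos (th s) * - z by rewrite mulr_ge0// oppr_ge0.
  by have := cos2Dsin2 (th s); move: (sin _) (cos _) d0 => S C d0; nra.
rewrite addrAC; apply: (le_trans base); apply: dot_stretch.
  exact: unit_T_dot frame_xx frame_uu frame_xu _.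
rewrite strandE strand_TE AxE AzE vec3B dot_vec33.
have sS : sin (th s) = s by rewrite sin_angle ?N1.
have -> : r * (cos (th s) * (sin (th s) + d * sin (th s) - 0) + 0 * (0 - y) +
   - sin (th s) * (cos (th s) + d * cos (th s) - z)) = (r * sin (th s)) * z by ring.
by rewrite sS mulr_ge0// ltW.
Qed.

Lemma A_side s : 1 <= `|s| <= m%:R ->
  [/\ A_x k l m tau s = sin (th s), sin (th s) ^+ 2 = 1 & cos (th s) = 0].
Proof.
move=> sI; rewrite /A_x /angle; case: ifPn => s0.
  rewrite A_right_vertical//=; rewrite ger0_norm// in sI.
  by rewrite turn_mid// sin_pihalf cos_pihalf expr1n mulr1.
rewrite -ltNge in s0; rewrite A_right_vertical//=; rewrite ltr0_norm// in sI.
by rewrite turn_mid// sinN cosN sin_pihalf cos_pihalf sqrrN expr1n mulr1.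
Qed.

Lemma A_bottom s : m%:R <= `|s| <= H -> [/\ A_x k l m tau s = sin (th s),
  A_z k l m tau s = 1 - m%:R + cos (th s) & cos (th s) <= 0].
Proof.
move=> /andP[ms sH]; rewrite /A_x /A_z A_right_bottom//=.
have c0' : - sin (`|s| - m%:R) <= 0.
  rewrite oppr_le0 sin_ge0_pi// subr_ge0 ms/=; have := pi0; lra.
rewrite /angle; case: ifPn => s0; first rewrite ger0_norm// in ms c0' *.
  by rewrite turn_high// [pi / 2 + _]addrC sinDpihalf cosDpihalf mul1r.
rewrite -ltNge in s0; rewrite ltr0_norm// in ms c0' *.
by rewrite turn_high// sinN cosN [pi / 2 + _]addrC sinDpihalf cosDpihalf mulN1r.
Qed.

Lemma strand_hoop_dist d e s r v r' : 0 <= d -> 0 <= e <= m%:R - 1 -> `|s| <= H -> `|v| <= b ->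
  (r = 0 \/ `|s| = c) -> 0 <= r * s -> (r' = 0 \/ `|v| = b) -> 0 <= r' * v ->
  1 <= enorm (strand d s + r *: strand_T s - (hoop e v + r' *: hoop_T v)).
Proof.
move=> d0 /andP[e0 em] sH vb sr rs vr rv; apply: enorm_ge1.
have [s1|/ltW s1] := leP `|s| 1; first exact: strand_hoop_dist_upper.
have v1 := le_trans vb b1.
have [y [z [-> zm]]] : exists y z, hoop e v + r' *: hoop_T v = vec3 0 y z /\ 1 - m%:R <= z.
  rewrite hoopE hoop_TE vec3Z vec3D mulr0 addr0; do 2 eexists; split; first by [].
  rewrite sin_angle ?N1//; have [Z0 _ _] := hoop_Z_bounds vb.
  have : e * cos (th v) <= e by rewrite ler_piMr// cos_le1.
  lra.
have [sm|/ltW ms] := leP `|s| m%:R.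
  rewrite strandE strand_TE vec3Z vec3D vec3B dot_vec33.
  have [-> S1 C0] : [/\ A_x k l m tau s = sin (th s), sin (th s) ^+ 2 = 1 & cos (th s) = 0].
    by apply: A_side; rewrite s1.
  rewrite C0 mulr0 addr0 subr0 -!expr2.
  have -> : sin (th s) + d * sin (th s) = (1 + d) * sin (th s) by ring.
  rewrite exprMn S1 mulr1 -addrA ler_wpDr ?addr_ge0 ?sqr_ge0//.
  by rewrite -[leLHS](expr1n _ 2) ler_pXn2r ?nnegrE ?addr_ge0// lerDl.
have [AxE AzE C0] : [/\ A_x k l m tau s = sin (th s),
  A_z k l m tau s = 1 - m%:R + cos (th s) & cos (th s) <= 0] by apply: A_bottom; rewrite ms.
apply: (dot_ge1 (strand_N_dot s)).
rewrite strandE strand_NE strand_TE AxE AzE vec3Z vec3D vec3B dot_vec33.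
have : 0 <= - cos (th s) * (z - (1 - m%:R)) by rewrite mulr_ge0 ?oppr_ge0// subr_ge0.
by have := cos2Dsin2 (th s); move: (sin _) (cos _) d0 => S C d0'; nra.
Qed.

(** * Thickness and struts of the link *)

Variables q1 q2 : R.
Local Notation L := (clasp_hopf k l m tau q1 q2).
Local Notation component := (@clasp_hopf_component R k l m tau q1 q2).
Hypothesis inside : in_region L.

Let K0E s : A_curve k l m tau s = planar frame_x frame_up (A_x k l m tau s) (A_z k l m tau s).
Proof. exact: A_curveE. Qed.

Let closed_T : unit_T frame_x frame_up (th (- H)) = unit_T frame_x frame_up (th H).
Proof. by rewrite angleN angle_end// /unit_T cosN sinN sinpi opprK oppr0. Qed.

Let alphaE j s : - H <= s <= H -> alpha_curve k l m tau j s = strand j%:R s.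
Proof.
apply: (parallel_arcE frame_xx frame_uu frame_xu j%:R H0
  (strand_sweeps (lexx H)) (weight_ge0 m)
  (density_angle_sub H0 (lexx H)) A_normal_T) => //.
Qed.

Lemma alpha_points j s : `|s| <= H -> points (alpha_curve k l m tau j) (strand j%:R s).
Proof. by rewrite ler_norml => sH; exists s; [rewrite /= in_itv|rewrite alphaE]. Qed.

Lemma alpha_point_cases j p : points (alpha_curve k l m tau j) p ->
  exists2 s, `|s| <= H & p = strand j%:R s.
Proof.
move=> [s /=]; rewrite in_itv/= => sH <-; exists s; first by rewrite ler_norml.
by rewrite -alphaE.
Qed.

Lemma dLen_alpha j (xi : V -> V) :
  {within `[(- H), H], continuous (xi \o alpha_curve k l m tau j)} ->
  let g s := dot (xi (strand j%:R s)) (strand_N s) * w s in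
  sintegrable g (- H) H /\ dLen_curve xi (alpha_curve k l m tau j) = sint g (- H) H.
Proof.
move=> cxi; apply: (dLen_closed_parallel frame_xx frame_uu frame_xu H0 (ler0n R j)
  (strand_sweeps (lexx H)) (weight_ge0 m)
  (density_angle_sub H0 (lexx H)) A_normal_T) => //.
Qed.

Let betaE (j : nat) s : - c <= s <= c ->
  parallel (@A_normal R) (k + j)%:R (beta_tip_arc k l m tau) s = strand (k + j)%:R s.
Proof.
apply: (parallel_arcE frame_xx frame_uu frame_xu (k + j)%:R c0
  (strand_sweeps cH) (weight_ge0 m)
  (density_angle_sub c0 cH) A_normal_T) => //.
- exact: beta_lo.
- exact: beta_hi.
- by move=> t _; exact: K0E.
Qed.

Let gammaE (j : nat) s : - b <= s <= b ->
  parallel (@gamma_normal R) j%:R (gamma_tip_arc k l m tau) s = hoop j%:R s.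
Proof.
apply: (parallel_arcE frame_yy frame_dd frame_yd j%:R b0
  hoop_sweeps (weight_ge0 m)
  (density_angle_sub b0 bH) gamma_normal_T) => //.
by move=> t _; rewrite planar_down opprK.
Qed.

Lemma beta_points j s : `|s| <= c -> points (beta_curve k l m tau q1 j) (strand (k + j)%:R s).
Proof.
rewrite ler_norml; apply: (extend_points c0 q1 _ _ (betaE j)).
- exact: beta_lo.
- exact: beta_hi.
- exact: n_dir_lo.
- exact: n_dir_hi.
Qed.

Lemma gamma_points j s : `|s| <= b -> points (gamma_curve k l m tau q2 j) (hoop j%:R s).
Proof.
rewrite ler_norml; apply: (extend_points b0 q2 _ _ (gammaE j)) => //.
- exact: m_dir_lo.
- exact: m_dir_hi.
Qed.

Let cases_normal t0 s r : 0 < t0 -> - t0 <= s <= t0 ->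
  [\/ r = 0, s = t0 /\ 0 <= r | s = - t0 /\ r <= 0] ->
  [/\ `|s| <= t0, 0 <= r * s & r = 0 \/ `|s| = t0].
Proof.
move=> t00 sI [->|[-> r0]|[-> r0]]; rewrite ?normrN ?(gtr0_norm t00) ?lexx ?mulrN.
- by rewrite mul0r ler_norml; split => //; left.
- by rewrite mulr_ge0 ?(ltW t00)//; split => //; right.
- by rewrite oppr_ge0 mulr_le0_ge0 ?(ltW t00)//; split => //; right.
Qed.

Lemma beta_point_cases j p : points (beta_curve k l m tau q1 j) p ->
  exists s r, [/\ `|s| <= c, 0 <= r * s, r = 0 \/ `|s| = c &
    p = strand (k + j)%:R s + r *: strand_T s].
Proof.
move=> /(extend_point_cases c0 _ _ (betaE j)); case.
- exact: beta_lo.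
- exact: beta_hi.
- exact: n_dir_lo.
- exact: n_dir_hi.
- move=> s [r [sI pE hr]]; exists s, r; have [h1 h2 h3] := cases_normal c0 sI hr.
  by split.
Qed.

Lemma gamma_point_cases j p : points (gamma_curve k l m tau q2 j) p ->
  exists s r, [/\ `|s| <= b, 0 <= r * s, r = 0 \/ `|s| = b &
    p = hoop j%:R s + r *: hoop_T s].
Proof.
move=> /(extend_point_cases b0 _ _ (gammaE j)); case => //.
- exact: m_dir_lo.
- exact: m_dir_hi.
- move=> s [r [sI pE hr]]; exists s, r; have [h1 h2 h3] := cases_normal b0 sI hr.
  by split.
Qed.

Lemma dLen_beta (j : 'I_l) (xi : V -> V) : compatible L xi ->
  let g s := dot (xi (strand (k + j)%:R s)) (strand_N s) * w s in
  sintegrable g (- c) c /\ dLen_curve xi (beta_curve k l m tau q1 j) = sint g (- c) c.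
Proof.
move=> /(_ (inl (inr j))) [cxi /(_ isT)[flo fhi]].
apply: (dLen_extend frame_xx frame_uu frame_xu c0 (ler0n R (k + j))
  (strand_sweeps cH) (weight_ge0 m)
  (density_angle_sub c0 cH) _ _ (betaE j)) => //.
- exact: beta_lo.
- exact: beta_hi.
- exact: n_dir_lo.
- exact: n_dir_hi.
- move=> p pp; split; rewrite -subr_ge0.
    exact: (inside (i := inl (inr j)) (inl true) pp).
  exact: (inside (i := inl (inr j)) (inl false) pp).
Qed.

Lemma dLen_gamma (j : 'I_m) (xi : V -> V) : compatible L xi ->
  let g s := dot (xi (hoop j%:R s)) (hoop_N s) * w s in
  sintegrable g (- b) b /\ dLen_curve xi (gamma_curve k l m tau q2 j) = sint g (- b) b.
Proof.
move=> /(_ (inr j)) [cxi /(_ isT)[flo fhi]].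
apply: (dLen_extend frame_yy frame_dd frame_yd b0 (ler0n R j)
  hoop_sweeps (weight_ge0 m)
  (density_angle_sub b0 bH) _ _ (gammaE j)) => //.
- exact: m_dir_lo.
- exact: m_dir_hi.
- move=> p pp; split; rewrite -subr_ge0.
    exact: (inside (i := inr j) (inr true) pp).
  exact: (inside (i := inr j) (inr false) pp).
Qed.

Definition level (i : 'I_k + 'I_l) : nat :=
  match i with inl j => j | inr j => k + j end.

Lemma level_inj : injective level.
Proof.
move=> [i|i] [j|j] /= E.
- by congr inl; apply/val_inj.
- by have := ltn_ord i; rewrite E ltnNge leq_addr.
- by have := ltn_ord j; rewrite -E ltnNge leq_addr.
- by congr inr; apply/val_inj/(@addnI k).
Qed.

Lemma strand_point_cases (i : 'I_k + 'I_l) p : points (component (inl i)) p ->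
  exists s r, [/\ `|s| <= H, (k <= level i)%N -> `|s| <= c,
    0 <= r * s, r = 0 \/ (k <= level i)%N /\ `|s| = c &
    p = strand (level i)%:R s + r *: strand_T s].
Proof.
case: i => j /=.
  move=> /alpha_point_cases[s sH ->]; exists s, 0; rewrite mul0r scale0r addr0.
  by split => //; [rewrite leqNgt ltn_ord|left].
move=> /beta_point_cases[s [r [sc rs hr ->]]]; exists s, r; split => //.
  exact: (le_trans sc).
by case: hr => [|sE]; [left|right; rewrite leq_addr].
Qed.

Lemma strand_strand_dist (i j : 'I_k + 'I_l) p q : (level i < level j)%N ->
  points (component (inl i)) p -> points (component (inl j)) q -> 1 <= enorm (q - p).
Proof.
move=> ij /strand_point_cases[s [r [sH _ rs hr ->]]] /strand_point_cases[t [r' [tH tc _ _ ->]]].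
apply: (parallel_dist frame_xx frame_uu frame_xu).
- exact: ler0n.
- by rewrite natr1 ler_nat.
- by apply: A_support; rewrite // -ler_norml.
- case: hr => [->|[ki sE]]; first by rewrite mul0r.
  apply: (turn_end (t0 := c)) => //; first by rewrite c0.
  by apply: tc; rewrite (leq_trans ki)// ltnW.
Qed.

Lemma hoop_hoop_dist (i j : 'I_m) p q : (i < j)%N ->
  points (component (inr i)) p -> points (component (inr j)) q -> 1 <= enorm (q - p).
Proof.
move=> ij /gamma_point_cases[s [r [sb rs hr ->]]] /gamma_point_cases[t [r' [tb _ _ ->]]].
apply: (parallel_dist frame_yy frame_dd frame_yd).
- exact: ler0n.
- by rewrite natr1 ler_nat.
- by rewrite !mulNr; apply: hoop_support.
- case: hr => [->|sE]; first by rewrite mul0r.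
  by apply: (turn_end (t0 := b)) => //; rewrite b0.
Qed.

Lemma strand_hoop_dist_points (i : 'I_k + 'I_l) (j : 'I_m) p q :
  points (component (inl i)) p -> points (component (inr j)) q -> 1 <= enorm (p - q).
Proof.
move=> /strand_point_cases[s [r [sH _ rs hr ->]]] /gamma_point_cases[t [r' [tb rt ht ->]]].
apply: strand_hoop_dist => //.
- by rewrite ler0n /= lerBrDr natr1 ler_nat.
- by case: hr => [|[_]]; [left|right].
Qed.

Lemma link_dist (i j : 'I_k + 'I_l + 'I_m) p q : i != j ->
  points (component i) p -> points (component j) q -> 1 <= enorm (p - q).
Proof.
have sym p' q' : enorm (p' - q') = enorm (q' - p') by rewrite -enormN opprB.
case: i j => [i|i] [j|j] ij pi_ pj.
- have : level i != level j by apply: contra ij => /eqP/level_inj ->.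
  rewrite neq_ltn => /orP[h'|h']; first by rewrite sym; exact: strand_strand_dist pi_ pj.
  exact: strand_strand_dist pj pi_.
- exact: strand_hoop_dist_points pi_ pj.
- by rewrite sym; exact: strand_hoop_dist_points pj pi_.
- have : i != j :> nat by apply: contra ij => /eqP/val_inj ->.
  rewrite neq_ltn => /orP[h'|h']; first by rewrite sym; exact: hoop_hoop_dist pi_ pj.
  exact: hoop_hoop_dist pj pi_.
Qed.

(** Where the strand at distance [d] carries curvature: the innermost [k]
strands are whole closed curves. *)
Definition on_strand (d : nat) s : Prop := `|s| <= c \/ (d < k)%N /\ `|s| <= H.

Lemma on_strandW (d e : nat) s : (e <= d)%N -> on_strand d s -> on_strand e s.
Proof. by move=> ed [|[dk sH]]; [left|right; rewrite (leq_ltn_trans ed)]. Qed.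

Lemma strand_points (d : nat) s : (d < k + l)%N -> on_strand d s ->
  exists2 i : 'I_k + 'I_l, level i = d & points (component (inl i)) (strand d%:R s).
Proof.
move=> dkl hs; have [dk|kd] := ltnP d k.
  exists (inl (Ordinal dk)) => //=; apply: alpha_points.
  by case: hs => [sc|[_]//]; exact: le_trans cH.
have dl : (d - k < l)%N by rewrite ltn_subLR.
exists (inr (Ordinal dl)) => /=; first by rewrite subnKC.
rewrite -[d in strand d%:R](subnKC kd); apply: beta_points.
by case: hs => // -[]; rewrite ltnNge kd.
Qed.

Lemma hoop_points (e : nat) v : (e < m)%N -> `|v| <= b ->
  exists2 i : 'I_m, i = e :> nat & points (component (inr i)) (hoop e%:R v).
Proof. by move=> em vb; exists (Ordinal em) => //=; exact: gamma_points. Qed.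

(** The top of the innermost strand touches the unit sphere about the end of
the tip arc of the innermost hoop. *)
Lemma GThi_link : GThi L = 1%:E.
Proof.
apply/eqP; rewrite eq_le; apply/andP; split; last first.
  apply/ereal_infP => _ [i [j [x [y [ij xi yj ->]]]]]; rewrite lee_fin.
  exact: link_dist ij xi yj.
apply: ereal_inf_lbound.
have s0 : on_strand 0 0 by left; rewrite normr0 ltW.
have vb : `|b| <= b by rewrite ger0_norm// ltW.
have n0 : (0 < k + l)%N by rewrite addn_gt0 l1 orbT.
have [i _ pi_] := strand_points n0 s0; have [j _ pj] := hoop_points m1 vb.
exists (inl i), (inr j), (strand 0%:R 0), (hoop 0%:R b); split => //.
congr EFin; apply/esym/enorm_eq1.
have [_ _ /(_ (gtr0_norm b0))[XE hE]] := hoop_Z_bounds vb.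
have [AxE AzE] := A_top.
rewrite strandE hoopE angle0 sin0 cos0 XE AxE AzE hE !mul0r !addr0 subr0 vec3B dot_vec33.
have : Num.sqrt (1 - b ^+ 2) ^+ 2 = 1 - b ^+ 2.
  by rewrite sqr_sqrtr// subr_ge0 expr_le1// ltW.
by move: (clasp_Z _ _ _) (Num.sqrt _) => Z C CE; ring: CE.
Qed.

Lemma unit_strut (i j : 'I_k + 'I_l + 'I_m) p q : i != j -> points (component i) p ->
  points (component j) q -> dot (p - q) (p - q) = 1 -> gehring_strut L p q.
Proof.
by move=> ij pi_ pj pq; exists i, j; split => //; rewrite GThi_link enorm_eq1.
Qed.

Section Struts.
(** The contrary of criticality: no strut is shortened at a rate above [eps]. *)
Variables (xi : V -> V) (eps : R).
Hypothesis eps0 : 0 <= eps.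
Hypothesis taut : forall x y, gehring_strut L x y ->
  - eps <= dot (xi x - xi y) (direction (x - y)).

Lemma strut_bound (i j : 'I_k + 'I_l + 'I_m) p q : i != j -> points (component i) p ->
  points (component j) q -> dot (p - q) (p - q) = 1 -> - eps <= dot (xi p - xi q) (p - q).
Proof.
move=> ij pi_ pj pq; rewrite -[X in dot _ X](direction_unit pq).
exact: taut (unit_strut ij pi_ pj pq).
Qed.

(** Outward components of the field on a strand, and below on a hoop. *)
Definition push (d : nat) s : R := dot (xi (strand d%:R s)) (strand_N s).
Definition hoop_push (e : nat) v : R := dot (xi (hoop e%:R v)) (hoop_N v).

(** Struts between consecutive parallels transmit the outward component. *)
Lemma push_ge (d : nat) s : (d < k + l)%N -> on_strand d s -> push 0 s - d%:R * eps <= push d s.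
Proof.
elim: d => [|d IH] dkl hs; first by rewrite mul0r subr0.
have hs' := on_strandW (leqnSn d) hs; have dkl' := ltnW dkl.
have {}IH := IH dkl' hs'; have [i iE pi_] := strand_points dkl hs.
have [j jE pj] := strand_points dkl' hs'.
have ij : (inl i : 'I_k + 'I_l + 'I_m) != inl j.
  by apply/eqP => -[E]; move: iE; rewrite E jE => /eqP; rewrite ltn_eqF.
have NE : strand d.+1%:R s - strand d%:R s = strand_N s.
  by rewrite -[d.+1]addn1 natrD strandD scale1r addrAC subrr add0r.
have := strut_bound ij pi_ pj; rewrite NE strand_N_dot dotBl => /(_ erefl).
have dE : d.+1%:R * eps = d%:R * eps + eps by rewrite -natr1 mulrDl mul1r.
by move: IH; rewrite dE /push; lra.
Qed.

Lemma hoop_push_ge (e : nat) v : (e < m)%N -> `|v| <= b -> hoop_push 0 v - e%:R * eps <= hoop_push e v.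
Proof.
elim: e => [|e IH] em vb; first by rewrite mul0r subr0.
have em' := ltnW em; have {}IH := IH em' vb; have [i iE pi_] := hoop_points em vb.
have [j jE pj] := hoop_points em' vb.
have ij : (inr i : 'I_k + 'I_l + 'I_m) != inr j.
  by apply/eqP => -[E]; move: iE; rewrite E jE => /eqP; rewrite ltn_eqF.
have NE : hoop e.+1%:R v - hoop e%:R v = hoop_N v.
  by rewrite -[e.+1]addn1 natrD hoopD scale1r addrAC subrr add0r.
have := strut_bound ij pi_ pj; rewrite NE hoop_N_dot dotBl => /(_ erefl).
have dE : e.+1%:R * eps = e%:R * eps + eps by rewrite -natr1 mulrDl mul1r.
by move: IH; rewrite dE /hoop_push; lra.
Qed.

Let n0 : (0 < k + l)%N. Proof. by rewrite addn_gt0 l1 orbT. Qed.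

Let b_norm0 : `|0 : R| <= b. Proof. by rewrite normr0 ltW. Qed.

Let touch (e : nat) s : (e < m)%N -> on_strand 0 s -> strand 0 s - hoop e%:R 0 = strand_N s ->
  dot (xi (hoop e%:R 0)) (strand_N s) - eps <= push 0 s.
Proof.
move=> em hs NE; have [i _ pi_] := strand_points n0 hs; have [j _ pj] := hoop_points em b_norm0.
have := @strut_bound (inl i) (inr j) _ _ isT pi_ pj.
by rewrite NE strand_N_dot dotBl => /(_ erefl); rewrite /push; lra.
Qed.

Lemma hoop_tip e : hoop e 0 = vec3 0 0 (- e).
Proof. by rewrite hoopE clasp_X0 clasp_Z0 angle0 sin0 cos0; congr vec3; ring. Qed.

(** Struts from the arcs of the unit circle to the tip of the first hoop. *)
Lemma push_circle s : on_strand 0 s -> a <= `|s| <= 1 ->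
  dot (xi (hoop 0 0)) (strand_N s) - eps <= push 0 s.
Proof.
move=> hs sI; apply: (@touch 0) => //; have [AxE AzE] := A_circle sI.
by rewrite hoop_tip strandE AxE AzE strand_NE vec3B; congr vec3; ring.
Qed.

(** Struts from the lower semicircle to the tip of the last hoop. *)
Lemma push_bottom s : (0 < k)%N -> m%:R <= `|s| <= H ->
  dot (xi (hoop m.-1%:R 0)) (strand_N s) - eps <= push 0 s.
Proof.
move=> k0 sI; apply: touch; first by rewrite prednK.
  by right; case/andP: sI.
have [AxE AzE _] := A_bottom sI.
have mE : m%:R = m.-1%:R + 1 :> R by rewrite natr1 prednK.
by rewrite hoop_tip strandE AxE AzE strand_NE vec3B mE; congr vec3; ring.
Qed.

Lemma tips_bound : - (m.-1%:R * eps) <=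
  dot (xi (hoop 0 0)) frame_up - dot (xi (hoop m.-1%:R 0)) frame_up.
Proof.
have := hoop_push_ge (e := m.-1) (v := 0); rewrite prednK// => /(_ (leqnn m) b_norm0).
have NE : hoop_N 0 = - frame_up.
  by rewrite hoop_NE angle0 sin0 cos0 vec3N; congr vec3; ring.
by rewrite /hoop_push NE !dotNr; lra.
Qed.

Local Notation vc := (conj_param a b).

(** The four struts joining the points at height parameters [u] and [v] balance
horizontally: their sum is a combination of the normal components. *)
Lemma clasp_push u : 0 < u < a ->
  - (2 * eps) * (arc_weight u + arc_weight (vc u)) <=
  (push 0 u + push 0 (- u)) * arc_weight u +
  (hoop_push 0 (vc u) + hoop_push 0 (- vc u)) * arc_weight (vc u).
Proof.
move=> uI; have [u0 ua] := andP uI; have uI' : 0 <= u <= a by rewrite !ltW.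
have quarter (x y z : R) : - x - x + (- x - x) <= 2 * y * z -> - (2 * x) <= z * y.
  by lra.
have /andP[v0 vb] := conj_bounds_oo a0 b0 uI.
have g0 := clasp_gap_gt0 a0 a1 b0 b1 uI; have ginv := clasp_gap_inv a0 a1 b0 b1 uI.
set v := vc u in v0 vb ginv *; set g := clasp_gap a b u in g0 ginv.
set C := Num.sqrt (1 - u ^+ 2); set C' := Num.sqrt (1 - v ^+ 2).
have C0 : 0 < C by rewrite sqrtr_gt0; exact: sqr_lt1 a1 _ uI.
have C'0 : 0 < C' by rewrite sqrtr_gt0 (sqr_lt1 b1)// v0.
have XE : clasp_X a b u = u * (g / C).
  by rewrite mulrA -(clasp_X_gap a0 a1 b0 b1 uI') mulfK// gt_eqF.
have YE : clasp_X b a v = v * (g / C').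
  by rewrite mulrA -(clasp_X_conj_gap a0 a1 b0 b1 uI') mulfK// gt_eqF.
have unit_strut_uv := clasp_strut_unit a0 a1 b0 b1 uI'; rewrite -/v -/g XE YE in unit_strut_uv.
have gE : h - clasp_Z a b u - clasp_Z b a v = g.
  rewrite heightE -(clasp_height_split a0 a1 b0 b1 uI') -/v -/g.
  by move: (clasp_Z _ _ _) (clasp_Z _ _ _) => p q; ring.
have N_u : `|u| = u by rewrite gtr0_norm.
have N_v : `|v| = v by rewrite gtr0_norm.
have SE s : `|s| = u -> strand 0 s = vec3 (s * (g / C)) 0 (h - clasp_Z a b u).
  have Ax : A_x k l m tau u = u * (g / C).
    by rewrite -XE /A_x (ltW u0) mul1r N_u A_right_clasp ?ltW.
  have Az : A_z k l m tau u = h - clasp_Z a b u by rewrite /A_z N_u A_right_clasp ?ltW.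
  rewrite strandE !mul0r !addr0; case: (ger0P s) => _ sE; first by rewrite sE Ax Az.
  by rewrite -[s]opprK sE A_xN// A_zN Ax Az mulNr.
have TE w' : `|w'| = v -> hoop 0 w' = vec3 0 (w' * (g / C')) (clasp_Z b a v).
  rewrite hoopE !mul0r addr0 subr0; case: (ger0P w') => _ wE; first by rewrite wE YE.
  by rewrite -[w']opprK wE clasp_X_odd// clasp_ZN YE mulNr.
have four s w' : `|s| = u -> `|w'| = v -> - eps <= dot (xi (strand 0 s) - xi (hoop 0 w'))
    (vec3 (s * (g / C)) (- (w' * (g / C'))) g).
  move=> su wv.
  have sc : on_strand 0 s by left; rewrite su (le_trans (ltW ua)).
  have wb : `|w'| <= b by rewrite wv ltW.
  have [i _ pi_] := strand_points n0 sc; have [j _ pj] := hoop_points m1 wb.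
  have E : strand 0 s - hoop 0 w' = vec3 (s * (g / C)) (- (w' * (g / C'))) g.
    by rewrite (SE _ su) (TE _ wv) vec3B sub0r subr0 gE.
  have := @strut_bound (inl i) (inr j) _ _ isT pi_ pj; rewrite E => h'; apply: h'.
  rewrite dot_vec33 mulrNN -!expr2 -unit_strut_uv !exprMn.
  by rewrite -(real_normK (num_real s)) -(real_normK (num_real w')) su wv.
have f1 := four u v N_u N_v; have f2 := four u (- v) N_u (etrans (normrN _) N_v).
have f3 := four (- u) v (etrans (normrN _) N_u) N_v.
have f4 := four (- u) (- v) (etrans (normrN _) N_u) (etrans (normrN _) N_v).
have uN : -1 <= u <= 1 by rewrite (le_trans (lerN10 _) (ltW u0)) (le_trans (ltW ua)).
have vN : -1 <= v <= 1 by rewrite (le_trans (lerN10 _) (ltW v0)) (le_trans (ltW vb)).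
rewrite /push /hoop_push !strand_NE !hoop_NE !angleN !sinN !cosN !sin_angle// !cos_angle//.
move: f1 f2 f3 f4 ginv; rewrite mulr0n /arc_weight -/C -/C'; clearbody C C'.
move: (xi (strand 0 u)) (xi (strand 0 (- u))) (xi (hoop 0 v)) (xi (hoop 0 (- v))).
move=> p1 p2 r1 r2; rewrite !dotBl !dot_vec3.
move=> f1 f2 f3 f4 ginv.
set W := (X in _ <= X).
have := lerD (lerD f1 f2) (lerD f3 f4); set S := (X in _ <= X -> _).
have -> : S = 2 * g * W by rewrite /S /W; field; rewrite !gt_eqF.
move=> sum; have {}sum : - (2 * eps) * g^-1 <= W.
  by rewrite ler_pdivrMr//; exact: quarter sum.
apply: le_trans sum; rewrite !mulNr lerN2 ler_wpM2l// mulr_ge0//.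
Qed.

(** * The balance of forces *)

Hypothesis compat : compatible L xi.

Local Notation force d := (fun s => push d s * w s).
Local Notation hoop_force e := (fun v => hoop_push e v * w v).
Local Notation n := ((k + l)%:R : R).

Let alpha_force j : (j < k)%N -> sintegrable (force j) (- H) H /\
  dLen_curve xi (alpha_curve k l m tau j) = sint (force j) (- H) H.
Proof.
move=> jk; apply: dLen_alpha => //.
by have [] := compat (inl (inl (Ordinal jk))).
Qed.

Let beta_force j : (j < l)%N -> sintegrable (force (k + j)) (- c) c /\
  dLen_curve xi (beta_curve k l m tau q1 j) = sint (force (k + j)) (- c) c.
Proof. by move=> jl; exact: (dLen_beta (Ordinal jl) compat). Qed.

Let gamma_force (e : nat) : (e < m)%N -> sintegrable (hoop_force e) (- b) b /\
  dLen_curve xi (gamma_curve k l m tau q2 e) = sint (hoop_force e) (- b) b.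
Proof. by move=> em; exact: (dLen_gamma (Ordinal em) compat). Qed.

Let force_integrable (d : nat) : (d < k + l)%N -> sintegrable (force d) (- c) c.
Proof.
move=> dkl; have [dk|kd] := ltnP d k.
  have [fi _] := alpha_force dk.
  by apply: (sintegrable_sub _ cH fi); rewrite lerN2.
have dl : (d - k < l)%N by rewrite ltn_subLR.
by have [] := beta_force dl; rewrite subnKC.
Qed.

Let dth (x y : R) : - H <= x -> y <= H -> density w th x y.
Proof. by move=> xH yH; exact: (density_sub xH yH (density_angle R m1)). Qed.

Let w0 s : 0 <= w s. Proof. exact: weight_ge0. Qed.

Let dth_bounds (x y : R) : - H <= x -> x <= y -> y <= H -> 0 <= th y - th x.
Proof.
move=> xH xy yH; rewrite subr_ge0; apply: (angle_nd m1) => //; rewrite in_itv/=.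
  by rewrite xH (le_trans xy).
by rewrite yH (le_trans xH).
Qed.

Let total_turn : th H - th (- H) = 2 * pi.
Proof. by rewrite angleN angle_end// opprK; ring. Qed.

Let deg (d : nat) : (d < k + l)%N -> d%:R * eps + eps <= n * eps.
Proof. move=> dn; have -> : d%:R * eps + eps = d.+1%:R * eps by rewrite -natr1 mulrDl mul1r.
by rewrite ler_wpM2r// ler_nat. Qed.

Let deg' (d : nat) : (d < k + l)%N -> d%:R * eps <= n * eps.
Proof. by move=> dn; apply: le_trans (deg dn); rewrite lerDl. Qed.

Let tip_force (d : nat) : (d < k + l)%N ->
  sint (force 0) (- a) a - n * eps * (th a - th (- a)) <= sint (force d) (- a) a.
Proof.
move=> dn; have aa : - a <= a by rewrite ge0_cp// ltW.
have sub (e : nat) : (e < k + l)%N -> sintegrable (force e) (- a) a.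
  by move=> en; apply: (sintegrable_sub _ ac (force_integrable en)); rewrite lerN2.
apply: sint_weight_ge => //; [|exact: sub|exact: sub|].
  by apply: dth; rewrite ?lerN2 (le_trans ac).
move=> s sI; have on : on_strand d s.
  by left; apply: (le_trans _ ac); rewrite ltW// ltr_norml.
apply: le_trans (push_ge dn on).
by rewrite lerB// deg'.
Qed.

Let bottom_force (d : nat) (x y : R) : (d < k)%N -> - H <= x -> x <= y -> y <= H ->
  sintegrable (force d) x y -> (forall s, x < s < y -> m%:R <= `|s| <= H) ->
  dot (xi (hoop m.-1%:R 0)) (strand_T x) - dot (xi (hoop m.-1%:R 0)) (strand_T y)
    - n * eps * (th y - th x) <= sint (force d) x y.
Proof.
move=> dk xH xy yH fi on; apply: sint_turning_ge => //; first exact: dth.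
have dn : (d < k + l)%N by rewrite (leq_trans dk) ?leq_addr.
move=> s /on sI; have od : on_strand d s by right; case/andP: sI.
have h1 := push_ge dn od.
have h2 := push_bottom (leq_ltn_trans (leq0n d) dk) sI.
by have := deg dn; rewrite -/(strand_N s); lra.
Qed.

Let side_force (d : nat) (x y : R) : sintegrable (force d) x y ->
  (forall s, x < s < y -> 1 < `|s| < m%:R) -> sint (force d) x y = 0.
Proof.
move=> fi on; have E s : x < s < y -> force d s = 0.
  move=> /on /andP[s1 sm]; rewrite /weight /turn_weight leNgt s1 /= ltW// mulr0//.
by rewrite (eq_sint (g := fun=> 0) E fi) /sint Rintegral_cst// mul0r.
Qed.

Let up p := dot p frame_up.

Let T_diff p s : dot p (strand_T s) - dot p (strand_T (- s)) = - (2 * sin (th s)) * up p.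
Proof.
by rewrite -dotBr !strand_TE angleN cosN sinN vec3B /up /frame_up !dot_vec3; ring.
Qed.

Let T_end p : dot p (strand_T H) = dot p (strand_T (- H)).
Proof. by rewrite !strand_TE angleN angle_end// cosN sinN sinpi !oppr0. Qed.

Let up1 := up (xi (hoop 0 0)).
Let upm := up (xi (hoop m.-1%:R 0)).

Let abs_right (x y s : R) : 0 <= x -> x < s < y -> x <= `|s| <= y.
Proof. by move=> x0 /andP[xs sy]; rewrite ger0_norm ?(le_trans x0)// !ltW. Qed.

Let abs_left (x y s : R) : 0 <= x -> - y < s < - x -> x <= `|s| <= y.
Proof.
by move=> x0 /andP[ys sx]; rewrite -normrN (@abs_right x y)// ltrNr sx ltrNl.
Qed.

(** On circular arcs the field is compared with its constant value at the
center, and the curvature integral becomes a difference of tangents. Adding the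
symmetric parts leaves the vertical component. *)
Let upper_force (d : nat) r : (d < k + l)%N -> a <= r -> r <= 1 ->
  (forall s, `|s| <= r -> on_strand d s) -> sintegrable (force d) (- r) r ->
  sint (force 0) (- a) a + (2 * r - 2 * a) * up1 - n * eps * (th r - th (- r)) <=
  sint (force d) (- r) r.
Proof.
move=> dn ar r1 on fi; have aa : - a <= a by rewrite ge0_cp// ltW.
have rH : r <= H by exact: (le_trans r1).
have NrH : - H <= - r by rewrite lerN2.
have Nra : - r <= - a by rewrite lerN2.
have Nar : - a <= r by exact: (le_trans aa).
have arc x y : - r <= x -> x <= y -> y <= r -> (forall s, x < s < y -> a <= `|s| <= r) ->
    dot (xi (hoop 0 0)) (strand_T x) - dot (xi (hoop 0 0)) (strand_T y)
      - n * eps * (th y - th x) <= sint (force d) x y.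
  move=> rx xy yr sI; apply: sint_turning_ge => //.
  - by apply: dth; [exact: le_trans rx|exact: le_trans rH].
  - exact: (sintegrable_sub rx yr fi).
  - move=> s /sI /andP[as_ sr]; have sI' : a <= `|s| <= 1 by rewrite as_ (le_trans sr).
    have h1 := push_ge dn (on _ sr).
    have h2 := push_circle (on_strandW (leq0n d) (on _ sr)) sI'.
    by have := deg dn; rewrite -/(strand_N s); lra.
have fi2 := sintegrable_sub Nra (lexx r) fi.
rewrite (sint_cat Nra Nar fi) (sint_cat aa ar fi2).
have rI : -1 <= r <= 1 by rewrite r1 (le_trans (lerN10 _))// (le_trans (ltW a0)).
have g1 := T_diff (xi (hoop 0 0)) a; have g2 := T_diff (xi (hoop 0 0)) r.
rewrite -/up1 sin_angle// in g1; rewrite -/up1 sin_angle// in g2.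
have f2 := arc a r (le_trans Nra aa) ar (lexx r) (fun s => abs_right (ltW a0)).
have f3 := arc (- r) (- a) (lexx _) Nra Nar (fun s => abs_left (ltW a0)).
exact: (upper_arith (tip_force dn) f2 f3 g1 g2).
Qed.

Let alpha_bound j : (j < k)%N ->
  sint (force 0) (- a) a + (2 * 1 - 2 * a) * up1 - 2 * upm - n * eps * (2 * pi) <=
  dLen_curve xi (alpha_curve k l m tau j).
Proof.
move=> jk; have [fi ->] := alpha_force jk.
have jn : (j < k + l)%N by rewrite (leq_trans jk) ?leq_addr.
have NmH : - H <= - m%:R by rewrite lerN2.
have N1m : - m%:R <= -1 :> R by rewrite lerN2.
have N11 : -1 <= 1 :> R by rewrite ge0_cp.
have p2 : -1 <= H by exact: (le_trans N11).
have p3 : - m%:R <= H by exact: (le_trans N1m).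
have n1 : - H <= -1 by rewrite lerN2.
have n4 : - H <= 1 by exact: (le_trans n1).
have n5 : - H <= m%:R by exact: (le_trans n4).
have sub x y : - H <= x -> y <= H -> sintegrable (force j) x y.
  by move=> hx hy; exact: (sintegrable_sub hx hy fi).
rewrite (sint_cat NmH p3 fi) (sint_cat N1m p2 (sub _ _ NmH (lexx _))).
rewrite (sint_cat N11 oneH (sub _ _ n1 (lexx _))) (sint_cat M1 MH (sub _ _ n4 (lexx _))).
rewrite (@side_force j (- m%:R) (-1)); first last.
- by move=> s /andP[s1 s2]; rewrite ltr0_norm ?(lt_trans s2)//; rewrite ltrNr s2 ltrNl.
- by apply: sub.
rewrite (@side_force j 1 m%:R); first last.
- by move=> s /andP[s1 s2]; rewrite gtr0_norm ?s1// (lt_trans _ s1).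
- by apply: sub.
have on s : `|s| <= 1 -> on_strand j s by move=> s1; right; rewrite (le_trans s1).
have f1 := @bottom_force j (- H) (- m%:R) jk (lexx _) NmH p3 (sub _ _ (lexx _) p3)
  (fun s => abs_left (ler0n R m)).
have f3 := upper_force jn a1 (lexx 1) on (sub _ _ n1 oneH).
have f5 := @bottom_force j m%:R H jk n5 MH (lexx _) (sub _ _ n5 (lexx _))
  (fun s => abs_right (ler0n R m)).
have g3 := T_diff (xi (hoop m.-1%:R 0)) m%:R; have g4 := T_end (xi (hoop m.-1%:R 0)).
have thm : th m%:R = pi / 2 by rewrite /angle ler0n turn_mid ?lexx ?andbT.
have th1 : th 1 = pi / 2 by rewrite /angle ler01 turn_mid ?lexx.
rewrite thm sin_pihalf -/upm in g3; rewrite !angleN th1 in f3.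
rewrite !angleN thm angle_end// in f1; rewrite thm angle_end// in f5.
exact: (alpha_arith f1 f3 f5 g3 g4).
Qed.

Let beta_bound j : (j < l)%N ->
  sint (force 0) (- a) a + (2 * c - 2 * a) * up1 - n * eps * (2 * pi) <=
  dLen_curve xi (beta_curve k l m tau q1 j).
Proof.
move=> jl; have [fi ->] := beta_force jl.
have jn : (k + j < k + l)%N by rewrite ltn_add2l.
apply: le_trans (upper_force jn ac c1 (fun s sc => or_introl sc) fi).
rewrite lerB// ler_wpM2l ?mulr_ge0// -total_turn lerB// -subr_ge0 dth_bounds//.
- by rewrite (le_trans _ (ltW c0))// oppr_le0 ltW.
- by rewrite lerN2.
- by rewrite (le_trans _ cH)// ge0_cp// ltW.
Qed.

Let gamma_bound (e : nat) : (e < m)%N ->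
  sint (hoop_force 0) (- b) b - m%:R * eps * (2 * pi) <= dLen_curve xi (gamma_curve k l m tau q2 e).
Proof.
move=> em; have [fi ->] := gamma_force em; have [fi0 _] := gamma_force m1.
have bb : - b <= b by rewrite ge0_cp// ltW.
have bHN : - H <= - b by rewrite lerN2.
have e0 : 0 <= m%:R * eps by rewrite mulr_ge0.
have t2 : th b <= th H by rewrite -subr_ge0 dth_bounds// (le_trans bHN).
have t3 : th (- H) <= th (- b) by rewrite -subr_ge0 dth_bounds// (le_trans bb).
have t4 : m%:R * eps * (th b - th (- b)) <= m%:R * eps * (2 * pi).
  by rewrite ler_wpM2l// -total_turn lerB.
apply: (@le_trans _ _ (sint (hoop_force 0) (- b) b - m%:R * eps * (th b - th (- b)))).
  by rewrite lerB.
apply: sint_weight_ge => //; first exact: dth.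
move=> v vI; have vb : `|v| <= b by rewrite ltW// ltr_norml.
apply: le_trans (hoop_push_ge em vb).
by rewrite lerB// ler_wpM2r// ler_nat ltnW.
Qed.

Let conj_sint f : sintegrable f 0 b ->
  sintegrable (fun u => f (conj_param a b u)) 0 a /\
  m%:R * sint f 0 b = n * sint (fun u => f (conj_param a b u)) 0 a.
Proof.
move=> fi; have [gi gE] := sint_conj a0 b0 fi; split => //.
have mb : m%:R * b = tau by rewrite mulrC divfK// gt_eqF ?m_gt0.
have na : n * a = tau by rewrite mulrC divfK// gt_eqF ?n_gt0.
apply: (mulfI (lt0r_neq0 b0)); rewrite mulrA [b * _]mulrC mb mulrCA -gE mulrA na.
by [].
Qed.

(** The clasp arcs share the curvature measure: the substitution [v = conj u]
maps [m] copies of the lower arc to [k + l] copies of the upper one, because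
[m * b = (k + l) * a = tau]. *)
Let clasp_balance : - (eps * ((n + m%:R) * pi)) <=
  n * sint (force 0) (- a) a + m%:R * sint (hoop_force 0) (- b) b.
Proof.
have fi : sintegrable (force 0) (- a) a.
  by apply: (sintegrable_sub _ ac (force_integrable n0)); rewrite lerN2.
have [fi0 _] := gamma_force m1.
have [gi ->] := sint_even (ltW a0) fi; have [gi' ->] := sint_even (ltW b0) fi0.
have [hi ->] := conj_sint gi'.
have wa : density w th 0 a by apply: dth; [rewrite oppr_le0 ltW|exact: le_trans cH].
have wb : density w th 0 b by apply: dth => //; rewrite oppr_le0 ltW.
have [wi wE] := conj_sint wb.1.
have wsum := sintegrableD wa.1 wi.
rewrite -mulrDr -sintD//.
apply: (@le_trans _ _ (n * sint (fun u => - (2 * eps) * (w u + w (conj_param a b u))) 0 a)).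
  rewrite sintZ// sintD//; last exact: wa.1.
  rewrite [leRHS]mulrCA (mulrDr n) -wE (wa.2 0 a)// ?(ltW a0)// (wb.2 0 b)// ?(ltW b0)// angle0 !subr0.
  have ta : th a <= pi / 2.
    have /andP[] // : - (pi / 2) <= th a <= pi / 2.
    exact: angle_half_bounds.
  have tb : th b <= pi / 2.
    have /andP[] // : - (pi / 2) <= th b <= pi / 2.
    exact: angle_half_bounds.
  have h1 : n * th a <= n * (pi / 2) by rewrite ler_wpM2l.
  have h2 : m%:R * th b <= m%:R * (pi / 2) by rewrite ler_wpM2l.
  rewrite mulNr lerN2 [2 * eps]mulrC -mulrA ler_wpM2l//; lra.
rewrite ler_wpM2l//; apply: le_sint.
- exact: sintegrableZ.
- exact: sintegrableD.
- move=> u uI; have [u0 ua] := andP uI.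
  have /andP[v0 vb] := conj_bounds_oo a0 b0 uI.
  have uw : w u = arc_weight u.
    by rewrite weight_low// (le_trans (lerN10 _) (ltW u0)) (le_trans (ltW ua)).
  have vw : w (conj_param a b u) = arc_weight (conj_param a b u).
    by rewrite weight_low// (le_trans (lerN10 _) (ltW v0)) (le_trans (ltW vb)).
  rewrite !weightN -!mulrDl uw vw.
  exact: (clasp_push uI).
Qed.

Definition balance_bound : R := (n + m%:R) * pi + 2 * k%:R * m%:R + 2 * pi * (n ^+ 2 + m%:R ^+ 2).

(** The vertical components at the first tip cancel up to the [k] closed strands,
since [(k + l) * a = l * c = tau]; what remains is balanced by the struts
between the tips of the hoops. *)
Lemma dLen_ge : - (eps * balance_bound) <= dLen L xi.
Proof.
have kl : n = k%:R + l%:R by rewrite natrD.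
rewrite /dLen /= !big_sumType/=.
have A : \sum_(j < k) (sint (force 0) (- a) a + (2 * 1 - 2 * a) * up1 - 2 * upm - n * eps * (2 * pi)) <=
    \sum_(j < k) dLen_curve xi (alpha_curve k l m tau j).
  by apply: ler_sum => j _; exact: alpha_bound.
have B : \sum_(j < l) (sint (force 0) (- a) a + (2 * c - 2 * a) * up1 - n * eps * (2 * pi)) <=
    \sum_(j < l) dLen_curve xi (beta_curve k l m tau q1 j).
  by apply: ler_sum => j _; exact: beta_bound.
have C : \sum_(e < m) (sint (hoop_force 0) (- b) b - m%:R * eps * (2 * pi)) <=
    \sum_(e < m) dLen_curve xi (gamma_curve k l m tau q2 e).
  by apply: ler_sum => j _; exact: gamma_bound.
have tips : - (m%:R * eps) <= up1 - upm.
  apply: le_trans tips_bound.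
  by rewrite lerN2 ler_wpM2r// ler_nat leq_pred.
have {}tips : - (2 * k%:R * (m%:R * eps)) <= 2 * k%:R * (up1 - upm).
  by rewrite -mulrN ler_wpM2l// mulr_ge0.
have cl := clasp_balance.
have na : n * a = tau by rewrite mulrC divfK// gt_eqF ?n_gt0.
have lc : l%:R * c = tau by rewrite mulrC divfK// gt_eqF ?l_gt0.
have sumE (p : nat) (x : R) : \sum_(j < p) x = p%:R * x by rewrite sumr_const card_ord mulr_natl.
rewrite !sumE in A B C; rewrite /balance_bound.
exact: (total_arith kl na lc cl tips A B C).
Qed.

End Struts.

End LinkGeometry.

Theorem theorem4p1 (R : realType) (k l m : nat) (tau c1 c2 : R) :
  (1 <= l)%N -> (1 <= m)%N ->
  0 < tau -> tau <= Num.min m%:R l%:R ->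
  in_region (clasp_hopf k l m tau c1 c2) ->
  strongly_critical (clasp_hopf k l m tau c1 c2).
Proof.
move=> l1 m1 tau0; rewrite le_min => /andP[taum taul] inside.
have C0 : 0 <= balance_bound R k l m.
  have p0 := @pi_ge0 R; rewrite /balance_bound; apply: addr_ge0; first apply: addr_ge0.
  - by rewrite mulr_ge0// addr_ge0.
  - by rewrite !mulr_ge0.
  - by rewrite !mulr_ge0// addr_ge0// sqr_ge0.
have C1 : 0 < balance_bound R k l m + 1 by rewrite ltr_wpDl.
pose eps := (balance_bound R k l m + 1)^-1.
have eps0 : 0 < eps by rewrite invr_gt0.
exists eps => // xi compat len1; rewrite leNgt; apply/negP.
rewrite lt_min => /andP[tight _].
have taut x y : gehring_strut (clasp_hopf k l m tau c1 c2) x y ->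
    - eps <= dot (xi x - xi y) (direction (x - y)).
  move=> strut; rewrite -lee_fin; apply: (le_trans (ltW tight)).
  by apply: ereal_inf_lbound; exists x, y.
have := dLen_ge l1 m1 tau0 taum taul inside (ltW eps0) taut compat.
rewrite len1 lerN2 leNgt mulrC ltr_pdivrMr// mul1r ltrDl ltr01//.
Qed.
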